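(* Let $m\ge2$ be even and $\alpha,\beta\in[-\pi,\pi]$ with $\alpha\notin\{0,\pm\pi\}$. Then the fractional Clifford-Fourier transform $\mathcal F_{\alpha,\beta}$ is a continuous operator on $\mathcal S(\mathbb R^m)\otimes\mathcal{C}l_{0,m}$.
   Context: $\mathcal{C}l_{0,m}$ is the Clifford algebra generated by $e_1,\dots,e_m$ with $e_ie_j+e_je_i=0$ ($i\ne j$) and $e_i^2=-1$, with complex coefficients allowed. Vectors are written $\underline x=\sum_jx_je_j$, $\langle\underline x,\underline y\rangle=\sum_jx_jy_j$, and $\Gamma_{\underline y}=-\sum_{j<k}e_je_k(y_j\partial_{y_k}-y_k\partial_{y_j})$. $\mathcal S(\mathbb R^m)$ is the Schwartz space with its usual topology given by the semi-norms $\sup_{\underline x}|\underline x^\gamma\partial^\delta f(\underline x)|$ over multi-indices $\gamma,\delta$. The fractional Clifford-Fourier transform is $$\mathcal F_{\alpha,\beta}[f](\underline y)=\left(\pi(1-e^{-2i\alpha})\right)^{-m/2}\int_{\mathbb R^m}K_{\alpha,\beta}(\underline x,\underline y)\,f(\underline x)\,dx,\qquad K_{\alpha,\beta}(\underline x,\underline y)=e^{\frac i2(\cot\alpha)(|\underline x|^2+|\underline y|^2)}\,e^{i\beta\Gamma_{\underline y}}\left(e^{-i\langle\underline x,\underline y\rangle/\sin\alpha}\right),$$ where $e^{i\beta\Gamma_{\underline y}}$ acts in the variable $\underline y$ by the exponential series $\sum_{n\ge0}\frac{(i\beta)^n}{n!}\Gamma_{\underline y}^n$. *)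

(* Defs.v *)
From HB Require Import structures.
From mathcomp Require Import all_boot all_order all_algebra.
From mathcomp Require Import complex.

Set Implicit Arguments.
Unset Strict Implicit.
Unset Printing Implicit Defensive.

Import Order.TTheory GRing.Theory Num.Theory.

Local Open Scope ring_scope.

Section SetParity.
Variable m : nat.
Implicit Types A B C : {set 'I_m}.

Definition symdiff A B : {set 'I_m} := (A :\: B) :|: (B :\: A).

(* e_A e_B = (-1)^(swaps A B) e_(symdiff A B): sorting the product costs one
   sign for each pair b < a in A x B, and one more for each e_a e_a = -1. *)
Definition swaps A B : nat := (\sum_(a in A) \sum_(b in B) (b <= a))%N.

Lemma in_symdiff A B i : (i \in symdiff A B) = (i \in A) (+) (i \in B).
Proof. by rewrite !inE; case: (i \in A); case: (i \in B). Qed.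

Lemma symdiffA : associative symdiff.
Proof. by move=> A B C; apply/setP => i; rewrite !in_symdiff addbA. Qed.

Lemma symdiffC : commutative symdiff.
Proof. by move=> A B; apply/setP => i; rewrite !in_symdiff addbC. Qed.

Lemma symdiff0 : right_id set0 symdiff.
Proof. by move=> A; apply/setP => i; rewrite in_symdiff inE addbF. Qed.

Lemma sym0diff : left_id set0 symdiff.
Proof. by move=> A; rewrite symdiffC symdiff0. Qed.

Lemma symdiffv A : symdiff A A = set0.
Proof. by apply/setP => i; rewrite in_symdiff inE addbb. Qed.

Lemma symdiffK A : involutive (symdiff A).
Proof. by move=> B; rewrite symdiffA symdiffv sym0diff. Qed.

Lemma odd_swaps A B : odd (swaps A B) =
  \big[addb/false]_a \big[addb/false]_b [&& a \in A, b \in B & (b <= a)%N].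
Proof.
rewrite /swaps (big_morph odd oddD (erefl _)) big_mkcond/=.
apply: eq_bigr => a _; case: ifP => aA; last by rewrite big1.
rewrite (big_morph odd oddD (erefl _)) big_mkcond/=.
by apply: eq_bigr => b _; case: ifP => //=; case: leq.
Qed.

Lemma odd_swapsDl A B C :
  odd (swaps (symdiff A B) C) = odd (swaps A C) (+) odd (swaps B C).
Proof.
rewrite !odd_swaps -big_split/=; apply: eq_bigr => a _.
rewrite -big_split/=; apply: eq_bigr => b _.
by rewrite in_symdiff andb_addl.
Qed.

Lemma odd_swapsDr A B C :
  odd (swaps A (symdiff B C)) = odd (swaps A B) (+) odd (swaps A C).
Proof.
rewrite !odd_swaps -big_split/=; apply: eq_bigr => a _.
rewrite -big_split/=; apply: eq_bigr => b _.
by rewrite in_symdiff andb_addl andb_addr.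
Qed.

Lemma swaps0l A : swaps set0 A = 0%N.
Proof. by rewrite /swaps big_set0. Qed.

Lemma swaps0r A : swaps A set0 = 0%N.
Proof. by rewrite /swaps big1 // => a _; rewrite big_set0. Qed.

Lemma swaps1 (i j : 'I_m) : swaps [set i] [set j] = (j <= i)%N.
Proof. by rewrite /swaps !big_set1. Qed.

End SetParity.

(* x : clifford K m is \sum_A x A *: e_A, where e_A is the increasing product of
   the generators with index in A. *)
Definition clifford (K : comNzRingType) (m : nat) := {ffun {set 'I_m} -> K}.

HB.instance Definition _ (K : comNzRingType) m :=
  GRing.Zmodule.on (clifford K m).

Section CliffordAlgebra.
Variables (K : comNzRingType) (m : nat).
Implicit Types (x y z : clifford K m) (a b : K) (A B C : {set 'I_m}).

Definition cl_scale a x : clifford K m := [ffun A => a * x A].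

Lemma cl_scaleA a b x : cl_scale a (cl_scale b x) = cl_scale (a * b) x.
Proof. by apply/ffunP => A; rewrite !ffunE mulrA. Qed.

Lemma cl_scale1 : left_id 1 cl_scale.
Proof. by move=> x; apply/ffunP => A; rewrite !ffunE mul1r. Qed.

Lemma cl_scaleDr : right_distributive cl_scale +%R.
Proof. by move=> a x y; apply/ffunP => A; rewrite !ffunE mulrDr. Qed.

Lemma cl_scaleDl x : {morph cl_scale^~ x : a b / a + b}.
Proof. by move=> a b; apply/ffunP => A; rewrite !ffunE mulrDl. Qed.

HB.instance Definition _ := GRing.Zmodule_isLmodule.Build K (clifford K m)
  cl_scaleA cl_scale1 cl_scaleDr cl_scaleDl.

Definition cl_basis A : clifford K m := [ffun B => (B == A)%:R].

(* The pairs (A, B) with symdiff A B = C are the pairs (A, symdiff A C). *)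
Definition cl_mul x y : clifford K m := [ffun C =>
  \sum_(A : {set 'I_m})
    (-1) ^+ swaps A (symdiff A C) * (x A * y (symdiff A C))].

Let signE A B : (-1) ^+ swaps A B = (-1) ^+ odd (swaps A B) :> K.
Proof. by rewrite signr_odd. Qed.

Lemma cl_mulA : associative cl_mul.
Proof.
move=> x y z; apply/ffunP => C; rewrite !ffunE; apply/esym.
under eq_bigr do rewrite ffunE mulr_suml mulr_sumr.
rewrite exchange_big/=; apply: eq_bigr => A _.
rewrite ffunE !mulr_sumr (reindex_inj (can_inj (symdiffK A)))/=.
apply: eq_bigr => B _; rewrite symdiffK.
have -> : symdiff (symdiff A B) C = symdiff B (symdiff A C).
  by rewrite (symdiffC A) symdiffA.
set s1 := _ ^+ _; set s2 := _ ^+ _; set s3 := _ ^+ _; set s4 := _ ^+ _.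
suff s1234 : s1 * s2 = s3 * s4.
  by rewrite [x A * (s4 * _)]mulrCA !mulrA s1234.
rewrite /s1 /s2 /s3 /s4 !signE -!signr_addb; congr (_ ^+ _).
rewrite !odd_swapsDl !odd_swapsDr.
by case: (odd (swaps A A)); case: (odd (swaps A B)); case: (odd (swaps A C));
  case: (odd (swaps B A)); case: (odd (swaps B B)); case: (odd (swaps B C)).
Qed.

Lemma cl_mul1l : left_id (cl_basis set0) cl_mul.
Proof.
move=> x; apply/ffunP => C; rewrite !ffunE (bigD1 set0)//= big1 ?addr0.
  by rewrite sym0diff swaps0l ffunE eqxx !mul1r.
by move=> A /negPf A0; rewrite ffunE A0 mul0r mulr0.
Qed.

Lemma cl_mul1r : right_id (cl_basis set0) cl_mul.
Proof.
move=> x; apply/ffunP => C; rewrite !ffunE (bigD1 C)//= big1 ?addr0.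
  by rewrite symdiffv swaps0r ffunE eqxx mulr1 mul1r.
move=> A /negPf AC; rewrite ffunE; case: eqP => [A0|]; last by rewrite !mulr0.
by move: AC; rewrite -(symdiffK A C) A0 symdiff0 eqxx.
Qed.

Lemma cl_mulDl : left_distributive cl_mul +%R.
Proof.
move=> x y z; apply/ffunP => C; rewrite !ffunE -big_split; apply: eq_bigr => A _.
by rewrite ffunE /= mulrDl mulrDr.
Qed.

Lemma cl_mulDr : right_distributive cl_mul +%R.
Proof.
move=> x y z; apply/ffunP => C; rewrite !ffunE -big_split; apply: eq_bigr => A _.
by rewrite ffunE /= !mulrDr.
Qed.

Lemma cl_1neq0 : cl_basis set0 != 0.
Proof.
apply/eqP => /ffunP /(_ set0); rewrite !ffunE eqxx => /eqP.
by rewrite oner_eq0.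
Qed.

HB.instance Definition _ := GRing.Zmodule_isNzRing.Build (clifford K m)
  cl_mulA cl_mul1l cl_mul1r cl_mulDl cl_mulDr cl_1neq0.

Lemma cl_scaleAl a x y : a *: (x * y) = (a *: x) * y.
Proof.
apply/ffunP => C; rewrite !ffunE mulr_sumr; apply: eq_bigr => A _.
by rewrite ffunE mulrCA; congr (_ * _); rewrite mulrA.
Qed.

HB.instance Definition _ :=
  GRing.Lmodule_isLalgebra.Build K (clifford K m) cl_scaleAl.

Lemma cl_scaleAr a x y : a *: (x * y) = x * (a *: y).
Proof.
apply/ffunP => C; rewrite !ffunE mulr_sumr; apply: eq_bigr => A _.
by rewrite ffunE mulrCA; congr (_ * _); rewrite mulrCA.
Qed.

HB.instance Definition _ :=
  GRing.Lalgebra_isAlgebra.Build K (clifford K m) cl_scaleAr.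

Definition cl_gen (i : 'I_m) : clifford K m := cl_basis [set i].

Lemma cl_basisM A B :
  cl_basis A * cl_basis B = (-1) ^+ swaps A B *: cl_basis (symdiff A B).
Proof.
apply/ffunP => C; rewrite !ffunE (bigD1 A)//= big1 ?addr0; last first.
  by move=> D /negPf DA; rewrite ffunE DA mul0r mulr0.
rewrite !ffunE eqxx mul1r (can2_eq (symdiffK A) (symdiffK A)).
by case: eqP => [->|]; rewrite ?mulr0 ?symdiffK.
Qed.

Lemma cl_gen_sqr i : cl_gen i * cl_gen i = -1.
Proof. by rewrite /cl_gen cl_basisM swaps1 leqnn symdiffv expr1 scaleN1r. Qed.

Lemma cl_gen_anti i j : i != j -> cl_gen i * cl_gen j + cl_gen j * cl_gen i = 0.
Proof.
move=> ij; rewrite /cl_gen !cl_basisM !swaps1 symdiffC -scalerDl.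
by case: ltngtP ij => [||/val_inj->] /=; rewrite ?eqxx// ?addNr ?subrr scale0r.
Qed.

(* The canonical basis consists of the increasing products of generators. *)
Lemma cl_basis_cons (i : 'I_m) A : {in A, forall j : 'I_m, (i < j)%N} ->
  cl_gen i * cl_basis A = cl_basis (i |: A).
Proof.
move=> iA; rewrite /cl_gen cl_basisM.
have -> : symdiff [set i] A = i |: A.
  apply/setP => j; rewrite in_symdiff !inE.
  case: eqP => [->|//]; case: (boolP (i \in A)) => // /iA.
  by rewrite ltnn.
suff -> : swaps [set i] A = 0%N by rewrite scale1r.
by rewrite /swaps big_set1 big1// => j /iA ij; rewrite leqNgt ij.
Qed.

Lemma clifford_sum x : x = \sum_A x A *: cl_basis A.
Proof.
apply/ffunP => B; rewrite sum_ffunE (bigD1 B)//= big1 ?addr0.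
  by rewrite !ffunE eqxx mulr1.
by move=> A /negPf AB; rewrite !ffunE eq_sym AB mulr0.
Qed.

End CliffordAlgebra.

From mathcomp Require Import all_classical all_reals all_analysis.
Import numFieldNormedType.Exports.

Local Open Scope classical_set_scope.

Section LebesgueTuple.
Variable R : realType.
Local Notation RR := (measurableTypeR R).

Definition tcons n (p : RR * n.-tuple RR) : n.+1.-tuple RR :=
  [tuple of p.1 :: p.2].

Fixpoint lebesgue_tuple (n : nat) : set (n.-tuple RR) -> \bar R :=
  match n with
  | 0 => \d_([tuple] : 0.-tuple RR)
  | k.+1 => pushforward (lebesgue_measure \x lebesgue_tuple (n := k))%E
              (@tcons k)
  end.

Lemma measurable_tcons n : measurable_fun setT (@tcons n).
Proof. exact: measurable_cons. Qed.

Section Step.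
Variables (n : nat) (mu : {sigma_finite_measure set (n.-tuple RR) -> \bar R}).

Definition tuple_step : set (n.+1.-tuple RR) -> \bar R :=
  pushforward (lebesgue_measure \x mu)%E (@tcons n).

Let nu : {measure set (n.+1.-tuple RR) -> \bar R} :=
  measure_function_pushforward__canonical__measure_function_Measure
    (lebesgue_measure \x mu)%E (@measurable_tcons n).

HB.instance Definition _ := Measure.copy tuple_step nu.

Let tuple_step_sigma_finite : sigma_finite setT tuple_step.
Proof.
pose g (t : n.+1.-tuple RR) : (RR * n.-tuple RR)%type := (thead t, [tuple of behead t]).
have gK : cancel g (@tcons n) by move=> t; rewrite /tcons/= -tuple_eta.
have Kg : cancel (@tcons n) g.
  move=> [x t]; rewrite /g theadE/=; congr pair; exact: val_inj.
have mg : measurable_fun setT g.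
  apply/measurable_fun_pairP; split; first exact: measurable_tnth.
  exact: measurable_behead.
have /sigma_finiteP[F [TF ndF Foo]] := sigma_finiteT (@lebesgue_measure R).
have /sigma_finiteP[G [TG ndG Goo]] := sigma_finiteT mu.
exists (fun k => g @^-1` (F k `*` G k)).
  apply/seteqP; split=> // t _.
  have [i _ Fi] : (\bigcup_i F i) (g t).1 by rewrite -TF.
  have [j _ Gj] : (\bigcup_i G i) (g t).2 by rewrite -TG.
  exists (maxn i j) => //; split => /=.
    by move: Fi; apply/subsetPset/ndF/leq_maxl.
  by move: Gj; apply/subsetPset/ndG/leq_maxr.
move=> k; have [mFk Fk] := Foo k; have [mGk Gk] := Goo k; split.
  by rewrite -[X in measurable X]setTI; apply: mg => //; exact: measurableX.
rewrite /tuple_step /pushforward (_ : _ @^-1` _ = F k `*` G k); last first.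
  by rewrite -comp_preimage (_ : g \o _ = id)//; apply/funext.
by rewrite product_measure1E// lte_mul_pinfty// ge0_fin_numE.
Qed.

HB.instance Definition _ := Measure_isSigmaFinite.Build _ _ _
  tuple_step tuple_step_sigma_finite.

End Step.

Let exists_sigma_finite_measure n :
  exists mu : {sigma_finite_measure set (n.-tuple RR) -> \bar R},
    @lebesgue_tuple n = mu.
Proof.
elim: n => [|n [mu IH]]; first by exists (\d_([tuple] : 0.-tuple RR)).
by exists (tuple_step mu); rewrite /= IH.
Qed.

Let lebesgue_tuple0 n : lebesgue_tuple (@set0 (n.-tuple RR)) = 0%E.
Proof. by have [mu ->] := exists_sigma_finite_measure n. Qed.

Let lebesgue_tuple_ge0 n (A : set (n.-tuple RR)) : (0 <= lebesgue_tuple A)%E.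
Proof. by have [mu ->] := exists_sigma_finite_measure n. Qed.

Let lebesgue_tuple_semi_sigma_additive n :
  semi_sigma_additive (@lebesgue_tuple n).
Proof.
have [mu ->] := exists_sigma_finite_measure n.
exact: measure_semi_sigma_additive.
Qed.

HB.instance Definition _ n := isMeasure.Build _ _ _ (@lebesgue_tuple n)
  (@lebesgue_tuple0 n) (@lebesgue_tuple_ge0 n)
  (@lebesgue_tuple_semi_sigma_additive n).

Let lebesgue_tuple_sigma_finite n : sigma_finite setT (@lebesgue_tuple n).
Proof.
by have [mu ->] := exists_sigma_finite_measure n; exact: sigma_finiteT.
Qed.

HB.instance Definition _ n := Measure_isSigmaFinite.Build _ _ _
  (@lebesgue_tuple n) (@lebesgue_tuple_sigma_finite n).

Lemma lebesgue_tuple_box n (A : 'I_n -> set RR) :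
  (forall i, measurable (A i)) ->
  lebesgue_tuple [set t : n.-tuple RR | forall i, A i (tnth t i)] =
  (\prod_i lebesgue_measure (A i))%E.
Proof.
elim: n A => [|n IH] A mA.
  rewrite big_ord0 /= diracE mem_set//= => -[]//.
rewrite big_ord_recl -IH// /= /pushforward.
rewrite -product_measure1E//.
- congr (_ _); apply/seteqP; split => -[x t] /=.
    move=> H; split; first by have := H ord0; rewrite tnth0.
    by move=> i; have := H (lift ord0 i); rewrite tnthS.
  move=> [Ax At] i; case: (unliftP ord0 i) => [j ->|->].
    by rewrite tnthS.
  by rewrite tnth0.
- rewrite (_ : mkset _ = \bigcap_(i in [set: 'I_n])
      ((fun t : n.-tuple RR => tnth t i) @^-1` A (lift ord0 i))).
    apply: fin_bigcap_measurable; first exact: finite_finset.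
    move=> i _; rewrite -[X in measurable X]setTI.
    exact: measurable_tnth.
  by apply/seteqP; split => t /= H i; [move=> _|]; apply: H.
Qed.

End LebesgueTuple.

Section Coordinates.
Variable R : realType.

(* Derivatives, limits and integrals of complex- and Clifford-valued functions
   are taken on real coordinates. *)
Definition reim T (Phi : (T -> R) -> R) (f : T -> R[i]) : R[i] :=
  Complex (Phi (fun t => complex.Re (f t))) (Phi (fun t => complex.Im (f t))).

Definition reim_all T (P : (T -> R) -> Prop) (f : T -> R[i]) : Prop :=
  P (fun t => complex.Re (f t)) /\ P (fun t => complex.Im (f t)).

Definition cl_reim m T (Phi : (T -> R) -> R) (f : T -> clifford R[i] m) :
    clifford R[i] m :=
  [ffun A => reim Phi (fun t => f t A)].

Definition cl_reim_all m T (P : (T -> R) -> Prop) (f : T -> clifford R[i] m) : Prop :=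
  forall A, reim_all P (fun t => f t A).

End Coordinates.

Section Schwartz.
Variables (R : realType) (m : nat).
Implicit Types (f g : 'rV[R]_m -> R[i]) (gam del : 'I_m -> nat).

Definition cpartial (j : 'I_m) f : 'rV[R]_m -> R[i] :=
  fun x => reim (fun u => 'D_(delta_mx 0 j) u x) f.

Definition cdifferentiable f (x : 'rV[R]_m) : Prop :=
  reim_all (fun u => differentiable u x) f.

(* All iterated partial derivatives, in any order, exist and are
   differentiable. *)
Definition csmooth f : Prop := forall (s : seq 'I_m) (x : 'rV[R]_m),
  cdifferentiable (foldr cpartial f s) x.

Definition mpartial del f : 'rV[R]_m -> R[i] :=
  foldr (fun j => iter (del j) (cpartial j)) f (enum 'I_m).

Definition seminorm gam del f : \bar R :=
  ereal_sup (range (fun x : 'rV[R]_m =>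
    (Normc.normc ((\prod_j x 0 j ^+ gam j)%:C%C * mpartial del f x))%:E)).

Definition is_schwartz f : Prop :=
  csmooth f /\ forall gam del, (seminorm gam del f < +oo)%E.

Lemma cRe_linear (a : R[i]) f g : (fun t => complex.Re (a * f t + g t)) =
  (complex.Re a *: (fun t => complex.Re (f t))) -
  (complex.Im a *: (fun t => complex.Im (f t))) + (fun t => complex.Re (g t)).
Proof.
by apply/funext => t; rewrite !fctE; case: a (f t) (g t) => [? ?] [? ?] [? ?].
Qed.

Lemma cIm_linear (a : R[i]) f g : (fun t => complex.Im (a * f t + g t)) =
  (complex.Re a *: (fun t => complex.Im (f t))) +
  (complex.Im a *: (fun t => complex.Re (f t))) + (fun t => complex.Im (g t)).
Proof.
by apply/funext => t; rewrite !fctE; case: a (f t) (g t) => [? ?] [? ?] [? ?].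
Qed.

Lemma cdifferentiableP (a : R[i]) f g x :
  cdifferentiable f x -> cdifferentiable g x ->
  cdifferentiable (fun x => a * f x + g x) x.
Proof.
move=> [? ?] [? ?]; rewrite /cdifferentiable /reim_all cRe_linear cIm_linear.
split; apply: differentiableD => //.
  by apply: differentiableB; exact: differentiableZ.
by apply: differentiableD; exact: differentiableZ.
Qed.

Lemma cpartialP (a : R[i]) f g j :
  (forall x, cdifferentiable f x) -> (forall x, cdifferentiable g x) ->
  cpartial j (fun x => a * f x + g x) =
    (fun x => a * cpartial j f x + cpartial j g x).
Proof.
move=> df dg; apply/funext => x; have [f1 f2] := df x; have [g1 g2] := dg x.
have dZ (c : R) (u : 'rV[R]_m -> R) : differentiable u x ->
    derivable (c *: u) x (delta_mx 0 j).
  by move=> du; apply/derivableZ/diff_derivable.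
rewrite /cpartial /reim cRe_linear cIm_linear.
rewrite deriveD; [|apply: derivableB; exact: dZ|exact: diff_derivable].
rewrite deriveB; [|exact: dZ|exact: dZ].
rewrite deriveD; [|apply: derivableD; exact: dZ|exact: diff_derivable].
rewrite deriveD; [|exact: dZ|exact: dZ].
rewrite !deriveZ; try exact: diff_derivable.
by case: a.
Qed.

Lemma foldr_cpartialP (a : R[i]) f g s : csmooth f -> csmooth g ->
  foldr cpartial (fun x => a * f x + g x) s =
  (fun x => a * foldr cpartial f s x + foldr cpartial g s x).
Proof.
by move=> sf sg; elim: s => //= j s ->; rewrite cpartialP.
Qed.

Lemma csmoothP (a : R[i]) f g : csmooth f -> csmooth g ->
  csmooth (fun x => a * f x + g x).
Proof.
move=> sf sg s x; rewrite foldr_cpartialP//.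
by apply: cdifferentiableP; [exact: sf|exact: sg].
Qed.

(* An iterated partial derivative is one along a sequence of directions. *)
Lemma mpartialE del : exists s, forall f, mpartial del f = foldr cpartial f s.
Proof.
exists (flatten [seq nseq (del j) j | j <- enum 'I_m]) => f.
rewrite /mpartial; elim: (enum 'I_m) => //= j s ->.
by rewrite foldr_cat; elim: (del j) => //= n ->.
Qed.

Lemma seminorm_ge gam del f (x : 'rV[R]_m) :
  ((Normc.normc ((\prod_j x 0 j ^+ gam j)%:C%C * mpartial del f x))%:E
    <= seminorm gam del f)%E.
Proof. by apply: ereal_sup_ubound; exists x. Qed.

Lemma is_schwartzP (a : R[i]) f g : is_schwartz f -> is_schwartz g ->
  is_schwartz (fun x => a * f x + g x).
Proof.
move=> [sf bf] [sg bg]; split=> [|gam del]; first exact: csmoothP.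
have [s E] := mpartialE del.
have finp h : (seminorm gam del h < +oo)%E -> seminorm gam del h \is a fin_num.
  move=> h_oo; rewrite ge0_fin_numE//; apply: le_trans (seminorm_ge _ _ _ 0).
  by rewrite lee_fin; case: (_ * _) => ? ?; rewrite sqrtr_ge0.
have ff := finp _ (bf gam del); have fg := finp _ (bg gam del).
apply: (@le_lt_trans _ _ ((Normc.normc a)%:E * seminorm gam del f +
    seminorm gam del g)%E); last first.
  by rewrite ltey_eq fin_numD fg fin_numM.
apply: ge_ereal_sup => _ [x _ <-].
rewrite E foldr_cpartialP// -E mulrDr -E.
apply: (@le_trans _ _ (Normc.normc a * Normc.normc (
    (\prod_j x 0 j ^+ gam j)%:C%C * mpartial del f x) + Normc.normc (
    (\prod_j x 0 j ^+ gam j)%:C%C * mpartial del g x))%:E).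
  rewrite lee_fin -Normc.normcM mulrCA; exact: le_normcD.
rewrite EFinD EFinM leeD ?seminorm_ge//; apply: lee_wpmul2l; last exact: seminorm_ge.
by rewrite lee_fin; case: (a) => ? ?; rewrite sqrtr_ge0.
Qed.

Definition schwartz_pred : {pred 'rV[R]_m -> clifford R[i] m} :=
  fun F => `[< forall A, is_schwartz (fun x => F x A) >].

Let schwartz_closed : subsemimod_closed schwartz_pred.
Proof.
have schwartz0 : 0 \in schwartz_pred.
  apply/asboolP => A.
  have -> : (fun x => (0 : 'rV[R]_m -> clifford R[i] m) x A) = cst 0.
    by apply/funext => x; rewrite !fctE ffunE.
  have E s : foldr cpartial (cst 0) s = cst 0.
    elim: s => //= j s ->; apply/funext => x.
    by rewrite /cpartial /reim/= !derive_cst.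
  split=> [s x|gam del].
    by rewrite E; split; exact: differentiable_cst.
  rewrite /seminorm; have [s ->] := mpartialE del.
  apply: (@le_lt_trans _ _ 0%E) => //; apply: ge_ereal_sup => _ [x _ <-].
  by rewrite E mulr0 /= expr0n /= addr0 sqrtr0.
have schwartzP a : {in schwartz_pred &, forall F G,
    a *: F + G \in schwartz_pred}.
  move=> F G /asboolP sF /asboolP sG; apply/asboolP => A.
  have -> : (fun x => (a *: F + G) x A) = (fun x => a * F x A + G x A).
    by apply/funext => x; rewrite !fctE !ffunE.
  exact: is_schwartzP.
split; first split=> //.
- by move=> F G sF sG; rewrite -[F]scale1r schwartzP.
- by move=> a F sF; rewrite -[_ *: _]addr0 schwartzP.
Qed.

HB.instance Definition _ := GRing.isSubmodClosed.Build R[i]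
  ('rV[R]_m -> clifford R[i] m) schwartz_pred schwartz_closed.

(* S(R^m) (x) Cl_(0,m): the functions \sum_A f_A e_A with every f_A in S(R^m). *)
Record schwartz := Schwartz {
  schwartz_fun :> 'rV[R]_m -> clifford R[i] m;
  schwartzP : schwartz_fun \in schwartz_pred }.

HB.instance Definition _ := [isSub for schwartz_fun].
HB.instance Definition _ := [Choice of schwartz by <:].
HB.instance Definition _ := [SubChoice_isSubLmodule of schwartz by <:].

(* Balls of the seminorms F |-> seminorm gam del F_A, which generate the product
   topology of S(R^m) over the finitely many coordinates A. *)
Definition schwartz_subbase : set (set schwartz) :=
  [set B | exists gam del A (F : schwartz) (e : R),
    B = [set G : schwartz |
          (seminorm gam del (fun x => ((G x - F x) A)%R) < e%:E)%E]].

HB.instance Definition _ :=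
  isSubBaseTopological.Build schwartz schwartz_subbase id.

End Schwartz.

Section CliffordFourier.
Variables (R : realType) (m : nat).
Implicit Types (alpha beta : R) (x y : 'rV[R]_m).
Local Notation Cl := (clifford R[i] m).

Definition expi (t : R) : R[i] := Complex (cos t) (sin t).

Definition dotp x y : R := \sum_j x 0 j * y 0 j.

Definition cl_partial (j : 'I_m) (g : 'rV[R]_m -> Cl) : 'rV[R]_m -> Cl :=
  fun y => cl_reim (fun u => 'D_(delta_mx 0 j) u y) g.

Definition Gamma (g : 'rV[R]_m -> Cl) : 'rV[R]_m -> Cl := fun y =>
  - \sum_(j < m) \sum_(k < m | (j < k)%N) cl_gen _ j * cl_gen _ k *
      ((y 0 j)%:C%C *: cl_partial k g y - (y 0 k)%:C%C *: cl_partial j g y).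

Definition exp_Gamma_series beta (g : 'rV[R]_m -> Cl) y : Cl ^nat :=
  series (fun n => (Complex 0 beta ^+ n / n`!%:R) *: iter n Gamma g y).

Definition exp_Gamma beta (g : 'rV[R]_m -> Cl) y : Cl :=
  cl_reim (fun u => limn u) (exp_Gamma_series beta g y).

Definition plane_wave alpha x : 'rV[R]_m -> Cl :=
  fun y => (expi (- (dotp x y / sin alpha)))%:A.

Definition cf_kernel alpha beta x y : Cl :=
  expi (2^-1 * (cos alpha / sin alpha) * (dotp x x + dotp y y)) *:
    exp_Gamma beta (plane_wave alpha x) y.

Definition row_of_tuple (t : m.-tuple (measurableTypeR R)) : 'rV[R]_m :=
  \row_j tnth t j.

Definition cl_integrable (F : 'rV[R]_m -> Cl) : Prop :=
  cl_reim_all (fun u => (@lebesgue_tuple R m).-integrable setT (EFin \o u))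
    (F \o row_of_tuple).

Definition cl_integral (F : 'rV[R]_m -> Cl) : Cl :=
  cl_reim (fun u => \int[@lebesgue_tuple R m]_t u t)%R (F \o row_of_tuple).

(* Meaningful for m even only, where the exponent -m/2 is an integer. *)
Definition cf_transform alpha beta (f : 'rV[R]_m -> Cl) : 'rV[R]_m -> Cl :=
  fun y => (pi%:C%C * (1 - expi (- (2 * alpha)))) ^- m./2 *:
    cl_integral (fun x => cf_kernel alpha beta x y * f x).

End CliffordFourier.

(* Main.v *)
From HB Require Import structures.
Require Import Defs.
From mathcomp Require Import all_boot all_order all_algebra.
From mathcomp Require Import complex.
From mathcomp Require Import all_classical all_reals all_analysis.
From mathcomp Require Import finmap measurable_realfun ring lra.
Set Implicit Arguments.
Unset Strict Implicit.
Unset Printing Implicit Defensive.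
Import Order.TTheory GRing.Theory Num.Theory.
Import numFieldNormedType.Exports.
Local Open Scope ring_scope.
Local Open Scope classical_set_scope.

(** The transform is, coordinate by coordinate, a finite sum of operators of the
    form chirp, integral operator, chirp, where the chirp is multiplication by
    exp (i kappa |x|^2) and the kernel of the integral operator is a coordinate of
    the wave U(x, y, t) = e^{i t Gamma_y} e^{i c <x,y>} at t = beta, with
    c = - 1 / sin alpha. Everything rests on knowing this wave well enough.

    In even dimension the wave is elementary. With s = <x,y>, q = |x|^2 |y|^2 and
    omega = y x + s one can write U = F + omega G, where F and G are scalar functions
    of s, q and t. In dimension 2 they are built from exp (i c s cos t) and from the
    functions C_j of c^2 (q - s^2) sin^2 t, where C_0 (z) = cos (sqrt z) and
    C_(j+1) = C_j'; the pair of dimension m + 2 is obtained from that of dimension m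
    by a derivative in s ([wave_pair], [wave_pair_pde]). Since Gamma_y is minus the
    sum of y times the Dirac operator and of the Euler operator, a computation in
    the Clifford algebra gives dU/dt = i Gamma_y U ([wave_pde]).

    The functions involved are sums and products of linear forms and of functions
    c_j o g, where the c_j are successive derivatives of one another and are bounded
    by 1 on the range of g. For C_j the bound holds on the half line, and q - s^2 is
    nonnegative by Cauchy-Schwarz. Such functions are called tame below. They are
    smooth, all their derivatives are tame, they grow polynomially ([tame_growth])
    and their Taylor series converge along every line ([tame_taylor]). The Taylor
    series of U in t is the exponential series of Gamma_y, so the latter converges
    to U ([exp_Gamma_cvg]); polynomial growth makes the transform integral of a
    Schwartz function converge.

    Growth of the kernel gives growth of the transform, not decay. Decay comes from
    the equation Delta_x U = - c^2 |y|^2 U ([wave_helmholtz]): both sides evolve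
    under i Gamma_y and agree at t = 0. Integrating by parts, a factor |y|^2 in front
    of the transform becomes a Laplacian on the Schwartz function. A derivative of U
    in y satisfies the same equation up to a remainder of lower order, so that by
    induction it also gives a rapidly decreasing integral ([oscillating_decaying]).
    Since integrals of this type may be differentiated under the integral sign, every
    Schwartz seminorm of the transform is bounded by finitely many seminorms of the
    function ([oscillating_schwartz_op]), which is the asserted continuity
    ([coord_bound_continuous]). *)

(** * Directional derivatives and tame functions *)

Section DirectionalDerivatives.
Variable R : realType.

(** Partial derivatives are derivatives of restrictions to a slice: i embeds the
    slice affinely and sends the direction v to w. *)
Lemma derive_slice (V W : normedModType R) (i : V -> W) (v : V) (w : W)
    (f : W -> R) y : (forall h z, i (h *: v + z) = h *: w + i z) ->
  'D_v (f \o i) y = 'D_w f (i y).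
Proof.
move=> iE; rewrite /derive.
rewrite (_ : (fun h => _) = (fun h => h^-1 *: ((f \o shift (i y)) (h *: w) - f (i y))))//.
by apply/funext => h /=; rewrite iE.
Qed.

Lemma derivable_slice (V W : normedModType R) (i : V -> W) (v : V) (w : W)
    (f : W -> R) y : (forall h z, i (h *: v + z) = h *: w + i z) ->
  derivable f (i y) w -> derivable (f \o i) y v.
Proof.
move=> iE; rewrite /derivable => df.
rewrite (_ : (fun h => _) = (fun h => h^-1 *: ((f \o shift (i y)) (h *: w) - f (i y))))//.
by apply/funext => h /=; rewrite iE.
Qed.

Lemma is_derive_line (V : normedModType R) (f : V -> R) (v w : V) (t : R) :
  derivable f (v + t *: w) w ->
  is_derive t (1 : R) (fun h : R => f (v + h *: w)) ('D_w f (v + t *: w)).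
Proof.
move=> df.
have E (h z : R) : v + (h *: 1 + z) *: w = h *: w + (v + z *: w).
  by rewrite scalerDl addrCA /GRing.scale/= mulr1.
split; first exact: (derivable_slice (i := fun h : R => v + h *: w) (w := w)).
exact: (derive_slice (i := fun h : R => v + h *: w)).
Qed.

Lemma differentiable_eps (V : normedModType R) (G : V -> R) x :
  differentiable G x -> forall e : R, 0 < e -> exists2 d : R, 0 < d &
  forall k : V, `|k| < d -> `|G (k + x) - G x - 'D_k G x| <= e * `|k|.
Proof.
move=> dG e e0; have /eqaddoP/(_ e e0) := diff_locally dG.
rewrite near_simpl => /nbhs_ballP[d /= d0 dP]; exists d => // k kd.
have := dP k; rewrite -ball_normE /= sub0r normrN => /(_ kd).
by rewrite deriveE// !fctE opprD addrA.
Qed.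

(** The mean value theorem in the direction u reduces the second difference to a
    first difference of the derivative, where differentiability applies. The left
    hand side is symmetric in u and w, whence [derive_symmetric]. *)
Let symmetric_difference (V : normedModType R) (f : V -> R) (x u w : V) :
  (forall y, derivable f y u) -> differentiable ('D_u f) x ->
  forall e : R, 0 < e -> exists2 d : R, 0 < d & forall h : R, 0 < h -> h < d ->
  `|(f (h *: u + h *: w + x) - f (h *: w + x) - f (h *: u + x) + f x) / h
    - h * 'D_w ('D_u f) x| <= h * e.
Proof.
move=> df dG e e0; set N := `|u| + `|w| + 1.
have N0 : 0 < N by rewrite ltr_wpDl// addr_ge0.
(* both displacements below have norm at most h N, and two errors add up *)
have [d d0 dP] := differentiable_eps dG (divr_gt0 e0 (mulr_gt0 (ltr0n R 2) N0)).
exists (d / N); first by rewrite divr_gt0.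
move=> h h0; rewrite ltr_pdivlMr// => hd.
(* the second difference is the increment of phi between 0 and h *)
pose phi (t : R) := f ((h *: w + x) + t *: u) - f (x + t *: u).
have dphi t : is_derive t (1 : R) phi
    ('D_u f ((h *: w + x) + t *: u) - 'D_u f (x + t *: u)).
  by apply: is_deriveB; exact: is_derive_line.
have [|xi xih] := MVT h0 (fun t _ => dphi t).
  apply: derivable_within_continuous => t _; exact: ex_derive.
rewrite /phi subr0 !scale0r !addr0 => E.
have -> : f (h *: u + h *: w + x) - f (h *: w + x) - f (h *: u + x) + f x =
    f (h *: w + x + h *: u) - f (x + h *: u) - (f (h *: w + x) - f x).
  have e1 : h *: u + h *: w + x = h *: w + x + h *: u by rewrite -addrA addrC.
  by rewrite e1 [h *: u + x]addrC; ring.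
rewrite E mulfK ?gt_eqF//.
move: xih; rewrite in_itv/= => /andP[xi0 xih].
have nu : `|xi *: u| <= h * `|u|.
  by rewrite normrZ ler_wpM2r// ger0_norm ltW.
have nw : `|h *: w| = h * `|w| by rewrite normrZ gtr0_norm.
have n1 : `|xi *: u| <= h * N.
  by apply: le_trans nu _; rewrite ler_pM2l// /N; have := normr_ge0 w; lra.
have n2 : `|xi *: u + h *: w| <= h * N.
  apply: le_trans (ler_normD _ _) _; rewrite nw; apply: le_trans (lerD nu (lexx _)) _.
  by rewrite -mulrDr ler_pM2l// /N; lra.
have k1 := dP _ (le_lt_trans n1 hd); have k2 := dP _ (le_lt_trans n2 hd).
have eN : e / (2 * N) * (h * N) = h * e / 2 by field; rewrite gt_eqF.
have e20 : 0 <= e / (2 * N) by rewrite divr_ge0// ?mulr_ge0// ltW.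
have {}k1 := le_trans k1 (ler_wpM2l e20 n1).
have {}k2 := le_trans k2 (ler_wpM2l e20 n2).
have DE : 'D_(xi *: u + h *: w) ('D_u f) x =
    'D_(xi *: u) ('D_u f) x + h * 'D_w ('D_u f) x.
  by rewrite !deriveE// linearD; congr (_ + _); exact: linearZ.
have -> : h *: w + x + xi *: u = xi *: u + h *: w + x by rewrite addrC addrA.
rewrite [x + xi *: u]addrC.
move: k1 k2; rewrite eN DE.
set A := 'D_u f (xi *: u + x); set B := 'D_u f (xi *: u + h *: w + x).
set C := 'D_(xi *: u) _ _; set D := h * 'D_w _ _.
move=> k1 k2.
have -> : B - A - D = (B - 'D_u f x - (C + D)) - (A - 'D_u f x - C) by ring.
by apply: le_trans (ler_normB _ _) _; rewrite [leRHS]splitr; exact: lerD k2 k1.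
Qed.

(** Young's form of the symmetry of second derivatives: both sides are limits of the
    same second difference quotient. *)
Lemma derive_symmetric (V : normedModType R) (f : V -> R) (x u w : V) :
  (forall y, derivable f y u) -> (forall y, derivable f y w) ->
  differentiable ('D_u f) x -> differentiable ('D_w f) x ->
  'D_w ('D_u f) x = 'D_u ('D_w f) x.
Proof.
move=> fu fw du dw; apply/eqP; rewrite -subr_eq0 -normr_le0.
apply/ler_addgt0Pl => e e0; rewrite addr0.
have e20 : 0 < e / 2 by rewrite divr_gt0.
have [d1 d10 P1] := symmetric_difference w fu du e20.
have [d2 d20 P2] := symmetric_difference u fw dw e20.
pose h := Num.min d1 d2 / 2.
have m0 : 0 < Num.min d1 d2 by rewrite lt_min d10.
have h0 : 0 < h by rewrite divr_gt0.
have [hd1 hd2] : h < d1 /\ h < d2.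
  have : h < Num.min d1 d2 by rewrite /h; lra.
  by rewrite lt_min => /andP.
clearbody h; have {}P1 := P1 h h0 hd1; have {}P2 := P2 h h0 hd2.
move: P1 P2; rewrite [h *: w + h *: u]addrC.
set a := _ / h; set b := _ / h.
have -> : b = a by rewrite /a /b; congr (_ / _); ring.
set A := 'D_w _ _; set B := 'D_u _ _ => P1 P2; clearbody a A B.
have : `|h * (A - B)| <= h * e.
  have -> : h * (A - B) = (a - h * B) - (a - h * A) by ring.
  apply: le_trans (ler_normB _ _) _.
  have -> : h * e = h * (e / 2) + h * (e / 2) by rewrite -mulrDr -splitr.
  exact: lerD P2 P1.
by rewrite normrM gtr0_norm// ler_pM2l.
Qed.

End DirectionalDerivatives.

Section TameFunctions.
Variable R : realType.

(** A function with all its successive derivatives, uniformly bounded on E: this is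
    what makes compositions with it as harmless as trigonometric functions. *)
Definition tower (c : nat -> R -> R) (E : set R) :=
  (forall j z, is_derive z (1 : R) (c j) (c j.+1 z)) /\
  (forall j z, E z -> `|c j z| <= 1).

(** The closure of the affine functions under sums, products and bounded towers.
    Induction on this predicate replaces estimates on explicit kernels. The set D
    only records where bounds are claimed; differentiability holds everywhere. *)
Inductive tame (V : normedModType R) (D : set V) : (V -> R) -> Prop :=
| tame_cst (a : R) : tame D (fun=> a)
| tame_lin (l : V -> R) : (forall a x y, l (a *: x + y) = a * l x + l y) ->
    continuous l -> tame D l
| tame_add f g : tame D f -> tame D g -> tame D (fun v => f v + g v)
| tame_mul f g : tame D f -> tame D g -> tame D (fun v => f v * g v)
| tame_comp c E g j : tower c E -> tame D g -> (forall v, D v -> E (g v)) ->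
    tame D (fun v => c j (g v)).

Section Basic.
Variables (V : normedModType R) (D : set V).
Implicit Types (f g : V -> R) (v w : V).

Definition linear_pack (l : V -> R) (H : forall a x y, l (a *: x + y) = a * l x + l y) :
  {linear V -> R^o} := HB.pack l (GRing.isLinear.Build R V R^o *:%R l H).

Lemma linear_fun_differentiable (l : V -> R) v :
  (forall a x y, l (a *: x + y) = a * l x + l y) -> continuous l ->
  differentiable l v.
Proof. by move=> H cl; exact: (@linear_differentiable _ _ _ (linear_pack H)). Qed.

Lemma derive_linear_fun (l : V -> R) w v :
  (forall a x y, l (a *: x + y) = a * l x + l y) -> continuous l ->
  'D_w l v = l w.
Proof.
move=> H cl; rewrite deriveE; last exact: linear_fun_differentiable.
by rewrite (@diff_lin _ _ _ (linear_pack H)).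
Qed.

Lemma derive_mul f g w v : differentiable f v -> differentiable g v ->
  'D_w (fun x => f x * g x) v = 'D_w f v * g v + f v * 'D_w g v.
Proof.
move=> df dg; have df' : derivable f v w by exact: diff_derivable.
have dg' : derivable g v w by exact: diff_derivable.
by rewrite (deriveM df' dg') addrC; congr (_ + _); exact: mulrC.
Qed.

Lemma derive_add f g w v : differentiable f v -> differentiable g v ->
  'D_w (fun x => f x + g x) v = 'D_w f v + 'D_w g v.
Proof.
by move=> df dg; rewrite -deriveD//; exact: diff_derivable.
Qed.

Lemma derive_comp1 (c : R -> R) (c' : R) g w v : is_derive (g v) (1 : R) c c' ->
  differentiable g v -> 'D_w (fun x => c (g x)) v = 'D_w g v * c'.
Proof.
move=> dc dg; have dc1 : differentiable c (g v) by apply/derivable1_diffP.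
rewrite deriveE; last exact: (differentiable_comp dg dc1).
rewrite (diff_comp dg dc1)/= diff1E// /GRing.scale/= deriveE//.
by rewrite derive1E (@derive_val _ _ _ _ _ _ _ dc).
Qed.

Lemma tame_differentiable f v : tame D f -> differentiable f v.
Proof.
elim=> {f} [a|l Hl cl|f g _ df _ dg|f g _ df _ dg|c E g j [dc _] _ dg _].
- exact: differentiable_cst.
- exact: linear_fun_differentiable.
- exact: differentiableD.
- exact: differentiableM.
- apply: (differentiable_comp dg); apply/derivable1_diffP.
  exact: (@ex_derive _ _ _ _ _ _ _ (dc j (g v))).
Qed.

Lemma tame_derivable f v w : tame D f -> derivable f v w.
Proof. by move=> /(tame_differentiable v); exact: diff_derivable. Qed.

Lemma tame_continuous f : tame D f -> continuous f.
Proof. by move=> tf v; exact/differentiable_continuous/tame_differentiable. Qed.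

Lemma tame_mulE f g w : tame D f -> tame D g ->
  'D_w (fun x => f x * g x) = fun v => 'D_w f v * g v + f v * 'D_w g v.
Proof.
by move=> tf tg; apply/funext => v; apply: derive_mul; exact: tame_differentiable.
Qed.

Lemma tame_addE f g w : tame D f -> tame D g ->
  'D_w (fun x => f x + g x) = fun v => 'D_w f v + 'D_w g v.
Proof.
by move=> tf tg; apply/funext => v; apply: derive_add; exact: tame_differentiable.
Qed.

Lemma tame_compE c E g j w : tower c E -> tame D g ->
  'D_w (fun x => c j (g x)) = fun v => 'D_w g v * c j.+1 (g v).
Proof.
move=> [dc _] tg; apply/funext => v; apply: derive_comp1 => //.
exact: tame_differentiable.
Qed.

Lemma tame_derive f w : tame D f -> tame D ('D_w f).
Proof.
elim=> {f} [a|l Hl cl|f g tf df tg dg|f g tf df tg dg|c E g j ct tg dg gE].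
- rewrite (_ : 'D_w _ = fun=> 0); first exact: tame_cst.
  by apply/funext => v; exact: derive_cst.
- rewrite (_ : 'D_w _ = fun=> l w); first exact: tame_cst.
  by apply/funext => v; exact: derive_linear_fun.
- by rewrite tame_addE//; exact: tame_add.
- by rewrite tame_mulE//; apply: tame_add; exact: tame_mul.
- rewrite (tame_compE _ _ ct tg); apply: tame_mul => //.
  exact: tame_comp ct tg gE.
Qed.

Lemma tame_symmetric f u w : tame D f -> 'D_w ('D_u f) = 'D_u ('D_w f).
Proof.
move=> tf; apply/funext => x; apply: derive_symmetric => [y|y||].
- exact: tame_derivable.
- exact: tame_derivable.
- exact/tame_differentiable/tame_derive.
- exact/tame_differentiable/tame_derive.
Qed.

Definition iter_derive w n f := iter n (fun h => 'D_w h) f.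

Lemma iter_derive_tame w n f : tame D f -> tame D (iter_derive w n f).
Proof. by move=> tf; elim: n => //= n IH; exact: tame_derive. Qed.

Lemma iter_deriveSr w n f : iter_derive w n.+1 f = iter_derive w n ('D_w f).
Proof. exact: iterSr. Qed.

Lemma iter_derive_add w n f g : tame D f -> tame D g ->
  iter_derive w n (fun v => f v + g v) =
  fun v => iter_derive w n f v + iter_derive w n g v.
Proof.
move=> tf tg; elim: n => //= n ->; rewrite tame_addE//; exact: iter_derive_tame.
Qed.

Lemma tame_sum I (r : seq I) (F : I -> V -> R) :
  (forall i, tame D (F i)) -> tame D (fun v => \sum_(i <- r) F i v).
Proof.
move=> tF; elim: r => [|i r IH].
  rewrite (_ : (fun v => _) = fun=> 0); first exact: tame_cst.
  by apply/funext => v; rewrite big_nil.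
rewrite (_ : (fun v => _) = fun v => F i v + \sum_(i <- r) F i v).
  exact: tame_add.
by apply/funext => v; rewrite big_cons.
Qed.

Lemma tame_sumE I (r : seq I) (F : I -> V -> R) w :
  (forall i, tame D (F i)) ->
  'D_w (fun v => \sum_(i <- r) F i v) = fun v => \sum_(i <- r) 'D_w (F i) v.
Proof.
move=> tF; elim: r => [|i r IH].
  rewrite (_ : (fun v => _) = fun=> 0); last by apply/funext => v; rewrite big_nil.
  by apply/funext => v; rewrite big_nil derive_cst.
rewrite (_ : (fun v => _) = fun v => F i v + \sum_(i <- r) F i v); last first.
  by apply/funext => v; rewrite big_cons.
rewrite tame_addE//; last exact: tame_sum.
by apply/funext => v; rewrite big_cons; congr (_ + _); exact: (congr1 (@^~ v) IH).
Qed.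

Lemma tame_scale (a : R) f : tame D f -> tame D (fun v => a * f v).
Proof. by move=> tf; apply: tame_mul => //; exact: tame_cst. Qed.

Lemma tame_scaleE (a : R) f w : tame D f ->
  'D_w (fun v => a * f v) = fun v => a * 'D_w f v.
Proof.
move=> tf; rewrite tame_mulE//; last exact: tame_cst.
by apply/funext => v; rewrite (_ : 'D_w _ v = 0) ?mul0r ?add0r//; exact: derive_cst.
Qed.

Lemma tD_add f g w v : tame D f -> tame D g ->
  'D_w (fun x => f x + g x) v = 'D_w f v + 'D_w g v.
Proof. by move=> tf tg; exact: (congr1 (@^~ v) (tame_addE w tf tg)). Qed.

Lemma tD_mul f g w v : tame D f -> tame D g ->
  'D_w (fun x => f x * g x) v = 'D_w f v * g v + f v * 'D_w g v.
Proof. by move=> tf tg; exact: (congr1 (@^~ v) (tame_mulE w tf tg)). Qed.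

Lemma tD_scale (a : R) f w v : tame D f ->
  'D_w (fun x => a * f x) v = a * 'D_w f v.
Proof. by move=> tf; exact: (congr1 (@^~ v) (tame_scaleE a w tf)). Qed.

Lemma tD_comp c E g j w v : tower c E -> tame D g ->
  'D_w (fun x => c j (g x)) v = 'D_w g v * c j.+1 (g v).
Proof. by move=> ct tg; exact: (congr1 (@^~ v) (tame_compE j w ct tg)). Qed.

Lemma tame_sub f g : tame D f -> tame D g -> tame D (fun v => f v - g v).
Proof.
move=> tf tg; have -> : (fun v => f v - g v) = fun v => f v + -1 * g v.
  by apply/funext => v; rewrite mulN1r.
by apply: tame_add => //; exact: tame_scale.
Qed.

Lemma tD_sub f g w v : tame D f -> tame D g ->
  'D_w (fun x => f x - g x) v = 'D_w f v - 'D_w g v.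
Proof.
move=> tf tg; have -> : (fun v => f v - g v) = fun v => f v + -1 * g v.
  by apply/funext => x; rewrite mulN1r.
by rewrite (tD_add _ _ tf (tame_scale (-1) tg)) (tD_scale _ _ _ tg) mulN1r.
Qed.

Lemma iter_derive_mul w n f g v : tame D f -> tame D g ->
  iter_derive w n (fun v => f v * g v) v =
  \sum_(i < n.+1) 'C(n, i)%:R * (iter_derive w i f v * iter_derive w (n - i) g v).
Proof.
elim: n f g => [|n IH] f g tf tg; first by rewrite big_ord1 bin0 mul1r.
have tf' := tame_derive w tf; have tg' := tame_derive w tg.
rewrite iter_deriveSr tame_mulE// iter_derive_add; try exact: tame_mul.
rewrite !IH//.
pose a i := iter_derive w i f v; pose b i := iter_derive w i g v.
transitivity (\sum_(i < n.+1) 'C(n, i)%:R * (a i.+1 * b (n - i)%N) +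
  \sum_(i < n.+1) 'C(n, i)%:R * (a i * b (n - i).+1)).
  by congr (_ + _); apply: eq_bigr => i _; rewrite -iter_deriveSr.
rewrite [in RHS]big_ord_recl bin0 subn0.
transitivity (\sum_(i < n.+1) ('C(n, i)%:R * (a i.+1 * b (n - i)%N) +
   'C(n, i.+1)%:R * (a i.+1 * b (n - i)%N)) + 1 * (a 0%N * b n.+1)); last first.
  rewrite addrC; congr (_ + _); apply: eq_bigr => i _.
  by rewrite /= /bump /= add1n binS natrD mulrDl addrC subSS.
rewrite big_split/= -addrA; congr (_ + _).
rewrite big_ord_recl bin0 subn0 addrC; congr (_ + _).
rewrite big_ord_recr /= bin_small// mul0r addr0.
by apply: eq_bigr => i _; rewrite /= /bump /= add1n -subSn.
Qed.

End Basic.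

(** Only the linear forms of psi need be examined, since tame functions are built
    from linear forms. *)
Lemma tame_subst (V W : normedModType R) (D : set V) (E : set W) (psi : V -> W)
    (f : W -> R) : (forall v, D v -> E (psi v)) ->
  (forall l : W -> R, (forall a x y, l (a *: x + y) = a * l x + l y) ->
    continuous l -> tame D (fun v => l (psi v))) ->
  tame E f -> tame D (fun v => f (psi v)).
Proof.
move=> DE pl; elim=> {f} [a|l Hl cl|f g _ df _ dg|f g _ df _ dg|c C g j ct _ dg gE].
- exact: tame_cst.
- exact: pl.
- exact: tame_add.
- exact: tame_mul.
- by apply: (tame_comp _ ct dg) => v /DE; exact: gE.
Qed.

End TameFunctions.

(** * Growth and Taylor series of tame functions *)

Section Growth.
Variable R : realType.

Lemma nat_bound (x : R) : exists n : nat, x <= n%:R.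
Proof.
exists (Num.truncn `|x|).+1; apply: le_trans (ler_norm x) _.
by rewrite ltW// truncnS_gt.
Qed.

(** A one-parameter family of polynomial bounds, closed under sums and products. *)
Definition poly_bound (k : nat) (x : R) := k%:R * (1 + x) ^+ k.

Lemma poly_bound_ge0 k x : 0 <= x -> 0 <= poly_bound k x.
Proof. by move=> x0; rewrite mulr_ge0// exprn_ge0// addr_ge0. Qed.

Lemma poly_bound_mono k x y : 0 <= x -> x <= y -> poly_bound k x <= poly_bound k y.
Proof.
move=> x0 xy; rewrite ler_wpM2l// lerXn2r ?nnegrE ?addr_ge0 ?lerD2l//.
exact: le_trans xy.
Qed.

Lemma poly_bound_add k l x : 0 <= x -> poly_bound k x + poly_bound l x <= poly_bound (k + l) x.
Proof.
move=> x0; rewrite {3}/poly_bound natrD mulrDl; apply: lerD; rewrite ler_wpM2l//.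
- by rewrite ler_weXn2l ?leq_addr// lerDl.
- by rewrite ler_weXn2l ?leq_addl// lerDl.
Qed.

Lemma poly_bound_mul k l x : 0 <= x -> poly_bound k x * poly_bound l x <= poly_bound (k * l + (k + l)) x.
Proof.
move=> x0; rewrite /poly_bound mulrACA -exprD -natrM; apply: ler_pM => //.
- by rewrite exprn_ge0// addr_ge0.
- by rewrite ler_nat leq_addr.
- by rewrite ler_weXn2l ?leq_addl// lerDl.
Qed.

Lemma tame_growth (V : normedModType R) (D : set V) f : tame D f ->
  exists k, forall v, D v -> `|f v| <= poly_bound k `|v|.
Proof.
elim=> {f} [a|l Hl cl|f g _ [k fk] _ [l gl]|f g _ [k fk] _ [l gl]|c E g j [_ cE] _ _ gE].
- have [k ak] := nat_bound `|a|; exists k => v _; apply: le_trans ak _.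
  by rewrite ler_peMr// exprn_ege1// lerDl.
- pose L : {linear V -> R^o} := HB.pack l (GRing.isLinear.Build R V R^o *:%R l Hl).
  have /linear_lipschitz : continuous L by [].
  move=> [C C0 CP]; have [k Ck] := nat_bound C; exists k.+1 => v _.
  apply: le_trans (CP v) _; apply: ler_pM => //; first exact: ltW.
    by apply: le_trans Ck _; rewrite ler_nat.
  have v1 : 1 <= 1 + `|v| by rewrite lerDl.
  rewrite exprS; apply: (@le_trans _ _ (1 + `|v|)); first by rewrite lerDr.
  by rewrite ler_peMr ?addr_ge0// exprn_ege1.
- exists (k + l)%N => v Dv; apply: le_trans (ler_normD _ _) _.
  by apply: le_trans (poly_bound_add k l (normr_ge0 v)); rewrite lerD ?fk ?gl.
- exists (k * l + (k + l))%N => v Dv; rewrite normrM.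
  by apply: le_trans (poly_bound_mul k l (normr_ge0 v)); rewrite ler_pM ?fk ?gl.
- exists 1%N => v Dv; apply: le_trans (cE j _ (gE v Dv)) _.
  by rewrite /poly_bound mul1r expr1 lerDl.
Qed.

End Growth.

Section Taylor.
Variable R : realType.

(** Derivatives along w of order n are O(n! / T^n) uniformly on X, for every T: the
    Taylor series along w has infinite radius of convergence. *)
Definition fast (V : normedModType R) (X : set V) (w : V) (f : V -> R) :=
  forall T : R, 0 < T -> exists2 M : R, 0 <= M & forall n v, X v ->
    `|iter_derive w n f v| <= M * n`!%:R / T ^+ n.

Let binE n i : (i <= n)%N -> 'C(n, i)%:R * (i`!%:R * (n - i)`!%:R) = n`!%:R :> R.
Proof. by move=> iN; rewrite -!natrM bin_fact. Qed.

Let geometric n : \sum_(i < n) 2^-1 ^+ (n - i) <= 1 :> R.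
Proof.
suff -> : \sum_(i < n) 2^-1 ^+ (n - i) = 1 - 2^-1 ^+ n :> R.
  by rewrite lerBlDr lerDl exprn_ge0// invr_ge0.
elim: n => [|n IH]; first by rewrite big_ord0 expr0 subrr.
rewrite big_ord_recr /= subSnn.
rewrite (eq_bigr (fun i : 'I_n => 2^-1 * 2^-1 ^+ (n - i))); last first.
  by move=> i _; rewrite subSn ?exprS// ltnW.
by rewrite -mulr_sumr IH [in RHS]exprS expr1; set p := _ ^+ n; lra.
Qed.

Let fast_le (M N T : R) n : 0 < T -> M <= N ->
  M * n`!%:R / T ^+ n <= N * n`!%:R / T ^+ n.
Proof.
move=> T0 MN; apply: ler_wpM2r; last exact: ler_wpM2r.
by rewrite invr_ge0 exprn_ge0 ?ltW.
Qed.

Lemma fast_add (V : normedModType R) (D X : set V) w f g :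
  tame D f -> tame D g -> fast X w f -> fast X w g -> fast X w (fun v => f v + g v).
Proof.
move=> tf tg ff fg T T0; have [M M0 fM] := ff T T0; have [N N0 gN] := fg T T0.
exists (M + N) => [|n v Xv]; first exact: addr_ge0.
rewrite (iter_derive_add _ _ tf tg); apply: le_trans (ler_normD _ _) _.
by rewrite !mulrDl lerD ?fM ?gN.
Qed.

(** The n + 1 terms of the Leibniz formula are absorbed by using the bound of f and g
    at 2 T, since n + 1 <= 2^n. *)
Lemma fast_mul (V : normedModType R) (D X : set V) w f g :
  tame D f -> tame D g -> fast X w f -> fast X w g -> fast X w (fun v => f v * g v).
Proof.
move=> tf tg ff fg T T0; have T20 : 0 < 2 * T by rewrite mulr_gt0.
have [M M0 fM] := ff _ T20; have [N N0 gN] := fg _ T20.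
exists (M * N) => [|n v Xv]; first exact: mulr_ge0.
rewrite (iter_derive_mul _ _ _ tf tg).
apply: le_trans (ler_norm_sum _ _ _) _.
apply: (@le_trans _ _ (\sum_(i < n.+1) M * N * n`!%:R / (2 * T) ^+ n)).
  apply: ler_sum => i _; have iN : (i <= n)%N by rewrite -ltnS.
  rewrite normrM ger0_norm// normrM.
  apply: (@le_trans _ _ ('C(n, i)%:R * ((M * i`!%:R / (2 * T) ^+ i) *
      (N * (n - i)`!%:R / (2 * T) ^+ (n - i))))).
    by rewrite ler_wpM2l// ler_pM ?fM ?gN.
  have -> : (2 * T) ^+ n = (2 * T) ^+ i * (2 * T) ^+ (n - i) by rewrite -exprD subnKC.
  rewrite -(binE iN) invfM le_eqVlt; apply/orP; left.
  by apply/eqP; ring.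
rewrite big_const_ord iter_addr_0 -[leLHS]mulr_natl exprMn invfM.
have -> : n.+1%:R * (M * N * n`!%:R * ((2 ^+ n)^-1 * (T ^+ n)^-1)) =
    (n.+1%:R / 2 ^+ n) * (M * N * n`!%:R / T ^+ n) by ring.
have T0' := ltW T0.
apply: ler_piMl; first by rewrite divr_ge0 ?exprn_ge0// !mulr_ge0.
by rewrite ler_pdivrMr ?exprn_gt0// mul1r -natrX ler_nat ltn_expl.
Qed.

(** The chain rule expresses the derivatives of c_j o g through those of c_(j+1) o g
    of lower order, with j free. The constants M n = r^min(n, r) satisfy
    r M n <= (n + 1) M (n + 1), which is what the induction on n consumes, and they
    remain bounded by r^r. *)
Lemma fast_comp (V : normedModType R) (D X : set V) w c E g j :
  tower c E -> tame D g -> (forall v, D v -> E (g v)) -> X `<=` D ->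
  fast X w g -> fast X w (fun v => c j (g v)).
Proof.
move=> ct tg gE XD fg T T0; have T40 : 0 < 4 * T by rewrite mulr_gt0.
have [r0 r00 gr] := fg _ T40; have [r1 r01] := nat_bound r0.
pose r := r1.+1; have {}gr n v : X v ->
    `|iter_derive w n g v| <= r%:R * n`!%:R / (4 * T) ^+ n.
  move=> Xv; apply: le_trans (gr n v Xv) _.
  by apply: fast_le => //; apply: le_trans r01 _; rewrite ler_nat.
pose M n : R := r%:R ^+ minn n r.
have r_ge1 : 1 <= r%:R :> R by rewrite ler1n.
have Mmono k n : (k <= n)%N -> M k <= M n.
  move=> kn; rewrite /M ler_weXn2l// leq_min geq_minr andbT.
  exact: leq_trans (geq_minl _ _) kn.
have M0 n : 0 <= M n by rewrite exprn_ge0.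
have Mstep n : r%:R * M n <= n.+1%:R * M n.+1.
  rewrite /M; case/boolP: (n < r)%N => [nr|].
    rewrite (minn_idPl (ltnW nr)) (minn_idPl nr) -exprS.
    by rewrite ler_peMl// ?ler1n// exprn_ge0.
  rewrite -leqNgt => rn; rewrite (minn_idPr rn) (minn_idPr (leqW rn)) ler_wpM2r ?exprn_ge0//.
  by rewrite ler_nat leqW.
suff H n : forall k, (k <= n)%N -> forall j v, X v ->
    `|iter_derive w k (fun v => c j (g v)) v| <= M k * k`!%:R / T ^+ k.
  exists (r%:R ^+ r) => [|n v Xv]; first by rewrite exprn_ge0.
  apply: le_trans (H n n (leqnn n) j v Xv) _.
  by apply: fast_le => //; rewrite /M ler_weXn2l// geq_minr.
elim: n => [|n IH] k.
  rewrite leqn0 => /eqP-> {}j v Xv /=; rewrite expr0 divr1 mulr1 /M min0n expr0.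
  by case: ct => _ /(_ j); apply; apply/gE/XD.
rewrite leq_eqVlt => /orP[/eqP->{k}|]; last by rewrite ltnS; exact: IH.
move=> {}j v Xv; have tc : tame D (fun v => c j.+1 (g v)) by exact: tame_comp ct tg gE.
have tg' := tame_derive w tg.
rewrite iter_deriveSr (tame_compE _ _ ct tg) (iter_derive_mul _ _ _ tg' tc).
apply: le_trans (ler_norm_sum _ _ _) _.
apply: (@le_trans _ _ (\sum_(i < n.+1) (r%:R * M n * n`!%:R / T ^+ n.+1) *
    2^-1 ^+ i.+1)).
  apply: ler_sum => i _; have iN : (i <= n)%N by rewrite -ltnS.
  rewrite normrM ger0_norm// normrM -iter_deriveSr.
  apply: (@le_trans _ _ ('C(n, i)%:R * ((r%:R * i.+1`!%:R / (4 * T) ^+ i.+1) *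
      (M n * (n - i)`!%:R / T ^+ (n - i))))).
    rewrite ler_wpM2l// ler_pM ?gr//.
    apply: le_trans (IH _ (leq_subr i n) _ _ Xv) _.
    exact/fast_le/Mmono/leq_subr.
  have -> : T ^+ n.+1 = T ^+ i.+1 * T ^+ (n - i) by rewrite -exprD addSn subnKC.
  rewrite -(binE iN) factS natrM exprMn !invfM.
  have -> : 4 = 2 * 2 :> R by rewrite -natrM.
  rewrite exprMn invfM.
  set B := 'C(n, i)%:R; set u := i`!%:R; set u' := (n - i)`!%:R.
  set p := (2 ^+ i.+1)^-1; set q := (T ^+ i.+1)^-1; set q' := (T ^+ (n - i))^-1.
  rewrite exprVn -/p.
  have -> : B * (r%:R * (i.+1%:R * u) * (p * p * q) * (M n * u' * q')) =
      (i.+1%:R * p) * (r%:R * M n * (B * (u * u')) * (q * q') * p) by ring.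
  apply: ler_piMl; first by rewrite !mulr_ge0// invr_ge0 exprn_ge0// ltW.
  by rewrite ler_pdivrMr ?exprn_gt0// mul1r -natrX ler_nat ltnW// ltn_expl.
rewrite -mulr_sumr.
have -> : \sum_(i < n.+1) 2^-1 ^+ i.+1 = \sum_(i < n.+1) 2^-1 ^+ (n.+1 - i) :> R.
  rewrite (reindex_inj rev_ord_inj); apply: eq_bigr => i _ /=.
  by rewrite subSS -subSn// -ltnS.
apply: (@le_trans _ _ (r%:R * M n * n`!%:R / T ^+ n.+1 * 1)).
  apply: ler_wpM2l; last exact: geometric.
  by rewrite !mulr_ge0// invr_ge0 exprn_ge0// ltW.
rewrite mulr1; apply: ler_wpM2r; first by rewrite invr_ge0 exprn_ge0// ltW.
by rewrite factS natrM mulrA; apply: ler_wpM2r => //; rewrite [X in _ <= X]mulrC.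
Qed.

(** On a bounded set X a linear form is bounded with constant first derivative;
    the other constructors are the closure properties above. *)
Lemma tame_fast (V : normedModType R) (D X : set V) w f (B : R) :
  X `<=` D -> (forall v, X v -> `|v| <= B) -> tame D f -> fast X w f.
Proof.
move=> XD XB; elim=> {f} [a|l Hl cl|f g tf ff tg fg|f g tf ff tg fg|c E g j ct tg fg gE].
- move=> T T0; exists `|a| => // -[|n] v Xv; first by rewrite /= expr0 divr1 mulr1.
  rewrite iter_deriveSr (_ : 'D_w _ = fun=> 0); last first.
    by apply/funext => z; exact: derive_cst.
  rewrite (_ : iter_derive _ _ _ = fun=> 0) ?normr0.
    by rewrite mulr_ge0// ?mulr_ge0// invr_ge0 exprn_ge0// ltW.
  by elim: n => //= n ->; apply/funext => z; exact: derive_cst.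
- move=> T T0; have [k kP] := tame_growth (tame_lin D Hl cl).
  exists (poly_bound k `|B| + `|l w| * T).
    by rewrite addr_ge0 ?poly_bound_ge0// mulr_ge0// ltW.
  move=> [|n] v Xv.
    rewrite /= expr0 divr1 mulr1; apply: le_trans (kP v (XD v Xv)) _.
    apply: ler_wpDr; first by rewrite mulr_ge0// ltW.
    by apply: poly_bound_mono => //; apply: le_trans (XB v Xv) (ler_norm _).
  rewrite iter_deriveSr (_ : 'D_w _ = fun=> l w); last first.
    by apply/funext => z; exact: derive_linear_fun.
  case: n => [|n].
    rewrite /= mulr1 expr1 ler_pdivlMr// ler_wpDl//.
    by rewrite poly_bound_ge0.
  rewrite (_ : iter_derive _ _ _ = fun=> 0).
    rewrite normr0; apply: mulr_ge0; last by rewrite invr_ge0 exprn_ge0// ltW.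
    by rewrite mulr_ge0// addr_ge0 ?poly_bound_ge0// mulr_ge0// ltW.
  elim: n => [|n /= ->]; by apply/funext => z; exact: derive_cst.
- exact: fast_add tf tg ff fg.
- exact: fast_mul tf tg ff fg.
- exact: fast_comp ct tg gE XD fg.
Qed.

Lemma is_derive_mulfun (f g : R -> R) (x a b : R) :
  is_derive x (1 : R) f a -> is_derive x (1 : R) g b ->
  is_derive x (1 : R) (fun t => f t * g t) (a * g x + f x * b).
Proof.
move=> df dg; apply: (is_derive_eq (is_deriveM df dg)).
by rewrite addrC /GRing.scale/= [g x * a]mulrC.
Qed.

Lemma is_derive_addfun (f g : R -> R) (x a b : R) :
  is_derive x (1 : R) f a -> is_derive x (1 : R) g b ->
  is_derive x (1 : R) (fun t => f t + g t) (a + b).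
Proof. by move=> df dg; exact: (is_deriveD df dg). Qed.

Let is_derive_pow (n : nat) (t : R) : is_derive t (1 : R)
  (fun t : R => (1 - t) ^+ n.+1 / n.+1`!%:R) (- ((1 - t) ^+ n / n`!%:R)).
Proof.
have d1 : is_derive t (1 : R) (fun t : R => 1 - t) (-1).
  apply: (is_derive_eq (is_deriveB (is_derive_cst (1 : R) t (1 : R)) (is_derive_id t (1 : R)))).
  by rewrite sub0r.
have d2 : is_derive t (1 : R) (fun t : R => (1 - t) ^+ n.+1) (- (n.+1%:R * (1 - t) ^+ n)).
  have -> : (fun t : R => (1 - t) ^+ n.+1) = (fun t : R => 1 - t) ^+ n.+1.
    by apply/funext => z; rewrite !fctE.
  apply: (is_derive_eq (is_deriveX _ d1)).
  by rewrite /GRing.scale/= mulrN1.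
apply: (is_derive_eq (is_derive_mulfun d2 (is_derive_cst (n.+1`!%:R^-1 : R) t (1 : R)))).
rewrite mulr0 addr0 factS natrM invfM.
have n0 : n.+1%:R != 0 :> R by rewrite pnatr_eq0.
have f0 : n`!%:R != 0 :> R by rewrite pnatr_eq0 -lt0n fact_gt0.
have aux (a b p : R) : a != 0 -> b != 0 -> - (a * p) * (a^-1 * b^-1) = - (p / b).
  by move=> a0 b0; field; rewrite a0 b0.
exact: aux.
Qed.

Section Line.
Variables (V : normedModType R) (D : set V) (f : V -> R) (v w : V).
Hypothesis tf : tame D f.

(** The value at t = 1 is f (v + w), the value at t = 0 is the Taylor sum, and the
    derivative in t telescopes to a single term. *)
Let moving_sum (n : nat) (t : R) : R :=
  \sum_(i < n.+1) iter_derive w i f (v + t *: w) * ((1 - t) ^+ i / i`!%:R).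

Let is_derive_moving_sum n t : is_derive t (1 : R) (moving_sum n)
  (iter_derive w n.+1 f (v + t *: w) * ((1 - t) ^+ n / n`!%:R)).
Proof.
have dl i : is_derive t (1 : R) (fun t : R => iter_derive w i f (v + t *: w))
    (iter_derive w i.+1 f (v + t *: w)).
  by apply/is_derive_line/(tame_derivable (D := D))/iter_derive_tame.
elim: n => [|n IH].
  have -> : moving_sum 0 = fun t => iter_derive w 0 f (v + t *: w) * 1.
    by apply/funext => z; rewrite /moving_sum big_ord1 expr0 divr1.
  apply: (is_derive_eq (is_derive_mulfun (dl 0%N) (is_derive_cst (1 : R) t (1 : R)))).
  by rewrite mulr0 addr0 expr0 divr1.
have -> : moving_sum n.+1 = fun t => moving_sum n t +
    iter_derive w n.+1 f (v + t *: w) * ((1 - t) ^+ n.+1 / n.+1`!%:R).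
  by apply/funext => z; rewrite /moving_sum big_ord_recr.
apply: (is_derive_eq (is_derive_addfun IH (is_derive_mulfun (dl _) (is_derive_pow n t)))).
by rewrite mulrN addrCA addrN addr0.
Qed.

Hypothesis segD : forall h : R, 0 <= h <= 1 -> D (v + h *: w).

Lemma tame_taylor :
  [series iter_derive w n f v / n`!%:R]_n @ \oo --> f (v + w).
Proof.
pose X : set V := [set v + h *: w | h in [set h : R | 0 <= h <= 1]].
have Xb u : X u -> `|u| <= `|v| + `|w|.
  move=> [h /= /andP[h0 h1] <-]; apply: le_trans (ler_normD _ _) _.
  by rewrite lerD2l normrZ ger0_norm// ler_piMl.
have XD : X `<=` D by move=> u [h h01 <-]; exact: segD.
have [M M0 fM] := tame_fast w XD Xb tf (ltr0n R 4).
have sumE n : series (fun n => iter_derive w n f v / n`!%:R) n.+1 = moving_sum n 0.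
  rewrite /moving_sum /series/= big_mkord; apply: eq_bigr => i _.
  by rewrite subr0 expr1n scale0r addr0 mul1r.
have oneE n : moving_sum n 1 = f (v + w).
  rewrite /moving_sum big_ord_recl big1 => [|i _].
    by rewrite subrr expr0 divr1 mulr1 scale1r addr0.
  by rewrite subrr expr0n mul0r mulr0.
have err n : `|moving_sum n 0 - f (v + w)| <= M * 2^-1 ^+ n.
  rewrite -(oneE n) distrC.
  have [|h h01 ->] := MVT_segment ler01 (fun t _ => is_derive_moving_sum n t).
    apply: derivable_within_continuous => t _; exact: ex_derive.
  move: h01; rewrite in_itv/= => /andP[h0 h1].
  rewrite subr0 mulr1 normrM.
  have hX : X (v + h *: w) by exists h => //=; rewrite h0.
  have n0 : n`!%:R != 0 :> R by rewrite pnatr_eq0 -lt0n fact_gt0.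
  have n1 : 0 < n`!%:R :> R by rewrite ltr0n fact_gt0.
  apply: (@le_trans _ _ ((M * n.+1`!%:R / 4 ^+ n.+1) * (1 / n`!%:R))).
    apply: ler_pM => //; first exact: (fM n.+1).
    rewrite ger0_norm; last by rewrite divr_ge0// exprn_ge0// subr_ge0.
    rewrite ler_pM2r ?invr_gt0// exprn_ile1// ?subr_ge0// gerBl//.
  have -> : 4 = 2 * 2 :> R by rewrite -natrM.
  rewrite factS natrM exprMn invfM.
  have -> : M * (n.+1%:R * n`!%:R) * ((2 ^+ n.+1)^-1 * (2 ^+ n.+1)^-1) * (1 / n`!%:R) =
      M * (2 ^+ n.+1)^-1 * (n.+1%:R / 2 ^+ n.+1) :> R.
    have aux (a b p : R) : b != 0 -> M * (a * b) * (p * p) * (1 / b) = M * p * (a * p).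
      by move=> b0; field.
    exact: aux.
  apply: (@le_trans _ _ (M * (2 ^+ n.+1)^-1 * 1)).
    apply: ler_wpM2l; first by rewrite mulr_ge0// invr_ge0 exprn_ge0.
    by rewrite ler_pdivrMr ?exprn_gt0// mul1r -natrX ler_nat ltnW// ltn_expl.
  rewrite mulr1 -exprVn ler_wpM2l// exprS ler_piMl ?exprn_ge0 ?invr_ge0//.
  by rewrite invf_le1// ler1n.
rewrite -cvg_shiftS /=.
apply/cvgrPdist_le => e e0.
have : (fun n => M * 2^-1 ^+ n) @ \oo --> (M * 0 : R).
  by apply: cvgMr; apply: cvg_expr; rewrite ger0_norm ?invr_ge0// invf_lt1// ltr1n.
rewrite mulr0 => /cvgr0_norm_le /(_ _ e0); apply: filterS => n.
rewrite distrC sumE; apply: le_trans.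
by apply: le_trans (err n) (ler_norm _).
Qed.

End Line.

End Taylor.

(** * Trigonometric and Bessel towers *)

Section Towers.
Variable R : realType.

(** Each derivative is a shift of the argument by a quarter of the period. *)
Definition cos_tower (j : nat) (z : R) := cos (z + j%:R * (pi / 2)).

Lemma cos_towerP : tower cos_tower setT.
Proof.
split=> j z; last by move=> _; rewrite ler_norml cos_geN1 cos_le1.
have d1 : is_derive z (1 : R) (fun z => z + j%:R * (pi / 2)) (1 + 0).
  exact: (is_derive_addfun (is_derive_id z (1 : R)) (is_derive_cst (j%:R * (pi / 2) : R) z (1 : R))).
apply: (is_derive_eq (is_derive1_comp (is_derive_cos _) d1)).
by rewrite addr0 mulr1 /cos_tower -[j.+1%:R]natr1 (mulrDl j%:R) mul1r addrA cosDpihalf.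
Qed.

Lemma tame_cos (V : normedModType R) (D : set V) f :
  tame D f -> tame D (fun v => cos (f v)).
Proof.
move=> tf; rewrite (_ : (fun v => _) = fun v => cos_tower 0 (f v)).
  exact: (tame_comp 0 cos_towerP tf).
by apply/funext => v; rewrite /cos_tower mul0r addr0.
Qed.

Lemma tame_sin (V : normedModType R) (D : set V) f :
  tame D f -> tame D (fun v => sin (f v)).
Proof.
move=> tf; rewrite (_ : (fun v => _) = fun v => -1 * cos_tower 1 (f v)).
  by apply: tame_scale; exact: (tame_comp 1 cos_towerP tf).
by apply/funext => v; rewrite /cos_tower mul1r cosDpihalf mulN1r opprK.
Qed.

Lemma tD_cos (V : normedModType R) (D : set V) f w v : tame D f ->
  'D_w (fun x => cos (f x)) v = - ('D_w f v * sin (f v)).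
Proof.
move=> tf.
rewrite (derive_comp1 (c' := - sin (f v)) _ _ (tame_differentiable v tf)) ?mulrN//.
Qed.

Lemma tD_sin (V : normedModType R) (D : set V) f w v : tame D f ->
  'D_w (fun x => sin (f x)) v = 'D_w f v * cos (f v).
Proof.
move=> tf.
by rewrite (derive_comp1 (c' := cos (f v)) _ _ (tame_differentiable v tf)).
Qed.

(** The Taylor coefficients of the j-th derivative of cos (sqrt z). *)
Let coef (j n : nat) : R :=
  (-1) ^+ (n + j) * ((n + j)`!%:R / (n`!%:R * (n + j).*2`!%:R)).

Let factN0 n : n`!%:R != 0 :> R.
Proof. by rewrite pnatr_eq0 -lt0n fact_gt0. Qed.

Let coef_diffs j : pseries_diffs (coef j) = coef j.+1.
Proof.
apply/funext => n; rewrite /pseries_diffs /coef addSnnS factS natrM.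
have n0 : n.+1%:R != 0 :> R by rewrite pnatr_eq0.
have aux (a b c d e : R) : a != 0 -> b != 0 -> d != 0 ->
    a * (e * (c / (a * b * d))) = e * (c / (b * d)).
  by move=> a0 b0 d0; field; rewrite a0 b0 d0.
exact: aux.
Qed.

Let coef_le j n : `|coef j n| <= n`!%:R^-1.
Proof.
rewrite normrM normrX normrN1 expr1n mul1r ger0_norm; last first.
  by rewrite divr_ge0// mulr_ge0.
rewrite invfM mulrCA ler_piMr ?invr_ge0// ler_pdivrMr ?ltr0n ?fact_gt0//.
by rewrite mul1r ler_nat leq_fact// -addnn leq_addr.
Qed.

Let coef_cvg j x : cvgn (pseries (coef j) x).
Proof.
apply: normed_cvg.
apply: (@series_le_cvg _ _ (fun n => `|x| ^+ n / n`!%:R)) => [n|n|n|] //=.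
- by rewrite normrM normrX mulrC ler_wpM2l// exprn_ge0.
- exact: is_cvg_series_exp_coeff.
Qed.

(** The j-th derivative of cos (sqrt z), an entire function that is up to a factor the
    Bessel function of order j - 1/2 at sqrt z divided by its leading power. *)
Definition bessel (j : nat) (z : R) : R := limn (pseries (coef j) z).

Lemma is_derive_bessel j z : is_derive z (1 : R) (bessel j) (bessel j.+1 z).
Proof.
rewrite /bessel -coef_diffs.
apply: (@pseries_snd_diffs _ _ (`|z| + 1)); rewrite ?coef_diffs; do ?exact: coef_cvg.
by rewrite [ltRHS]ger0_norm ?addr_ge0// ltrDl.
Qed.

(** The differential equation 4 z C'' + 2 C' + C = 0 of C (z) = cos (sqrt z), checked on
    coefficients; [bessel_ode] follows by differentiating it. *)
Lemma bessel_ode0 z : 4 * z * bessel 2 z + 2 * bessel 1 z + bessel 0 z = 0.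
Proof.
have c0 : cvgn (pseries (coef 0) z) by exact: coef_cvg.
have c1 : cvgn (pseries (coef 1) z) by exact: coef_cvg.
have c2 : cvgn (pseries (pseries_diffs (coef 1)) z) by rewrite coef_diffs; exact: coef_cvg.
have := pseries_diffs_equiv c2; rewrite coef_diffs -/(bessel 2 z) => h2.
have h : series (fun i => (4 * i%:R + 2) * coef 1 i * z ^+ i + coef 0 i * z ^+ i) @ \oo -->
    4 * z * bessel 2 z + 2 * bessel 1 z + bessel 0 z.
  rewrite (_ : series _ = fun n => 4 * z * series (fun i => i%:R * coef 1 i * z ^+ i.-1) n
      + 2 * pseries (coef 1) z n + pseries (coef 0) z n).
    by apply: cvgD => //; apply: cvgD; apply: cvgMr.
  apply/funext => n; rewrite /pseries /series /= !mulr_sumr -!big_split /=.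
  apply: eq_bigr => i _; congr (_ + _).
  case: i => [|i] /=; first by ring.
  by rewrite exprS; ring.
rewrite -(cvg_lim _ h)//; rewrite (_ : series _ = fun=> 0) ?lim_cst//.
apply/funext => n; rewrite /series /= big1// => i _; rewrite -mulrDl.
rewrite (_ : _ + _ = 0) ?mul0r//.
rewrite /coef addn0 addn1 exprS doubleS !factS !natrM.
rewrite -mul2n -(natr1 i) -(natr1 (2 * i).+1) -(natr1 (2 * i)%N) natrM.
have i0 := factN0 i; have i1 := factN0 (2 * i)%N.
set p := _ ^+ i; set a := i`!%:R; set b := (2 * i)`!%:R; set x := i%:R.
have x0 : 0 <= x by [].
have h1 : 2 * x + 1 != 0 by rewrite gt_eqF// ltr_wpDl// mulr_ge0.
have h3 : 2 * x + 1 + 1 != 0 by rewrite gt_eqF// ltr_wpDl// addr_ge0// mulr_ge0.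
have aux : b != 0 -> a != 0 -> (4 * x + 2) * (-1 * p * ((x + 1) * a / (a * ((2 * x + 1 + 1) * ((2 * x + 1) * b))))) +
  p * (a / (a * b)) = 0.
  by move=> b0 a0; field; rewrite a0 b0 h1 h3.
exact: aux.
Qed.

Lemma bessel_ode j z :
  4 * z * bessel j.+2 z + (4 * j%:R + 2) * bessel j.+1 z + bessel j z = 0.
Proof.
elim: j z => [|j IH] z; first by rewrite mulr0 add0r bessel_ode0.
have dz : is_derive z (1 : R) (fun z : R => 4 * z) (0 * z + 4 * 1).
  exact: (is_derive_mulfun (is_derive_cst (4 : R) z (1 : R)) (is_derive_id z (1 : R))).
have d := is_derive_addfun (is_derive_addfun
  (is_derive_mulfun dz (is_derive_bessel j.+2 z))
  (is_derive_mulfun (is_derive_cst (4 * j%:R + 2 : R) z (1 : R)) (is_derive_bessel j.+1 z)))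
  (is_derive_bessel j z).
have := @derive_val _ _ _ _ _ _ _ d.
rewrite (_ : (fun t => _) = fun=> 0); last by apply/funext => t; exact: IH.
rewrite derive_cst => /esym E; rewrite -[RHS]E -(natr1 j) /cst /=; ring.
Qed.

Lemma bessel0 j : bessel j 0 = coef j 0.
Proof.
apply/cvg_lim => //; rewrite -cvg_shiftS /=.
rewrite (_ : (fun n => _) = fun=> coef j 0); first exact: cvg_cst.
apply/funext => n; rewrite /pseries /series /= big_nat_recl// expr0 mulr1 big1 ?addr0//.
by move=> i _; rewrite expr0n mulr0.
Qed.

Lemma bessel00 : bessel 0 0 = 1.
Proof. by rewrite bessel0 /coef !addn0 fact0 expr0 !mul1r invr1. Qed.

(** By the differential equation the energy C_j^2 + 4 z C_(j+1)^2 has derivative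
    - 8 j C_(j+1)^2, so on the half line |C_j| never exceeds |C_j (0)| <= 1. *)
Lemma besselP : tower bessel [set z | 0 <= z].
Proof.
split=> [|j z /= z0]; first exact: is_derive_bessel.
(* the energy and its derivative along the differential equation *)
pose H (z : R) := bessel j z * bessel j z + 4 * z * (bessel j.+1 z * bessel j.+1 z).
pose H' (z : R) := - (8 * j%:R * bessel j.+1 z ^+ 2).
have dH t : is_derive t (1 : R) H (H' t).
  have dz : is_derive t (1 : R) (fun z : R => 4 * z) (0 * t + 4 * 1).
    exact: (is_derive_mulfun (is_derive_cst (4 : R) t (1 : R)) (is_derive_id t (1 : R))).
  have b0 := is_derive_bessel j t; have b1 := is_derive_bessel j.+1 t.
  apply: (is_derive_eq (is_derive_addfun (is_derive_mulfun b0 b0)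
    (is_derive_mulfun dz (is_derive_mulfun b1 b1)))).
  have E := bessel_ode j t; rewrite /H'.
  have {}E : bessel j t = - (4 * t * bessel j.+2 t + (4 * j%:R + 2) * bessel j.+1 t).
    by apply/eqP; rewrite -addr_eq0 addrC E.
  by rewrite E; ring.
have [|c c0z HE] := MVT_segment z0 (fun t _ => dH t).
  apply: derivable_within_continuous => t _; exact: ex_derive.
have Hle : H z <= H 0.
  rewrite -subr_le0 HE subr0 /H' mulNr oppr_le0; apply: mulr_ge0 => //.
  by rewrite mulr_ge0// ?sqr_ge0// mulr_ge0.
have C0 : `|bessel j 0| <= 1.
  by rewrite bessel0; apply: le_trans (coef_le _ _) _; rewrite fact0 invr1.
have {}Hle : bessel j z ^+ 2 <= 1.
  apply: (@le_trans _ _ (H z)).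
    by rewrite /H -!expr2 lerDl mulr_ge0 ?sqr_ge0// mulr_ge0.
  apply: le_trans Hle _; rewrite /H mulr0 mul0r addr0 -expr2.
  by rewrite -real_normK ?num_real// expr_le1.
by rewrite -(expr_le1 (n := 2))// real_normK ?num_real.
Qed.

End Towers.

(** * Complex tame functions and the planar wave pair *)

Section ComplexTame.
Variable R : realType.
Local Notation C := R[i].

Lemma ReM (a b : C) : complex.Re (a * b) =
  complex.Re a * complex.Re b - complex.Im a * complex.Im b.
Proof. by case: a b => [? ?] [? ?]. Qed.

Lemma ImM (a b : C) : complex.Im (a * b) =
  complex.Re a * complex.Im b + complex.Im a * complex.Re b.
Proof. by case: a b => [? ?] [? ?]. Qed.

Lemma ReD (a b : C) : complex.Re (a + b) = complex.Re a + complex.Re b.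
Proof. by case: a b => [? ?] [? ?]. Qed.

Lemma ImD (a b : C) : complex.Im (a + b) = complex.Im a + complex.Im b.
Proof. by case: a b => [? ?] [? ?]. Qed.

Section Basic.
Variables (V : normedModType R) (D : set V).
Implicit Types (f g : V -> C) (v w : V).

Definition ctame f := reim_all (tame D) f.
Definition cD w f : V -> C := fun v => reim (fun u => 'D_w u v) f.

Lemma ctame_cst (a : C) : ctame (fun=> a).
Proof. by split; exact: tame_cst. Qed.

Lemma ctame_real (u : V -> R) : tame D u -> ctame (fun v => (u v)%:C%C).
Proof. by move=> tu; split => //=; exact: tame_cst. Qed.

Lemma ctame_add f g : ctame f -> ctame g -> ctame (fun v => f v + g v).
Proof.
move=> [f1 f2] [g1 g2]; split.
  by under eq_fun do rewrite ReD; exact: tame_add.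
by under eq_fun do rewrite ImD; exact: tame_add.
Qed.

Lemma ctame_mul f g : ctame f -> ctame g -> ctame (fun v => f v * g v).
Proof.
move=> [f1 f2] [g1 g2]; split.
  by under eq_fun do rewrite ReM; apply: tame_sub; exact: tame_mul.
by under eq_fun do rewrite ImM; apply: tame_add; exact: tame_mul.
Qed.

Lemma ctame_D w f : ctame f -> ctame (cD w f).
Proof. by move=> [f1 f2]; split => /=; exact: tame_derive. Qed.

Lemma cD_cst w (a : C) v : cD w (fun=> a) v = 0.
Proof. by rewrite /cD /reim !derive_cst. Qed.

Lemma cD_real w (u : V -> R) v : cD w (fun x => (u x)%:C%C) v = ('D_w u v)%:C%C.
Proof. by rewrite /cD /reim/= derive_cst. Qed.

Lemma cD_add w f g v : ctame f -> ctame g ->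
  cD w (fun x => f x + g x) v = cD w f v + cD w g v.
Proof.
move=> [f1 f2] [g1 g2]; rewrite {1}/cD /reim.
under [fun v => complex.Re (_ + _)]eq_fun do rewrite ReD.
under [fun v => complex.Im (_ + _)]eq_fun do rewrite ImD.
by rewrite (tD_add _ _ f1 g1) (tD_add _ _ f2 g2).
Qed.

Lemma cD_mul w f g v : ctame f -> ctame g ->
  cD w (fun x => f x * g x) v = cD w f v * g v + f v * cD w g v.
Proof.
move=> [f1 f2] [g1 g2]; rewrite {1}/cD /reim.
under [fun v => complex.Re (_ * _)]eq_fun do rewrite ReM.
under [fun v => complex.Im (_ * _)]eq_fun do rewrite ImM.
rewrite (tD_sub _ _ (tame_mul f1 g1) (tame_mul f2 g2)).
rewrite (tD_add _ _ (tame_mul f1 g2) (tame_mul f2 g1)).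
rewrite (tD_mul _ _ f1 g1) (tD_mul _ _ f2 g2) (tD_mul _ _ f1 g2) (tD_mul _ _ f2 g1).
rewrite /cD /reim.
case: (f v) => a b; case: (g v) => a' b' /=.
set u1 := derive _ _ _; set u2 := derive _ _ _; set u3 := derive _ _ _; set u4 := derive _ _ _.
by congr Complex => /=; ring.
Qed.

Lemma cD_scale w (a : C) f v : ctame f -> cD w (fun x => a * f x) v = a * cD w f v.
Proof.
by move=> tf; rewrite (cD_mul _ _ (ctame_cst a) tf) cD_cst mul0r add0r.
Qed.

Lemma ctame_expi (u : V -> R) : tame D u -> ctame (fun v => expi (u v)).
Proof. by move=> tu; split => /=; [exact: tame_cos|exact: tame_sin]. Qed.

Lemma cD_expi w (u : V -> R) v : tame D u ->
  cD w (fun x => expi (u x)) v = Complex 0 ('D_w u v) * expi (u v).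
Proof.
move=> tu; rewrite /cD /reim /= (tD_cos _ _ tu) (tD_sin _ _ tu).
by rewrite /expi /GRing.mul/= !mul0r !add0r.
Qed.

Lemma cD_symmetric u w f : ctame f -> cD w (cD u f) = cD u (cD w f).
Proof.
move=> [f1 f2]; apply/funext => v.
exact: (f_equal2 (@Complex R) (congr1 (@^~ v) (tame_symmetric u w f1))
  (congr1 (@^~ v) (tame_symmetric u w f2))).
Qed.

End Basic.

Lemma cD_slice (V W : normedModType R) (i : V -> W) (v : V) (w : W) (f : W -> C) y :
  (forall h z, i (h *: v + z) = h *: w + i z) ->
  cD v (f \o i) y = cD w f (i y).
Proof.
move=> iE; exact: (f_equal2 (@Complex R)
  (derive_slice (fun u => complex.Re (f u)) y iE)
  (derive_slice (fun u => complex.Im (f u)) y iE)).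
Qed.

Lemma ctame_subst (V W : normedModType R) (D : set V) (E : set W) (psi : V -> W)
    (f : W -> C) : (forall v, D v -> E (psi v)) ->
  (forall l : W -> R, (forall a x y, l (a *: x + y) = a * l x + l y) ->
    continuous l -> tame D (fun v => l (psi v))) ->
  ctame E f -> ctame D (fun v => f (psi v)).
Proof.
by move=> DE pl [f1 f2]; split; [exact: (tame_subst DE pl f1)|exact: (tame_subst DE pl f2)].
Qed.

End ComplexTame.

Section PlanarWave.
Variables (R : realType) (c : R).
Hypothesis c0 : c != 0.
Local Notation C := R[i].
Local Notation V := (R * R * R)%type.

Let cs (v : V) : R := v.1.1.
Let cq (v : V) : R := v.1.2.
Let ct (v : V) : R := v.2.
Definition es : V := (1, 0, 0).
Definition et : V := (0, 0, 1).
(** The image of (x, y) in the coordinates s = <x,y>, q = |x|^2 |y|^2 lies here by the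
    Cauchy-Schwarz inequality. *)
Definition cone : set V := [set v | cs v * cs v <= cq v].

Let lin_cs a x y : cs (a *: x + y) = a * cs x + cs y. Proof. by []. Qed.
Let lin_cq a x y : cq (a *: x + y) = a * cq x + cq y. Proof. by []. Qed.
Let lin_ct a x y : ct (a *: x + y) = a * ct x + ct y. Proof. by []. Qed.

Let cont_cs : continuous cs.
Proof. by move=> v; apply: (@cvg_comp _ _ _ fst fst); exact: cvg_fst. Qed.
Let cont_cq : continuous cq.
Proof. by move=> v; apply: (@cvg_comp _ _ _ fst snd); [exact: cvg_fst|exact: cvg_snd]. Qed.
Let cont_ct : continuous ct. Proof. by move=> v; exact: cvg_snd. Qed.

Let ts : tame cone cs. Proof. exact: tame_lin. Qed.
Let tq : tame cone cq. Proof. exact: tame_lin. Qed.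
Let tt : tame cone ct. Proof. exact: tame_lin. Qed.

Let Ds_s v : 'D_es cs v = 1. Proof. exact: derive_linear_fun. Qed.
Let Ds_q v : 'D_es cq v = 0. Proof. exact: derive_linear_fun. Qed.
Let Ds_t v : 'D_es ct v = 0. Proof. exact: derive_linear_fun. Qed.
Let Dt_s v : 'D_et cs v = 0. Proof. exact: derive_linear_fun. Qed.
Let Dt_q v : 'D_et cq v = 0. Proof. exact: derive_linear_fun. Qed.
Let Dt_t v : 'D_et ct v = 1. Proof. exact: derive_linear_fun. Qed.

Let phase (v : V) := c * (cs v * cos (ct v)).
Let arg (v : V) := c ^+ 2 * ((cq v - cs v * cs v) * (sin (ct v) * sin (ct v))).

Let t_phase : tame cone phase.
Proof. by apply: tame_scale; apply: tame_mul => //; exact: tame_cos. Qed.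

Let t_gap : tame cone (fun v => cq v - cs v * cs v).
Proof. by apply: tame_sub => //; exact: tame_mul. Qed.

Let t_arg : tame cone arg.
Proof. by apply: tame_scale; apply: tame_mul => //; apply: tame_mul; exact: tame_sin. Qed.

Let arg_ge0 v : cone v -> 0 <= arg v.
Proof. move=> vc; apply: mulr_ge0; first exact: sqr_ge0.
by apply: mulr_ge0; [rewrite subr_ge0|rewrite -expr2 sqr_ge0]. Qed.

Let t_bessel j : tame cone (fun v => bessel j (arg v)).
Proof. exact: (tame_comp j (@besselP R) t_arg). Qed.

Let D_phase w v : 'D_w phase v =
  c * ('D_w cs v * cos (ct v) - cs v * ('D_w ct v * sin (ct v))).
Proof.
rewrite (tD_scale _ _ _ (tame_mul ts (tame_cos tt))) (tD_mul _ _ ts (tame_cos tt)).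
by rewrite (tD_cos _ _ tt) mulrN.
Qed.

Let D_arg w v : 'D_w arg v = c ^+ 2 *
  (('D_w cq v - 2 * cs v * 'D_w cs v) * (sin (ct v) * sin (ct v)) +
   2 * (cq v - cs v * cs v) * 'D_w ct v * (sin (ct v) * cos (ct v))).
Proof.
have tsi := tame_sin tt.
rewrite (tD_scale _ _ _ (tame_mul t_gap (tame_mul tsi tsi))).
rewrite (tD_mul _ _ t_gap (tame_mul tsi tsi)) (tD_mul _ _ tsi tsi).
rewrite (tD_sub _ _ tq (tame_mul ts ts)) (tD_mul _ _ ts ts).
by rewrite (tD_sin _ _ tt); ring.
Qed.

Let D_bessel j w v :
  'D_w (fun v => bessel j (arg v)) v = 'D_w arg v * bessel j.+1 (arg v).
Proof. exact: (tD_comp _ _ _ (@besselP R) t_arg). Qed.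

Let F0 (v : V) : C := expi (phase v) * (bessel 0 (arg v))%:C%C.
Let g0 (v : V) : R := - 2 * c * (sin (ct v) * bessel 1 (arg v)).
Let G0 (v : V) : C := expi (phase v) * (g0 v)%:C%C.
Let K (v : V) : C := expi (ct v) / Complex 0 c.

(** The pair (F, G) such that F + omega G is the propagated plane wave in dimension
    2 (k + 1). The recursion raises the dimension by two with a derivative in s, and the factor e^{it} / (i c) restores the initial
    values (e^{ics}, 0). *)
Fixpoint wave_pair (k : nat) : (V -> C) * (V -> C) :=
  if k is k.+1 then
    (fun v => K v * (cD es (wave_pair k).1 v + (wave_pair k).2 v),
     fun v => K v * cD es (wave_pair k).2 v)
  else (F0, G0).

Let t_g0 : tame cone g0.
Proof. by apply: tame_scale; apply: tame_mul => //; exact: tame_sin. Qed.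

Let ctK : ctame cone K.
Proof. by apply: ctame_mul; [exact: ctame_expi|exact: ctame_cst]. Qed.

Lemma wave_pair_tame k :
  ctame cone (wave_pair k).1 /\ ctame cone (wave_pair k).2.
Proof.
elim: k => [|k [tF tG]] /=.
  by split; apply: ctame_mul; do ?exact: ctame_expi; exact: ctame_real.
split; apply: ctame_mul => //; last exact: ctame_D.
by apply: ctame_add => //; exact: ctame_D.
Qed.

Let D_K w v : cD w K v = Complex 0 ('D_w ct v) * K v.
Proof.
rewrite (cD_mul _ _ (ctame_expi tt) (ctame_cst _ _)) cD_cst (cD_expi _ _ tt).
by rewrite mulr0 addr0 /K mulrA.
Qed.

Lemma wave_pair_init k s q :
  (wave_pair k).1 (s, q, 0) = expi (c * s) /\ (wave_pair k).2 (s, q, 0) = 0.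
Proof.
pose i (s : R) : V := (s, q, 0).
have iE (h z : R) : i (h *: 1 + z) = h *: es + i z.
  by congr (_, _, _) => /=; rewrite ?scaler0 ?add0r.
elim: k s => [|k IH] s.
  rewrite /= /F0 /G0 /g0 /phase /arg /ct /cs /cq /=. rewrite cos0 sin0 mul0r !mulr0 mulr1.
  rewrite bessel00; split; first exact: mulr1. by rewrite mul0r mulr0; exact: mulr0.
have E1 : (wave_pair k).1 \o i = fun s => expi (c * s).
  by apply/funext => z; exact: (IH z).1.
have E2 : (wave_pair k).2 \o i = fun=> 0.
  by apply/funext => z; exact: (IH z).2.
have tid : tame setT (fun s : R => c * s).
  by apply: tame_scale; apply: tame_lin => // x; exact: cvg_id.
have D1 : cD es (wave_pair k).1 (i s) = Complex 0 c * expi (c * s).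
  rewrite -(cD_slice _ _ iE) E1 (cD_expi _ _ tid).
  rewrite (_ : 'D_1 _ s = c)//; rewrite -[RHS]mulr1.
  apply: (@derive_linear_fun _ _ (fun s => c * s)) => [a x y|x].
    by rewrite /GRing.scale/=; ring.
  by apply: cvgMr; exact: cvg_id.
have D2 : cD es (wave_pair k).2 (i s) = 0 by rewrite -(cD_slice _ _ iE) E2 cD_cst.
rewrite /= -/(i s) D1 D2 mulr0 (IH s).2 addr0; split=> //.
rewrite /K /ct /= (_ : expi 0 = 1); last by rewrite /expi cos0 sin0.
by rewrite mul1r mulrA mulVf ?mul1r// eq_complex /= negb_and c0 orbT.
Qed.

(** The evolution equation in the coordinates (s, q, t). For k = 0 it is the
    differential equation of [bessel]; the step applies d/ds to the equation of the
    previous dimension. *)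
Lemma wave_pair_pde k v :
  cD et (wave_pair k).1 v = 'i%C * ((cq v - cs v * cs v)%:C%C * cD es (wave_pair k).2 v
     - (2 * k%:R + 1) * (cs v)%:C%C * (wave_pair k).2 v) /\
  cD et (wave_pair k).2 v = 'i%C * ((2 * k%:R) * (wave_pair k).2 v - cD es (wave_pair k).1 v).
Proof.
elim: k v => [|k IH] v.
  have tE := ctame_expi t_phase.
  have tb := ctame_real (t_bessel 0); have tg := ctame_real t_g0.
  have Dg0 w : 'D_w g0 v = - 2 * c * ('D_w ct v * cos (ct v) * bessel 1 (arg v) +
      sin (ct v) * ('D_w arg v * bessel 2 (arg v))).
    rewrite (tD_scale _ _ _ (tame_mul (tame_sin tt) (t_bessel 1))).
    by rewrite (tD_mul _ _ (tame_sin tt) (t_bessel 1)) (tD_sin _ _ tt) D_bessel.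
  rewrite /= !(cD_mul _ _ tE tb) !(cD_mul _ _ tE tg) !(cD_expi _ _ t_phase).
  rewrite !cD_real !D_bessel !Dg0 !D_phase !D_arg.
  rewrite Ds_s Ds_q Ds_t Dt_s Dt_q Dt_t /G0 /g0.
  have ode := bessel_ode0 (arg v).
  have {}ode : bessel 0 (arg v) = - (4 * arg v * bessel 2 (arg v) + 2 * bessel 1 (arg v)).
    by apply/eqP; rewrite -addr_eq0 addrC ode.
  rewrite ode /arg; move: (bessel 2 _) (bessel 1 _) => b2 b1.
  move: (cos (ct v)) (sin (ct v)) (cs v) (cq v) => co si s q.
  case: (expi _) => e1 e2; rewrite mulr0 add0r.
  by split; congr Complex => /=; ring.
have [tF tG] := wave_pair_tame k.
have tDF := ctame_D es tF; have tDG := ctame_D es tG.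
have IHF : cD et (wave_pair k).1 = fun v => 'i%C * ((cq v - cs v * cs v)%:C%C * cD es (wave_pair k).2 v
     - (2 * k%:R + 1) * (cs v)%:C%C * (wave_pair k).2 v).
  by apply/funext => x; exact: (IH x).1.
have IHG : cD et (wave_pair k).2 = fun v => 'i%C * ((2 * k%:R) * (wave_pair k).2 v - cD es (wave_pair k).1 v).
  by apply/funext => x; exact: (IH x).2.
have tgap := ctame_real t_gap; have tcs := ctame_real ts.
have tk := @ctame_cst _ _ cone (2 * k%:R + 1 : C).
have tk' := @ctame_cst _ _ cone (2 * k%:R : C); have ti := @ctame_cst _ _ cone ('i%C : C).
have tN := @ctame_cst _ _ cone (-1 : C).
have DG : cD es (cD et (wave_pair k).2) v = 'i%C * (2 * k%:R * cD es (wave_pair k).2 v -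
    cD es (cD es (wave_pair k).1) v).
  rewrite IHG (_ : (fun x => _) = fun x => 'i%C * (2 * k%:R * (wave_pair k).2 x +
    -1 * cD es (wave_pair k).1 x)); last by apply/funext => x; rewrite mulN1r.
  rewrite (cD_scale _ _ _ (ctame_add (ctame_mul tk' tG) (ctame_mul tN tDF))).
  rewrite (cD_add _ _ (ctame_mul tk' tG) (ctame_mul tN tDF)).
  by rewrite (cD_scale _ _ _ tG) (cD_scale _ _ _ tDF) mulN1r.
have DF : cD es (cD et (wave_pair k).1) v = 'i%C *
    ((cq v - cs v * cs v)%:C%C * cD es (cD es (wave_pair k).2) v
     - (2 * k%:R + 3) * (cs v)%:C%C * cD es (wave_pair k).2 v -
     (2 * k%:R + 1) * (wave_pair k).2 v).
  rewrite IHF (_ : (fun x => _) = fun x => 'i%C * ((cq x - cs x * cs x)%:C%C *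
      cD es (wave_pair k).2 x + -1 * ((2 * k%:R + 1) * ((cs x)%:C%C * (wave_pair k).2 x)))); last first.
    by apply/funext => x; rewrite mulN1r mulrA.
  have t1 := ctame_mul tgap tDG; have t2 := ctame_mul tcs tG.
  have t3 := ctame_mul tN (ctame_mul tk t2).
  rewrite (cD_scale _ _ _ (ctame_add t1 t3)) (cD_add _ _ t1 t3).
  rewrite (cD_scale _ _ _ (ctame_mul tk t2)) (cD_scale _ _ _ t2).
  rewrite (cD_mul _ _ tgap tDG) (cD_mul _ _ tcs tG) !cD_real.
  rewrite (tD_sub _ _ tq (tame_mul ts ts)) (tD_mul _ _ ts ts) Ds_s Ds_q.
  have -> : (0 - (1 * cs v + cs v * 1))%:C%C = - 2 * (cs v)%:C%C :> C.
    by rewrite mul1r mulr1 sub0r rmorphN rmorphD/=; ring.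
  have -> : 1%:C%C = 1 :> C by [].
  by ring.
rewrite /= !(cD_mul _ _ ctK (ctame_add tDF tG)) !(cD_mul _ _ ctK tDG) !(cD_add _ _ tDF tG).
rewrite !(cD_symmetric es et tF) !(cD_symmetric es et tG) DF DG (IH v).2.
rewrite !D_K Ds_t Dt_t -[k.+1%:R]natr1.
have -> : Complex 0 0 = 0 :> C by [].
have -> : Complex 0 1 = 'i%C :> C by [].
by split; ring.
Qed.

End PlanarWave.

(** * Clifford-valued calculus *)

Section ChainRule.
Variable R : realType.
Local Notation V3 := (R * R * R)%type.

Definition eq3 : V3 := (0, 1, 0).

Let triple (a b d : R) : (a, b, d) = a *: es R + b *: eq3 + d *: et R :> V3.
Proof.
congr (_, _, _) => /=; rewrite /GRing.scale/= ?mulr0 ?mulr1 ?addr0 ?add0r//.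
Qed.

Lemma derive_chain3 (V : normedModType R) (s q t : V -> R) (F : V3 -> R) w v :
  differentiable s v -> differentiable q v -> differentiable t v ->
  differentiable F (s v, q v, t v) ->
  'D_w (fun x => F (s x, q x, t x)) v =
    'D_w s v * 'D_(es R) F (s v, q v, t v) +
    'D_w q v * 'D_eq3 F (s v, q v, t v) +
    'D_w t v * 'D_(et R) F (s v, q v, t v).
Proof.
move=> ds dq dt dF; have d1 := differentiable_pair ds dq.
have d2 := differentiable_pair d1 dt.
have E (p : V3) a b d : 'd F p (a, b, d) =
    a * 'd F p (es R) + b * 'd F p eq3 + d * 'd F p (et R).
  rewrite triple 2!linearD; congr (_ + _ + _); exact: linearZ.
rewrite deriveE; last exact: (differentiable_comp d2 dF).
rewrite (diff_comp d2 dF) /comp (diff_pair d1 dt) (diff_pair ds dq).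
by rewrite (deriveE _ ds) (deriveE _ dq) (deriveE _ dt) !(deriveE _ dF) -E.
Qed.

End ChainRule.

Section CliffordTame.
Variables (R : realType) (m : nat).
Local Notation C := R[i].
Local Notation Cl := (clifford R[i] m).

Section Basic.
Variables (V : normedModType R) (D : set V).
Implicit Types (F G : V -> Cl) (f g : V -> C) (w v : V).

Definition cltame F := cl_reim_all (tame D) F.
Definition clD w F : V -> Cl := fun v => cl_reim (fun u => 'D_w u v) F.

Lemma clDE w F v A : clD w F v A = cD w (fun x => F x A) v.
Proof. by rewrite ffunE. Qed.

Lemma ctame_ext f g : (forall v, f v = g v) -> ctame D g -> ctame D f.
Proof. by move=> /funext ->. Qed.

Lemma cltame_ext F G : (forall v, F v = G v) -> cltame G -> cltame F.
Proof. by move=> /funext ->. Qed.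

Lemma cD_ext f g w v : (forall x, f x = g x) -> cD w f v = cD w g v.
Proof. by move=> /funext ->. Qed.

Lemma clD_ext F G w v : (forall x, F x = G x) -> clD w F v = clD w G v.
Proof. by move=> /funext ->. Qed.

Lemma ctame_sum I (r : seq I) (f : I -> V -> C) :
  (forall i, ctame D (f i)) -> ctame D (fun v => \sum_(i <- r) f i v).
Proof.
move=> tf; elim: r => [|i r IH].
  by apply: (ctame_ext _ (ctame_cst D 0)) => v; rewrite big_nil.
by apply: (ctame_ext _ (ctame_add (tf i) IH)) => v; rewrite big_cons.
Qed.

Lemma cD_sum I (r : seq I) (f : I -> V -> C) w v : (forall i, ctame D (f i)) ->
  cD w (fun x => \sum_(i <- r) f i x) v = \sum_(i <- r) cD w (f i) v.
Proof.
move=> tf; elim: r => [|i r IH].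
  by rewrite big_nil (cD_ext (g := fun=> 0)) ?cD_cst// => x; rewrite big_nil.
rewrite (cD_ext (g := fun x => f i x + \sum_(i <- r) f i x)) => [|x]; last by rewrite big_cons.
by rewrite (cD_add _ _ (tf i) (ctame_sum r tf)) IH big_cons.
Qed.

Lemma cltame_cst (a : Cl) : cltame (fun=> a).
Proof. by move=> A; exact: (ctame_cst D (a A)). Qed.

Lemma cltame_add F G : cltame F -> cltame G -> cltame (fun v => F v + G v).
Proof.
by move=> tF tG A; apply: (ctame_ext _ (ctame_add (tF A) (tG A))) => v; rewrite ffunE.
Qed.

Lemma cltame_scale f F : ctame D f -> cltame F -> cltame (fun v => f v *: F v).
Proof.
by move=> tf tF A; apply: (ctame_ext _ (ctame_mul tf (tF A))) => v; rewrite ffunE.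
Qed.

Lemma cltame_mul F G : cltame F -> cltame G -> cltame (fun v => F v * G v).
Proof.
move=> tF tG A; apply: (ctame_ext (g := fun v => \sum_(B : {set 'I_m})
    (-1) ^+ swaps B (symdiff B A) * (F v B * G v (symdiff B A)))) => [v|].
  by rewrite ffunE.
apply: ctame_sum => B; apply: ctame_mul; first exact: ctame_cst.
exact: (ctame_mul (tF _) (tG _)).
Qed.

Lemma cltame_D w F : cltame F -> cltame (clD w F).
Proof.
by move=> tF A; apply: (ctame_ext _ (ctame_D w (tF A))) => v; exact: clDE.
Qed.

Lemma cltame_sum I (r : seq I) (P : pred I) (F : I -> V -> Cl) :
  (forall i, cltame (F i)) -> cltame (fun v => \sum_(i <- r | P i) F i v).
Proof.
move=> tF; elim: r => [|i r IH].
  by apply: (cltame_ext _ (cltame_cst 0)) => v; rewrite big_nil.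
apply: (cltame_ext (G := fun v => if P i then F i v + \sum_(j <- r | P j) F j v
    else \sum_(j <- r | P j) F j v)) => [v|]; first by rewrite big_cons.
by case: (P i) => //; exact: cltame_add.
Qed.

Lemma clD_cst w (a : Cl) v : clD w (fun=> a) v = 0.
Proof. by apply/ffunP => A; rewrite clDE cD_cst ffunE. Qed.

Lemma clD_add w F G v : cltame F -> cltame G ->
  clD w (fun x => F x + G x) v = clD w F v + clD w G v.
Proof.
move=> tF tG; apply/ffunP => A; rewrite clDE [RHS]ffunE !clDE.
rewrite (cD_ext (g := fun x => F x A + G x A)) => [|x]; last by rewrite ffunE.
exact: (cD_add _ _ (tF A) (tG A)).
Qed.

Lemma clD_scale w f F v : ctame D f -> cltame F ->
  clD w (fun x => f x *: F x) v = cD w f v *: F v + f v *: clD w F v.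
Proof.
move=> tf tF; apply/ffunP => A; rewrite clDE !ffunE.
rewrite (cD_ext (g := fun x => f x * F x A)) => [|x]; last by rewrite ffunE.
exact: (cD_mul _ _ tf (tF A)).
Qed.

Lemma clD_scale_cst w (a : C) F v : cltame F ->
  clD w (fun x => a *: F x) v = a *: clD w F v.
Proof.
by move=> tF; rewrite (clD_scale _ _ (ctame_cst D a) tF) cD_cst scale0r add0r.
Qed.

Lemma clD_mul w F G v : cltame F -> cltame G ->
  clD w (fun x => F x * G x) v = clD w F v * G v + F v * clD w G v.
Proof.
move=> tF tG; apply/ffunP => A; rewrite clDE !ffunE.
rewrite (cD_ext (g := fun v => \sum_(B : {set 'I_m})
    (-1) ^+ swaps B (symdiff B A) * (F v B * G v (symdiff B A)))) => [|x]; last by rewrite ffunE.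
rewrite cD_sum => [|B]; last first.
  by apply: ctame_mul; [exact: ctame_cst|exact: (ctame_mul (tF _) (tG _))].
rewrite -big_split /=; apply: eq_bigr => B _.
rewrite (cD_scale _ _ _ (ctame_mul (tF _) (tG _))) (cD_mul _ _ (tF _) (tG _)).
by rewrite mulrDr !clDE.
Qed.

Lemma clD_mulcl w (a : Cl) F v : cltame F -> clD w (fun x => a * F x) v = a * clD w F v.
Proof.
by move=> tF; rewrite (clD_mul _ _ (cltame_cst a) tF) clD_cst mul0r add0r.
Qed.

Lemma clD_sum w I (r : seq I) (P : pred I) (F : I -> V -> Cl) v :
  (forall i, cltame (F i)) ->
  clD w (fun x => \sum_(i <- r | P i) F i x) v = \sum_(i <- r | P i) clD w (F i) v.
Proof.
move=> tF; elim: r => [|i r IH].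
  by rewrite big_nil (clD_ext (G := fun=> 0)) ?clD_cst// => x; rewrite big_nil.
rewrite (clD_ext (G := fun v => if P i then F i v + \sum_(j <- r | P j) F j v
    else \sum_(j <- r | P j) F j v)) => [|x]; last by rewrite big_cons.
rewrite big_cons; case: (P i) => //.
by rewrite (clD_add _ _ (tF i) (cltame_sum r P tF)) IH.
Qed.

Lemma clD_symmetric u w F : cltame F -> clD w (clD u F) = clD u (clD w F).
Proof.
move=> tF; apply/funext => v; apply/ffunP => A.
transitivity (cD w (cD u (fun x => F x A)) v).
  by rewrite clDE; apply: cD_ext => x; exact: clDE.
rewrite (cD_symmetric u w (tF A)).
by rewrite clDE; apply: cD_ext => x; rewrite clDE.
Qed.

End Basic.

Lemma clD_slice (V W : normedModType R) (i : V -> W) (v : V) (w : W) (F : W -> Cl) y :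
  (forall h z, i (h *: v + z) = h *: w + i z) -> clD v (F \o i) y = clD w F (i y).
Proof.
by move=> iE; apply/ffunP => A; rewrite !clDE; exact: (cD_slice (fun u => F u A) y iE).
Qed.

End CliffordTame.

Section CliffordVectors.
Variables (K : comNzRingType) (m : nat).
Local Notation Cl := (clifford K m).
Local Notation e := (@cl_gen K m).

Definition cl_vec (x : 'I_m -> K) : Cl := \sum_j x j *: e j.

Lemma scale_mul (a b : K) (u v : Cl) : (a *: u) * (b *: v) = (a * b) *: (u * v).
Proof. by rewrite -scalerAl -scalerAr scalerA. Qed.

Let sum_triangle (M : zmodType) (f : 'I_m -> 'I_m -> M) :
  \sum_j \sum_k f j k =
  \sum_(j < m) \sum_(k < m | (j < k)%N) (f j k + f k j) + \sum_j f j j.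
Proof.
have E (j : 'I_m) : \sum_k f j k = \sum_(k < m | (j < k)%N) f j k +
    \sum_(k < m | (k < j)%N) f j k + f j j.
  rewrite (bigID (fun k : 'I_m => (j < k)%N)) /= -addrA; congr (_ + _).
  rewrite (bigD1 j)/= ?ltnn// addrC; congr (_ + _); apply: eq_bigl => k.
  by rewrite -leqNgt -val_eqE/= ltn_neqAle andbC.
under eq_bigr do rewrite E; rewrite big_split/=; congr (_ + _).
under [in RHS]eq_bigr do rewrite big_split; rewrite !big_split/=; congr (_ + _).
rewrite (exchange_big_dep xpredT)//=.
Qed.

(** Polarized form of the defining relations: the square of a vector is minus its
    squared length. *)
Lemma cl_vecM (x y : 'I_m -> K) :
  cl_vec x * cl_vec y + cl_vec y * cl_vec x = - (2 * \sum_j x j * y j)%:A.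
Proof.
have P (x' y' : 'I_m -> K) :
    cl_vec x' * cl_vec y' = \sum_j \sum_k (x' j * y' k) *: (e j * e k).
  rewrite /cl_vec mulr_suml; apply: eq_bigr => j _.
  by rewrite mulr_sumr; apply: eq_bigr => k _; rewrite scale_mul.
rewrite !P [X in _ + X]exchange_big/= -big_split/= mulr_sumr scaler_suml -sumrN.
apply: eq_bigr => a _; rewrite -big_split/= (bigD1 a)//= big1 ?addr0 => [|b ba].
  rewrite cl_gen_sqr [y a * _]mulrC scalerN -opprD -scalerDl.
  by rewrite mulr_natl mulr2n.
by rewrite [y b * _]mulrC -scalerDr cl_gen_anti ?scaler0// eq_sym.
Qed.

(** The rotation operator is minus the sum of y D and E, with D the Dirac and E the
    Euler operator: in y D the off-diagonal products antisymmetrize to rotations and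
    the diagonal ones give - E. Here d stands for the gradient. *)
Lemma rotation_dirac (y : 'I_m -> K) (d : 'I_m -> Cl) :
  - \sum_(j < m) \sum_(k < m | (j < k)%N) e j * e k * (y j *: d k - y k *: d j) =
  - (cl_vec y * \sum_k e k * d k + \sum_j y j *: d j).
Proof.
congr (- _); rewrite /cl_vec mulr_suml.
under [in RHS]eq_bigr do rewrite mulr_sumr.
rewrite sum_triangle -addrA -big_split/= [X in _ + X]big1 ?addr0 => [|j _].
  apply: eq_bigr => j _; apply: eq_bigr => k jk.
  rewrite mulrBr -scalerAr; congr (_ + _); first by rewrite -scalerAl mulrA.
  rewrite -scalerAr -scalerAl mulrA -scalerN; congr (_ *: _).
  have jk' : j != k by apply: contraTneq jk => ->; rewrite ltnn.
  have /eqP := cl_gen_anti K jk'; rewrite addr_eq0 => /eqP ->.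
  by rewrite mulNr opprK.
by rewrite -scalerAl mulrA cl_gen_sqr mulN1r scalerN addNr.
Qed.

Section RadialGradient.
Variables (x y : 'I_m -> K) (Fs P Gs Q g : K) (W : Cl).
Local Notation X := (cl_vec x).
Local Notation Y := (cl_vec y).
Let d j : Cl := (x j * Fs) *: 1 + (y j * P) *: 1 +
  ((x j * Gs) *: W + (y j * Q) *: W) + (g *: (e j * X) + (x j * g) *: 1).

Let sum_vec (f : 'I_m -> K) (a : K) (Z : Cl) :
  \sum_j e j * ((f j * a) *: Z) = a *: (cl_vec f * Z).
Proof.
rewrite /cl_vec mulr_suml scaler_sumr; apply: eq_bigr => j _.
by rewrite -scalerAr -scalerAl scalerA mulrC.
Qed.

Let sum_dot (f : 'I_m -> K) (a : K) (Z : Cl) :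
  \sum_j y j *: ((f j * a) *: Z) = ((\sum_j f j * y j) * a) *: Z.
Proof.
rewrite mulr_suml scaler_suml; apply: eq_bigr => j _.
by rewrite scalerA; congr (_ *: _); ring.
Qed.

(** The family d is the gradient in y of F + G W for W = y x + <x,y>, as given by the
    chain rule; the factor 1 - m comes from the sum of e_j e_j over j together with
    the gradient of <x,y>. *)
Lemma dirac_radial : \sum_j e j * d j =
  Fs *: X + P *: Y + (Gs *: (X * W) + Q *: (Y * W)) + ((1 - m%:R) * g) *: X.
Proof.
transitivity (\sum_j (e j * ((x j * Fs) *: 1) + e j * ((y j * P) *: 1) +
   (e j * ((x j * Gs) *: W) + e j * ((y j * Q) *: W)) +
   (- g *: X + e j * ((x j * g) *: 1)))).
  apply: eq_bigr => j _; rewrite /d !mulrDr; congr (_ + (_ + _)).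
  by rewrite -scalerAr mulrA cl_gen_sqr mulN1r scalerN scaleNr.
rewrite !big_split/= !sum_vec !mulr1 sumr_const card_ord; congr (_ + _).
by rewrite -scaler_nat scalerA -scalerDl; congr (_ *: _); ring.
Qed.

(** The companion of [dirac_radial] for the Euler operator. *)
Lemma euler_radial : \sum_j y j *: d j =
  ((\sum_j x j * y j) * Fs + (\sum_j y j * y j) * P) *: 1 +
  ((\sum_j x j * y j) * Gs + (\sum_j y j * y j) * Q) *: W +
  g *: (Y * X + (\sum_j x j * y j) *: 1).
Proof.
transitivity (\sum_j (y j *: ((x j * Fs) *: 1) + y j *: ((y j * P) *: 1) +
   (y j *: ((x j * Gs) *: W) + y j *: ((y j * Q) *: W)) +
   (g *: ((y j *: e j) * X) + y j *: ((x j * g) *: 1)))).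
  apply: eq_bigr => j _; rewrite /d !scalerDr; congr (_ + (_ + _)).
  by rewrite -scalerAl !scalerA mulrC.
rewrite !big_split/= !sum_dot -!scalerDl; congr (_ + _).
rewrite -scaler_sumr -mulr_suml scalerDr scalerA; congr (_ + _ *: _).
by rewrite mulrC.
Qed.

End RadialGradient.

End CliffordVectors.

(** * The propagated plane wave *)

Section Wave.
Variables (R : realType) (m : nat).
Local Notation C := R[i].
Local Notation Cl := (clifford R[i] m).
Local Notation E := ('rV[R]_m * 'rV[R]_m * R)%type.
Local Notation V3 := (R * R * R)%type.
Local Notation e := (@cl_gen C m).

Definition ex (j : 'I_m) : E := (delta_mx 0 j, 0, 0).
Definition ey (j : 'I_m) : E := (0, delta_mx 0 j, 0).
Definition ez : E := (0, 0, 1).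

Lemma tame_x j : tame setT (fun v : E => v.1.1 0 j).
Proof.
apply: tame_lin => [a u v|v]; first by rewrite !mxE.
apply: (@cvg_comp _ _ _ (fun v : E => v.1.1) (fun x : 'rV[R]_m => x 0 j)).
  by apply: (@cvg_comp _ _ _ fst fst); exact: cvg_fst.
exact: coord_continuous.
Qed.

Lemma tame_y j : tame setT (fun v : E => v.1.2 0 j).
Proof.
apply: tame_lin => [a u v|v]; first by rewrite !mxE.
apply: (@cvg_comp _ _ _ (fun v : E => v.1.2) (fun x : 'rV[R]_m => x 0 j)).
  by apply: (@cvg_comp _ _ _ fst snd); [exact: cvg_fst|exact: cvg_snd].
exact: coord_continuous.
Qed.

Lemma tame_z : tame setT (fun v : E => v.2).
Proof. by apply: tame_lin => // v; exact: cvg_snd. Qed.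

Let lin_derive (l : E -> R) (w v : E) :
  (forall a x y, l (a *: x + y) = a * l x + l y) -> continuous l -> 'D_w l v = l w.
Proof. exact: derive_linear_fun. Qed.

Lemma derive_x j w v : 'D_w (fun v : E => v.1.1 0 j) v = w.1.1 0 j.
Proof.
apply: (@lin_derive (fun v : E => v.1.1 0 j)) => [a u {}v|{}v]; first by rewrite !mxE.
exact: (tame_continuous (tame_x j)).
Qed.

Lemma derive_y j w v : 'D_w (fun v : E => v.1.2 0 j) v = w.1.2 0 j.
Proof.
apply: (@lin_derive (fun v : E => v.1.2 0 j)) => [a u {}v|{}v]; first by rewrite !mxE.
exact: (tame_continuous (tame_y j)).
Qed.

Lemma derive_z w v : 'D_w (fun v : E => v.2) v = w.2.
Proof. by apply: (@lin_derive (fun v : E => v.2)) => // {}v; exact: cvg_snd. Qed.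

Definition sv (v : E) : R := dotp v.1.1 v.1.2.
Definition qv (v : E) : R := dotp v.1.1 v.1.1 * dotp v.1.2 v.1.2.

Let t_dot (f g : 'I_m -> E -> R) : (forall j, tame setT (f j)) ->
  (forall j, tame setT (g j)) -> tame setT (fun v => \sum_j f j v * g j v).
Proof. by move=> tf tg; apply: tame_sum => j; exact: tame_mul. Qed.

Let D_dot (f g : 'I_m -> E -> R) w v : (forall j, tame setT (f j)) ->
  (forall j, tame setT (g j)) -> 'D_w (fun v => \sum_j f j v * g j v) v =
  \sum_j ('D_w (f j) v * g j v + f j v * 'D_w (g j) v).
Proof.
move=> tf tg.
have /(congr1 (@^~ v)) -> := tame_sumE (index_enum 'I_m) w (fun j => tame_mul (tf j) (tg j)).
by apply: eq_bigr => j _; exact: (tD_mul _ _ (tf j) (tg j)).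
Qed.

Lemma tame_sv : tame setT sv.
Proof. exact: (t_dot tame_x tame_y). Qed.

Lemma tame_xx : tame setT (fun v : E => dotp v.1.1 v.1.1).
Proof. exact: (t_dot tame_x tame_x). Qed.

Lemma tame_yy : tame setT (fun v : E => dotp v.1.2 v.1.2).
Proof. exact: (t_dot tame_y tame_y). Qed.

Lemma tame_qv : tame setT qv.
Proof. exact: (tame_mul tame_xx tame_yy). Qed.

Lemma dotpC (x y : 'rV[R]_m) : dotp x y = dotp y x.
Proof. by apply: eq_bigr => j _; rewrite mulrC. Qed.

Lemma dotpDl (x y z : 'rV[R]_m) : dotp (x + y) z = dotp x z + dotp y z.
Proof. by rewrite -big_split/=; apply: eq_bigr => j _; rewrite mxE mulrDl. Qed.

Lemma dotp_delta (x : 'rV[R]_m) j : dotp (delta_mx 0 j) x = x 0 j.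
Proof.
rewrite /dotp (bigD1 j)//= big1 ?addr0 => [|k kj].
  by rewrite mxE !eqxx mul1r.
by rewrite mxE (negPf kj) andbF mul0r.
Qed.

Lemma dotp0 (x : 'rV[R]_m) : dotp 0 x = 0.
Proof. by rewrite /dotp big1// => j _; rewrite mxE mul0r. Qed.

Lemma D_sv w v : 'D_w sv v = dotp w.1.1 v.1.2 + dotp v.1.1 w.1.2.
Proof.
rewrite (D_dot _ _ tame_x tame_y) big_split/=.
by congr (_ + _); apply: eq_bigr => j _; rewrite ?derive_x ?derive_y.
Qed.

Lemma D_xx w v : 'D_w (fun v : E => dotp v.1.1 v.1.1) v = 2 * dotp w.1.1 v.1.1.
Proof.
rewrite (D_dot _ _ tame_x tame_x) mulr_sumr; apply: eq_bigr => j _.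
by rewrite !derive_x; ring.
Qed.

Lemma D_yy w v : 'D_w (fun v : E => dotp v.1.2 v.1.2) v = 2 * dotp w.1.2 v.1.2.
Proof.
rewrite (D_dot _ _ tame_y tame_y) mulr_sumr; apply: eq_bigr => j _.
by rewrite !derive_y; ring.
Qed.

(** Lagrange's identity. *)
Lemma dotp_cauchy (x y : 'rV[R]_m) : dotp x y * dotp x y <= dotp x x * dotp y y.
Proof.
have H : 0 <= \sum_j \sum_k (x 0 j * y 0 k - x 0 k * y 0 j) ^+ 2.
  by apply: sumr_ge0 => j _; apply: sumr_ge0 => k _; exact: sqr_ge0.
rewrite -subr_ge0 -(pmulr_rge0 _ (ltr0n R 2)); move: H; congr (0 <= _).
transitivity (\sum_j \sum_k (x 0 j * x 0 j * (y 0 k * y 0 k)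
   + (y 0 j * y 0 j * (x 0 k * x 0 k)) + - 2 * ((x 0 j * y 0 j) * (x 0 k * y 0 k)))).
  by apply: eq_bigr => j _; apply: eq_bigr => k _; ring.
have S (a b : 'I_m -> R) : \sum_j \sum_k a j * b k = (\sum_j a j) * (\sum_k b k).
  by rewrite mulr_suml; apply: eq_bigr => j _; rewrite mulr_sumr.
under eq_bigr do rewrite !big_split/= -!mulr_sumr.
rewrite !big_split/= -!mulr_suml -/(dotp x x) -/(dotp y y) -/(dotp x y).
rewrite -(mulr_sumr _ _ _ (- 2)) -mulr_suml -/(dotp x y).
by ring.
Qed.

(** The scalar invariants s, q and t of (x, y, t). *)
Definition psi (v : E) : V3 := (sv v, qv v, v.2).

Lemma psi_cone v : @cone R (psi v). Proof. exact: dotp_cauchy. Qed.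

(** The invariants are polynomial, and they land in [cone], where the Bessel towers
    are bounded. *)
Lemma ctame_psi (f : V3 -> C) : ctame (@cone R) f -> ctame setT (fun v => f (psi v)).
Proof.
apply: ctame_subst => [v _|l Hl cl]; first exact: psi_cone.
have -> : (fun v => l (psi v)) = fun v =>
    sv v * l (1, 0, 0) + (qv v * l (0, 1, 0) + v.2 * l (0, 0, 1)).
  have l0 : l 0 = 0 by have := Hl (-1) 0 0; rewrite scaler0 addr0 mulN1r addNr.
  apply/funext => v.
  have -> : psi v = sv v *: (1, 0, 0) + (qv v *: (0, 1, 0) + (v.2 *: (0, 0, 1) + 0)) :> V3.
    by congr (_, _, _) => /=; rewrite /GRing.scale/= !(mulr0, mulr1, addr0, add0r).
  by rewrite !Hl l0 addr0.
apply: tame_add; first by apply: tame_mul; [exact: tame_sv|exact: tame_cst].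
apply: tame_add; first by apply: tame_mul; [exact: tame_qv|exact: tame_cst].
by apply: tame_mul; [exact: tame_z|exact: tame_cst].
Qed.

Lemma cD_psi (f : V3 -> C) w v : ctame (@cone R) f ->
  cD w (fun x => f (psi x)) v = ('D_w sv v)%:C%C * cD (es R) f (psi v) +
    ('D_w qv v)%:C%C * cD (eq3 R) f (psi v) + (w.2)%:C%C * cD (et R) f (psi v).
Proof.
move=> [f1 f2].
have d1 := tame_differentiable v tame_sv; have d2 := tame_differentiable v tame_qv.
have d3 := tame_differentiable v tame_z.
have e1 := derive_chain3 w d1 d2 d3 (tame_differentiable (psi v) f1).
have e2 := derive_chain3 w d1 d2 d3 (tame_differentiable (psi v) f2).
rewrite derive_z in e1 e2.
rewrite [LHS](f_equal2 (@Complex R) e1 e2) /cD /reim /psi.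
set a := 'D_w sv v; set b := 'D_w qv v.
move: (derive _ _ _) (derive _ _ _) => u1 u2; move: (derive _ _ _) (derive _ _ _) => u3 u4.
move: (derive _ _ _) (derive _ _ _) => u5 u6.
by congr Complex => /=; ring.
Qed.

Definition xv (v : E) : Cl := cl_vec (fun j => (v.1.1 0 j)%:C%C).
Definition yv (v : E) : Cl := cl_vec (fun j => (v.1.2 0 j)%:C%C).
(** The scalar <x,y> is added so that omega is the bivector of y and x: its square
    is then the scalar s^2 - q. *)
Definition omega (v : E) : Cl := yv v * xv v + (sv v)%:C%C *: 1.

(** The operator Gamma acting in the middle variable of functions of (x, y, t). *)
Definition Gamma_at (G : E -> Cl) : E -> Cl := fun v =>
  - \sum_(j < m) \sum_(k < m | (j < k)%N) e j * e k *
    ((v.1.2 0 j)%:C%C *: clD (ey k) G v - (v.1.2 0 k)%:C%C *: clD (ey j) G v).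

Lemma cltame_xv : cltame setT xv.
Proof.
apply: cltame_sum => j; apply: cltame_scale; last exact: cltame_cst.
exact/ctame_real/tame_x.
Qed.

Lemma cltame_yv : cltame setT yv.
Proof.
apply: cltame_sum => j; apply: cltame_scale; last exact: cltame_cst.
exact/ctame_real/tame_y.
Qed.

Lemma cltame_omega : cltame setT omega.
Proof.
apply: cltame_add; first exact: cltame_mul cltame_yv cltame_xv.
by apply: cltame_scale; [exact/ctame_real/tame_sv|exact: cltame_cst].
Qed.

Lemma clD_xv w v : clD w xv v = cl_vec (fun j => (w.1.1 0 j)%:C%C).
Proof.
rewrite (clD_sum (D := setT)) => [|j]; last first.
  by apply: cltame_scale; [exact/ctame_real/tame_x|exact: cltame_cst].
apply: eq_bigr => j _.
rewrite (clD_scale _ _ (ctame_real (tame_x j)) (cltame_cst _ _)) clD_cst scaler0 addr0.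
by rewrite cD_real derive_x.
Qed.

Lemma clD_yv w v : clD w yv v = cl_vec (fun j => (w.1.2 0 j)%:C%C).
Proof.
rewrite (clD_sum (D := setT)) => [|j]; last first.
  by apply: cltame_scale; [exact/ctame_real/tame_y|exact: cltame_cst].
apply: eq_bigr => j _.
rewrite (clD_scale _ _ (ctame_real (tame_y j)) (cltame_cst _ _)) clD_cst scaler0 addr0.
by rewrite cD_real derive_y.
Qed.

Lemma clD_omega w v : clD w omega v = cl_vec (fun j => (w.1.2 0 j)%:C%C) * xv v +
  yv v * cl_vec (fun j => (w.1.1 0 j)%:C%C) + ('D_w sv v)%:C%C *: 1.
Proof.
have ts := ctame_real tame_sv.
rewrite (clD_add _ _ (cltame_mul cltame_yv cltame_xv) (cltame_scale ts (cltame_cst _ 1))).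
rewrite (clD_mul _ _ cltame_yv cltame_xv) clD_xv clD_yv; congr (_ + _).
by rewrite (clD_scale _ _ ts (cltame_cst _ 1)) clD_cst scaler0 addr0 cD_real.
Qed.

Lemma real_sum (f : 'I_m -> R) : \sum_j (f j)%:C%C = (\sum_j f j)%:C%C :> C.
Proof. by rewrite rmorph_sum. Qed.

Lemma cl_vec_sqr (x : 'rV[R]_m) :
  cl_vec (fun j => (x 0 j)%:C%C) * cl_vec (fun j => (x 0 j)%:C%C) = - (dotp x x)%:C%C *: 1 :> Cl.
Proof.
have := cl_vecM (fun j => (x 0 j)%:C%C) (fun j => (x 0 j)%:C%C : C).
under eq_bigr do rewrite -rmorphM.
rewrite real_sum -mulr2n -scaler_nat => H.
have two0 : (2%:R : C) != 0 by rewrite pnatr_eq0.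
by apply: (scalerI two0); rewrite H scalerA mulrN scaleNr.
Qed.

Lemma yx_omega v : yv v * xv v = omega v - (sv v)%:C%C *: 1.
Proof. by rewrite /omega addrK. Qed.

Lemma omega_sqr v : omega v * omega v = (sv v ^+ 2 - qv v)%:C%C *: 1.
Proof.
have XX := cl_vec_sqr v.1.1; have YY := cl_vec_sqr v.1.2.
have := cl_vecM (fun j => (v.1.1 0 j)%:C%C) (fun j => (v.1.2 0 j)%:C%C : C).
under eq_bigr do rewrite -rmorphM.
rewrite real_sum -/(xv v) -/(yv v) -/(dotp v.1.1 v.1.2) -/(sv v) => XY.
have {}XY : xv v * yv v = - (2 * (sv v)%:C%C) *: 1 - yv v * xv v.
  by apply/eqP; rewrite eq_sym subr_eq XY scaleNr.
rewrite -/(xv v) in XX; rewrite -/(yv v) in YY.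
have YXYX : yv v * xv v * (yv v * xv v) =
    - (2 * (sv v)%:C%C) *: (yv v * xv v) - (qv v)%:C%C *: 1.
  move: (xv v) (yv v) XX YY XY => X Y XX YY XY.
  rewrite mulrA -(mulrA Y) XY mulrBr -scalerAr mulr1 mulrBl -scalerAl mulrA YY.
  rewrite -2!scalerAl mul1r XX scalerA /qv mulNr mulrN opprK -rmorphM /=.
  by rewrite (mulrC (dotp v.1.2 v.1.2)).
rewrite {1 2}/omega mulrDl !mulrDr YXYX -!scalerAr -!scalerAl !mulr1 mul1r.
rewrite rmorphB rmorphXn /=.
move: (yv v * xv v) (1 : Cl) (sv v)%:C%C (qv v)%:C%C => Z I s q.
by apply/ffunP => A; rewrite !ffunE; ring.
Qed.

Section Propagated.
Variables (c : R) (k : nat).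
Hypothesis c0 : c != 0.
Hypothesis mE : m = (2 * k + 2)%N.

Let F := (wave_pair c k).1.
Let G := (wave_pair c k).2.

(** The plane wave e^{i c <x,y>} propagated by e^{i t Gamma_y}. *)
Definition wave (v : E) : Cl :=
  (wave_pair c k).1 (psi v) *: 1 + (wave_pair c k).2 (psi v) *: omega v.

Let tF : ctame (@cone R) F. Proof. exact: (wave_pair_tame c k).1. Qed.
Let tG : ctame (@cone R) G. Proof. exact: (wave_pair_tame c k).2. Qed.

Lemma cltame_wave : cltame setT wave.
Proof.
apply: cltame_add; apply: cltame_scale; try exact: ctame_psi.
  exact: cltame_cst.
exact: cltame_omega.
Qed.

Let clD_wave w v : clD w wave v = cD w (fun v => F (psi v)) v *: 1 +
  (cD w (fun v => G (psi v)) v *: omega v + G (psi v) *: clD w omega v).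
Proof.
have t1 := ctame_psi tF; have t2 := ctame_psi tG.
rewrite (clD_add _ _ (cltame_scale t1 (cltame_cst _ 1)) (cltame_scale t2 cltame_omega)).
rewrite (clD_scale _ _ t1 (cltame_cst _ 1)) (clD_scale _ _ t2 cltame_omega).
by rewrite clD_cst scaler0 addr0.
Qed.

Let vec_delta j : cl_vec (fun i => ((delta_mx 0 j : 'rV[R]_m) 0 i)%:C%C) = e j.
Proof.
rewrite /cl_vec (bigD1 j)//= big1 ?addr0 => [|i ij].
  by rewrite mxE !eqxx scale1r.
by rewrite mxE (negPf ij) andbF scale0r.
Qed.

Let vec0 : cl_vec (fun i => ((0 : 'rV[R]_m) 0 i)%:C%C) = 0 :> Cl.
Proof. by rewrite /cl_vec big1// => i _; rewrite mxE scale0r. Qed.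

Let xx (v : E) := dotp v.1.1 v.1.1.
Let yy (v : E) := dotp v.1.2 v.1.2.

Let D_wave_y j v : clD (ey j) wave v =
  ((v.1.1 0 j)%:C%C * cD (es R) F (psi v)) *: 1 +
  ((v.1.2 0 j)%:C%C * (2 * (xx v)%:C%C * cD (eq3 R) F (psi v))) *: 1 +
  (((v.1.1 0 j)%:C%C * cD (es R) G (psi v)) *: omega v +
  ((v.1.2 0 j)%:C%C * (2 * (xx v)%:C%C * cD (eq3 R) G (psi v))) *: omega v) +
  (G (psi v) *: (e j * xv v) + ((v.1.1 0 j)%:C%C * G (psi v)) *: 1).
Proof.
rewrite clD_wave (cD_psi _ _ tF) (cD_psi _ _ tG) clD_omega vec0 mulr0 addr0 vec_delta.
rewrite D_sv (tD_mul _ _ tame_xx tame_yy) D_xx D_yy /= !dotp0 mulr0 mul0r !add0r.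
rewrite (dotpC v.1.1) !dotp_delta !mul0r !addr0 !rmorphM /= (_ : 2%:C%C = 2 :> C); last first.
  by rewrite rmorph_nat.
rewrite -/(xx v) -/(yy v).
move: (cD _ F _) (cD _ F _) (cD _ G _) (cD _ G _) => f1 f2 g1 g2.
move: (omega v) (1 : Cl) (e j * xv v) (G (psi v)) => W I Z g.
move: (_%:C%C) (_%:C%C) (_%:C%C) => u1 u2 u3.
by apply/ffunP => A; rewrite !ffunE; ring.
Qed.

(** The wave ansatz F + omega G is stable under Gamma: by [rotation_dirac] only the
    products of omega with itself and with y x occur, and the derivatives in q cancel
    between the Dirac and the Euler part. *)
Lemma gamma_wave v : Gamma_at wave v =
  ((qv v - sv v * sv v)%:C%C * cD (es R) G (psi v) -
    (2 * k%:R + 1) * (sv v)%:C%C * G (psi v)) *: 1 +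
  (2 * k%:R * G (psi v) - cD (es R) F (psi v)) *: omega v.
Proof.
rewrite /Gamma_at rotation_dirac -/(yv v).
set Fs := cD (es R) F (psi v); set Gs := cD (es R) G (psi v).
set P := 2 * (xx v)%:C%C * cD (eq3 R) F (psi v).
set Q := 2 * (xx v)%:C%C * cD (eq3 R) G (psi v).
set g := G (psi v).
pose d j : Cl := ((v.1.1 0 j)%:C%C * Fs) *: 1 + ((v.1.2 0 j)%:C%C * P) *: 1 +
  (((v.1.1 0 j)%:C%C * Gs) *: omega v + ((v.1.2 0 j)%:C%C * Q) *: omega v) +
  (g *: (e j * xv v) + ((v.1.1 0 j)%:C%C * g) *: 1).
rewrite (eq_bigr (fun j => e j * d j)); last by move=> j _; rewrite D_wave_y.
rewrite (dirac_radial _ _ Fs P Gs Q g (omega v)).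
rewrite [X in _ + X](eq_bigr (fun j => (v.1.2 0 j)%:C%C *: d j)); last first.
  by move=> j _; rewrite D_wave_y.
rewrite (euler_radial _ _ Fs P Gs Q g (omega v)).
rewrite -/(xv v) -/(yv v).
have dotE (f h : 'I_m -> R) : \sum_j (f j)%:C%C * (h j)%:C%C = (\sum_j f j * h j)%:C%C :> C.
  by rewrite rmorph_sum; apply: eq_bigr => j _; rewrite rmorphM.
rewrite !dotE -/(dotp _ _) -/(sv v) -/(dotp v.1.2 v.1.2).
have YX := yx_omega v; have OO := omega_sqr v; have YY := cl_vec_sqr v.1.2.
rewrite -/(yv v) in YY.
have mC : m%:R = 2 * k%:R + 2 :> C by rewrite mE natrD natrM.
rewrite mC !rmorphB rmorphXn rmorphM /= in OO *.
clear d; clearbody P Q Fs Gs g; move: (xv v) (yv v) (omega v) YX OO YY => X Y W YX OO YY.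
rewrite !mulrDr -![in LHS]scalerAr !mulrA YX YY mulrBl OO -![in LHS]scalerAl !mul1r.
move: (1 : Cl) => I; move: (sv v)%:C%C (qv v)%:C%C (dotp _ _)%:C%C (k%:R : C) => s q y2 k'.
apply/ffunP => A; rewrite !ffunE; ring.
Qed.

(** Comparison of [gamma_wave] with [wave_pair_pde]; omega does not depend on t. *)
Lemma wave_pde v : clD ez wave v = 'i%C *: Gamma_at wave v.
Proof.
rewrite gamma_wave clD_wave (cD_psi _ _ tF) (cD_psi _ _ tG) clD_omega /ez /= vec0 mul0r mulr0.
rewrite D_sv (tD_mul _ _ tame_xx tame_yy) D_xx D_yy /= (dotpC v.1.1) !dotp0 !(mulr0, mul0r) !addr0.
have -> : 0%:C%C = 0 :> C by [].
have -> : 1%:C%C = 1 :> C by [].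
have [/= eF eG] := wave_pair_pde c k (psi v); rewrite -/F -/G in eF eG.
rewrite {}eF {}eG.
move: (cD _ F _) (cD _ F _) (cD _ G _) (cD _ G _) (G _) => f f' g g' h.
move: (omega v) (1 : Cl) => W I.
by apply/ffunP => A; rewrite !ffunE; ring.
Qed.

Lemma wave_init x y : wave (x, y, 0) = expi (c * dotp x y) *: 1.
Proof.
have [/= i1 i2] := wave_pair_init c0 k (dotp x y) (dotp x x * dotp y y).
by rewrite /wave /psi /= i1 i2 scale0r addr0.
Qed.

End Propagated.

End Wave.

(** * Summation of the exponential series *)

Section Evolution.
Variables (R : realType) (m : nat).
Local Notation C := R[i].
Local Notation Cl := (clifford R[i] m).
Local Notation E := ('rV[R]_m * 'rV[R]_m * R)%type.
Local Notation e := (@cl_gen C m).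
Implicit Types (G H : E -> Cl) (v w : E).

Let rot (j k : 'I_m) G : E -> Cl := fun v =>
  (v.1.2 0 j)%:C%C *: clD (ey R k) G v + (-1 : C) *: ((v.1.2 0 k)%:C%C *: clD (ey R j) G v).

Let Gamma_atE G v : Gamma_at G v =
  \sum_(j < m) \sum_(k < m | (j < k)%N) (- (e j * e k)) * rot j k G v.
Proof.
rewrite /Gamma_at -sumrN; apply: eq_bigr => j _; rewrite -sumrN; apply: eq_bigr => k _.
by rewrite /rot scaleN1r mulNr.
Qed.

Let t_ycl G j k : cltame setT G ->
  cltame setT (fun v => (v.1.2 0 j)%:C%C *: clD (ey R k) G v).
Proof.
move=> tG; apply: cltame_scale; first exact: (ctame_real (tame_y R _)).
exact: cltame_D.
Qed.

Let rot_tame j k G : cltame setT G -> cltame setT (rot j k G).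
Proof.
move=> tG; apply: cltame_add; first exact: t_ycl.
by apply: cltame_scale; [exact: ctame_cst|exact: t_ycl].
Qed.

Let row_tame j G : cltame setT G -> forall k, cltame setT
  (fun v => - (e j * e k) * rot j k G v).
Proof. by move=> tG k; apply: cltame_mul; [exact: cltame_cst|exact: rot_tame]. Qed.

Lemma Gamma_at_tame G : cltame setT G -> cltame setT (Gamma_at G).
Proof.
move=> tG; apply: (cltame_ext (fun v => Gamma_atE G v)).
by apply: cltame_sum => j; apply: cltame_sum => k; exact: row_tame.
Qed.

Let clD_y w j k G v : w.1.2 = 0 -> cltame setT G ->
  clD w (fun v => (v.1.2 0 j)%:C%C *: clD (ey R k) G v) v =
  (v.1.2 0 j)%:C%C *: clD (ey R k) (clD w G) v.
Proof.
move=> w0 tG.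
have E : cD w (fun v : E => (v.1.2 0 j)%:C%C) v = 0.
  by rewrite cD_real derive_y w0 mxE.
rewrite (clD_scale _ _ (ctame_real (tame_y R j)) (cltame_D (ey R k) tG)) E.
by rewrite scale0r add0r (clD_symmetric _ _ tG).
Qed.

(** Directions that do not move y commute with the coefficients of Gamma. *)
Lemma clD_Gamma_at w G : w.1.2 = 0 -> cltame setT G ->
  clD w (Gamma_at G) = Gamma_at (clD w G).
Proof.
move=> w0 tG; apply/funext => v; rewrite (clD_ext _ _ (Gamma_atE G)) Gamma_atE.
rewrite (clD_sum (D := setT)) => [|j]; last by apply: cltame_sum => k; exact: row_tame.
apply: eq_bigr => j _; rewrite (clD_sum (D := setT)) => [|k]; last exact: row_tame.
apply: eq_bigr => k _; rewrite (clD_mulcl _ _ _ (rot_tame j k tG)); congr (_ * _).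
have t1 := t_ycl j k tG; have t2 := t_ycl k j tG.
rewrite (clD_add _ _ t1 (cltame_scale (ctame_cst setT (-1)) t2)).
rewrite (clD_scale_cst _ _ _ t2).
exact: (f_equal2 (fun a b => a + (-1 : C) *: b) (clD_y j k v w0 tG) (clD_y k j v w0 tG)).
Qed.

Lemma Gamma_at_scale (a : C) G v : cltame setT G ->
  Gamma_at (fun v => a *: G v) v = a *: Gamma_at G v.
Proof.
move=> tG; rewrite !Gamma_atE scaler_sumr; apply: eq_bigr => j _.
rewrite scaler_sumr; apply: eq_bigr => k _; rewrite scalerAr; congr (_ * _).
rewrite /rot (clD_scale_cst (ey R k) a v tG) (clD_scale_cst (ey R j) a v tG).
move: (clD _ G v) (clD _ G v) (v.1.2 0 j)%:C%C (v.1.2 0 k)%:C%C => g1 g2 b1 b2.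
by apply/ffunP => A; rewrite !ffunE; ring.
Qed.

Lemma Gamma_at_add G H v : cltame setT G -> cltame setT H ->
  Gamma_at (fun v => G v + H v) v = Gamma_at G v + Gamma_at H v.
Proof.
move=> tG tH; rewrite !Gamma_atE -big_split/=; apply: eq_bigr => j _.
rewrite -big_split/=; apply: eq_bigr => k _; rewrite -mulrDr; congr (_ * _).
rewrite /rot (clD_add (ey R k) v tG tH) (clD_add (ey R j) v tG tH).
move: (clD _ G v) (clD _ G v) (clD _ H v) (clD _ H v) => g1 g2 h1 h2.
move: (v.1.2 0 j)%:C%C (v.1.2 0 k)%:C%C => b1 b2.
by apply/ffunP => A; rewrite !ffunE; ring.
Qed.

Lemma Gamma_at_sum I (r : seq I) (F : I -> E -> Cl) v : (forall i, cltame setT (F i)) ->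
  Gamma_at (fun v => \sum_(i <- r) F i v) v = \sum_(i <- r) Gamma_at (F i) v.
Proof.
move=> tF; elim: r v => [|i r IH] v.
  have -> : (fun v : E => \sum_(i <- [::]) F i v) = fun v => 0 *: (0 : Cl).
    by apply/funext => u; rewrite big_nil scaler0.
  by rewrite (Gamma_at_scale _ _ (cltame_cst _ _)) big_nil scale0r.
have -> : (fun v => \sum_(j <- i :: r) F j v) = fun v => F i v + \sum_(j <- r) F j v.
  by apply/funext => u; rewrite big_cons.
by rewrite (Gamma_at_add _ (tF i) (cltame_sum r xpredT tF)) IH big_cons.
Qed.

(** Rotations preserve |y|^2. *)
Lemma Gamma_at_yy G v : cltame setT G ->
  Gamma_at (fun v => (dotp v.1.2 v.1.2)%:C%C *: G v) v =
  (dotp v.1.2 v.1.2)%:C%C *: Gamma_at G v.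
Proof.
move=> tG; rewrite !Gamma_atE scaler_sumr; apply: eq_bigr => j _.
rewrite scaler_sumr; apply: eq_bigr => k _; rewrite scalerAr; congr (_ * _).
have tq := ctame_real (tame_yy R m).
have Dq i : cD (ey R i) (fun v : E => (dotp v.1.2 v.1.2)%:C%C) v = 2 * (v.1.2 0 i)%:C%C.
  by rewrite cD_real D_yy /= dotp_delta rmorphM rmorph_nat.
rewrite /rot (clD_scale (ey R k) v tq tG) (clD_scale (ey R j) v tq tG) !Dq.
move: (clD _ G v) (clD _ G v) (G v) => g1 g2 g.
move: (dotp _ _)%:C%C (v.1.2 0 j)%:C%C (v.1.2 0 k)%:C%C => q a b.
by apply/ffunP => A; rewrite !ffunE; ring.
Qed.

Lemma Gamma_at_slice G (x : 'rV[R]_m) (t : R) :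
  Gamma (fun y => G (x, y, t)) = fun y => Gamma_at G (x, y, t).
Proof.
apply/funext => y; rewrite /Gamma /Gamma_at; apply: (f_equal (fun z : Cl => - z)).
have iE k (h : R) (z : 'rV[R]_m) :
    (x, h *: delta_mx 0 k + z, t) = h *: ey R k + (x, z, t) :> E.
  by congr (_, _, _) => /=; rewrite ?scaler0 ?add0r.
have sl k : cl_partial k (fun y => G (x, y, t)) y = clD (ey R k) G (x, y, t).
  exact: (clD_slice (i := fun y => (x, y, t)) G y (iE k)).
apply: eq_bigr => j _; apply: eq_bigr => k _.
by rewrite !sl.
Qed.

Lemma iter_Gamma_at_slice n G (x : 'rV[R]_m) (t : R) :
  iter n (@Gamma R m) (fun y => G (x, y, t)) = fun y => iter n (@Gamma_at R m) G (x, y, t).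
Proof.
elim: n => [//|n IH]; rewrite iterS IH.
exact: (Gamma_at_slice (iter n (@Gamma_at R m) G) x t).
Qed.

Lemma iter_Gamma_at_tame n G : cltame setT G -> cltame setT (iter n (@Gamma_at R m) G).
Proof. by move=> tG; elim: n => //= n IH; exact: Gamma_at_tame. Qed.

(** A derivative that acts as a multiple of Gamma and commutes with it acts as the
    same power of Gamma when iterated. *)
Lemma evolution_iter (a : C) w G n : w.1.2 = 0 -> cltame setT G ->
  (forall v, clD w G v = a *: Gamma_at G v) ->
  iter n (clD w) G = fun v => a ^+ n *: iter n (@Gamma_at R m) G v.
Proof.
move=> w0 tG GE; elim: n => [|n /= ->].
  by apply/funext => v; rewrite expr0 scale1r.
apply/funext => v; have tn := iter_Gamma_at_tame n tG.
rewrite (clD_scale_cst _ _ _ tn) exprSr -scalerA; congr (_ *: _).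
rewrite -(Gamma_at_scale _ _ tn).
elim: n tn v => [|n IH] _ v /=.
  by rewrite GE (Gamma_at_scale _ _ tG).
have tn := iter_Gamma_at_tame n tG.
rewrite (clD_Gamma_at w0 tn).
have -> : clD w (iter n (@Gamma_at R m) G) = Gamma_at (fun v => a *: iter n (@Gamma_at R m) G v).
  by apply/funext => u; exact: IH.
congr (Gamma_at _ v); apply/funext => u.
by rewrite (Gamma_at_scale _ _ tn).
Qed.

Lemma iter_clD_re w n G A : (fun u => complex.Re (iter n (clD w) G u A)) =
  iter_derive w n (fun u => complex.Re (G u A)).
Proof.
elim: n => //= n <-; apply/funext => u.
by rewrite clDE.
Qed.

Lemma iter_clD_im w n G A : (fun u => complex.Im (iter n (clD w) G u A)) =
  iter_derive w n (fun u => complex.Im (G u A)).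
Proof.
elim: n => //= n <-; apply/funext => u.
by rewrite clDE.
Qed.

Lemma clD_time (t : R) G v : cltame setT G -> clD (0, 0, t) G v = t%:C%C *: clD (ez R m) G v.
Proof.
move=> tG; apply/ffunP => A; rewrite clDE ffunE clDE; have [t1 t2] := tG A.
have H f : tame setT f -> 'D_((0, 0, t) : E) f v = t * 'D_(ez R m) f v.
  move=> tf; rewrite !deriveE; do ?exact: tame_differentiable tf.
  have -> : (0, 0, t) = t *: ez R m :> E.
    by congr (_, _, _) => /=; rewrite ?scaler0// /GRing.scale/= mulr1.
  exact: linearZ.
rewrite /cD /reim (H _ t1) (H _ t2).
by congr Complex => /=; ring.
Qed.

Let ReZreal (n : nat) (z : C) : complex.Re (z / n`!%:R) = complex.Re z / n`!%:R.
Proof.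
have -> : (n`!%:R)^-1 = (n`!%:R^-1 : R)%:C%C :> C by rewrite fmorphV rmorph_nat.
by rewrite ReM /= mulr0 subr0.
Qed.

Let ImZreal (n : nat) (z : C) : complex.Im (z / n`!%:R) = complex.Im z / n`!%:R.
Proof.
have -> : (n`!%:R)^-1 = (n`!%:R^-1 : R)%:C%C :> C by rewrite fmorphV rmorph_nat.
by rewrite ImM /= mulr0 add0r.
Qed.

(** Along the line from (x, y, 0) to (x, y, t) the Taylor series of a solution of
    dG/dt = i Gamma G is the exponential series of Gamma applied to G (., ., 0). *)
Lemma exp_Gamma_cvg G (x y : 'rV[R]_m) (t : R) : cltame setT G ->
  (forall v, clD (ez R m) G v = 'i%C *: Gamma_at G v) ->
  forall A,
   (fun n => complex.Re (exp_Gamma_series t (fun y => G (x, y, 0)) y n A)) @ \oo -->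
     complex.Re (G (x, y, t) A) /\
   (fun n => complex.Im (exp_Gamma_series t (fun y => G (x, y, 0)) y n A)) @ \oo -->
     complex.Im (G (x, y, t) A).
Proof.
move=> tG GE A; pose w : E := (0, 0, t).
have GE' v : clD w G v = Complex 0 t *: Gamma_at G v.
  rewrite (clD_time _ _ tG) GE scalerA; congr (_ *: _).
  by congr Complex => /=; ring.
have itE n : iter n (clD w) G (x, y, 0) = Complex 0 t ^+ n *: iter n (@Gamma R m) (fun y => G (x, y, 0)) y.
  by rewrite (evolution_iter n _ tG GE')// iter_Gamma_at_slice.
have termE n : ((Complex 0 t ^+ n / n`!%:R) *: iter n (@Gamma R m) (fun y => G (x, y, 0)) y) A =
    iter n (clD w) G (x, y, 0) A / n`!%:R.
  by rewrite itE !ffunE mulrAC.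
have endE : (x, y, t) = (x, y, 0) + w :> E.
  by congr (_, _, _) => /=; rewrite ?addr0 ?add0r.
have [t1 t2] := tG A.
have c1 := tame_taylor (v := (x, y, 0)) (w := w) t1 (fun _ _ => I).
have c2 := tame_taylor (v := (x, y, 0)) (w := w) t2 (fun _ _ => I).
rewrite -endE in c1 c2.
split.
  rewrite (_ : (fun n => _) = series (fun n =>
    iter_derive w n (fun u => complex.Re (G u A)) (x, y, 0) / n`!%:R)); first exact: c1.
  apply/funext => n; rewrite /exp_Gamma_series /series/= sum_ffunE raddf_sum.
  apply: eq_bigr => i _; rewrite termE; apply: (etrans (ReZreal _ _)); congr (_ / _).
  exact: (congr1 (@^~ (x, y, 0)) (iter_clD_re w i G A)).
rewrite (_ : (fun n => _) = series (fun n =>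
  iter_derive w n (fun u => complex.Im (G u A)) (x, y, 0) / n`!%:R)); first exact: c2.
apply/funext => n; rewrite /exp_Gamma_series /series/= sum_ffunE raddf_sum.
apply: eq_bigr => i _; rewrite termE; apply: (etrans (ImZreal _ _)); congr (_ / _).
exact: (congr1 (@^~ (x, y, 0)) (iter_clD_im w i G A)).
Qed.

End Evolution.

(** * The Helmholtz equation of the propagated wave *)

Lemma tame_coord (R : realType) m (D : set 'rV[R]_m) j :
  tame D (fun x : 'rV[R]_m => x 0 j).
Proof.
apply: tame_lin => [a u v|v]; first by rewrite !mxE.
exact: coord_continuous.
Qed.

Section Helmholtz.
Variables (R : realType) (m : nat).
Local Notation C := R[i].
Local Notation Cl := (clifford R[i] m).
Local Notation E := ('rV[R]_m * 'rV[R]_m * R)%type.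
Implicit Types (G H : E -> Cl) (v w : E).

(** Membership in the space of solutions of the evolution equation. *)
Let evolves G := forall v, clD (ez R m) G v = 'i%C *: Gamma_at G v.

Let evolves_D w G : w.1.2 = 0 -> cltame setT G -> evolves G -> evolves (clD w G).
Proof.
move=> w0 tG GE v; rewrite (clD_symmetric _ _ tG).
have -> : clD (ez R m) G = fun v => 'i%C *: Gamma_at G v by apply/funext => u; exact: GE.
rewrite (clD_scale_cst _ _ _ (Gamma_at_tame tG)).
by rewrite (clD_Gamma_at w0 tG).
Qed.

Let evolves_add G H : cltame setT G -> cltame setT H -> evolves G -> evolves H ->
  evolves (fun v => G v + H v).
Proof.
move=> tG tH GE HE v; rewrite (clD_add _ _ tG tH) GE HE -scalerDr.
by rewrite (Gamma_at_add _ tG tH).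
Qed.

Let evolves_scale (a : C) G : cltame setT G -> evolves G -> evolves (fun v => a *: G v).
Proof.
move=> tG GE v; rewrite (clD_scale_cst _ _ _ tG) GE (Gamma_at_scale _ _ tG).
by rewrite !scalerA mulrC.
Qed.

Let evolves_yy G : cltame setT G -> evolves G ->
  evolves (fun v => (dotp v.1.2 v.1.2)%:C%C *: G v).
Proof.
move=> tG GE v; rewrite (clD_scale _ _ (ctame_real (tame_yy R m)) tG) (Gamma_at_yy _ tG).
have -> : cD (ez R m) (fun v : E => (dotp v.1.2 v.1.2)%:C%C) v = 0.
  by rewrite cD_real D_yy /= dotp0 mulr0.
by rewrite scale0r add0r GE !scalerA mulrC.
Qed.

Variables (c : R) (k : nat).
Hypothesis c0 : c != 0.
Hypothesis mE : m = (2 * k + 2)%N.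
Let W : E -> Cl := wave c k.
Let tW : cltame setT W := @cltame_wave R m c k.
Let WE : evolves W. Proof. exact: (wave_pde c mE). Qed.

Let t2 j : cltame setT (clD (ex R j) (clD (ex R j) W)).
Proof. by apply: cltame_D; exact: cltame_D. Qed.

Let evolves_sum (F : 'I_m -> E -> Cl) : (forall j, cltame setT (F j)) ->
  (forall j, evolves (F j)) -> evolves (fun v => \sum_j F j v).
Proof.
move=> tF FE v; rewrite (clD_sum (D := setT))// (Gamma_at_sum _ _ tF) scaler_sumr.
by apply: eq_bigr => j _; exact: FE.
Qed.

(** The defect of the Helmholtz equation. *)
Let Z : E -> Cl := fun v => \sum_j clD (ex R j) (clD (ex R j) W) v +
  (c ^+ 2)%:C%C *: ((dotp v.1.2 v.1.2)%:C%C *: W v).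

Let t3 : cltame setT (fun v : E => (dotp v.1.2 v.1.2)%:C%C *: W v).
Proof. exact: (cltame_scale (ctame_real (tame_yy R m)) tW). Qed.

Let t4 : cltame setT (fun v : E => (c ^+ 2)%:C%C *: ((dotp v.1.2 v.1.2)%:C%C *: W v)).
Proof. exact: (cltame_scale (ctame_cst setT _) t3). Qed.

Let tZ : cltame setT Z.
Proof. exact: (cltame_add (cltame_sum _ xpredT t2) t4). Qed.

Let ZE : evolves Z.
Proof.
have e2 j : evolves (clD (ex R j) (clD (ex R j) W)).
  exact: (evolves_D (w := ex R j) erefl (cltame_D (ex R j) tW)
    (evolves_D (w := ex R j) erefl tW WE)).
have e4 := evolves_scale (c ^+ 2)%:C%C t3 (evolves_yy tW WE).
exact: (evolves_add (cltame_sum _ xpredT t2) t4 (evolves_sum t2 e2) e4).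
Qed.

Let Z0 (x y : 'rV[R]_m) : Z (x, y, 0) = 0.
Proof.
pose i (x : 'rV[R]_m) : E := (x, y, 0).
have iE j (h : R) (z : 'rV[R]_m) : i (h *: delta_mx 0 j + z) = h *: ex R j + i z.
  by congr (_, _, _) => /=; rewrite ?scaler0 ?add0r.
have W0 : W \o i = fun x => expi (c * dotp x y) *: 1.
  by apply/funext => z; exact: (@wave_init R m c k c0 z y).
have tp : tame setT (fun x : 'rV[R]_m => c * dotp x y).
  apply: tame_scale; apply: tame_sum => j.
  by apply: tame_mul; [exact: tame_coord|exact: tame_cst].
have te := ctame_expi tp.
have Dp j z : 'D_(delta_mx 0 j) (fun x : 'rV[R]_m => c * dotp x y) z = c * y 0 j.
  apply: etrans (derive_linear_fun _ _ _ _) _ => [a u v|v|].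
  - by rewrite dotpDl mulrDr; congr (_ + _); rewrite /dotp !mulr_sumr; apply: eq_bigr => l _; rewrite !mxE; ring.
  - exact: (tame_continuous tp).
  - by rewrite dotp_delta.
have D1 j : clD (ex R j) W \o i =
    fun x => Complex 0 (c * y 0 j) *: (expi (c * dotp x y) *: 1).
  apply/funext => z; rewrite /comp -(clD_slice W z (iE j)) W0.
  rewrite (clD_scale _ _ te (cltame_cst _ _)) clD_cst scaler0 addr0.
  by rewrite (cD_expi _ _ tp) Dp scalerA.
have D2 j : clD (ex R j) (clD (ex R j) W) (i x) =
    (- (c ^+ 2 * (y 0 j * y 0 j)))%:C%C *: (expi (c * dotp x y) *: 1).
  rewrite -(clD_slice (clD (ex R j) W) x (iE j)) D1.
  rewrite (clD_scale_cst _ _ _ (cltame_scale te (cltame_cst _ _))).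
  rewrite (clD_scale _ _ te (cltame_cst _ _)) clD_cst scaler0 addr0.
  rewrite (cD_expi _ _ tp) Dp -scalerA scalerA; congr (_ *: _).
  by congr Complex => /=; ring.
rewrite /Z -/(i x); under eq_bigr do rewrite D2.
rewrite -scaler_suml (_ : W (i x) = expi (c * dotp x y) *: 1); last first.
  exact: (congr1 (@^~ x) W0).
move: (expi _ *: 1) => u; rewrite scalerA -scalerDl -rmorph_sum /= -rmorphM/= -rmorphD/=.
by rewrite sumrN -mulr_sumr addNr scale0r.
Qed.

(** The defect evolves by i Gamma, since both the Laplacian in x and multiplication by
    |y|^2 commute with Gamma, and it vanishes at t = 0. The Taylor series in t, that is
    [exp_Gamma_cvg], propagates its vanishing to all times. *)
Lemma wave_helmholtz v : \sum_j clD (ex R j) (clD (ex R j) W) v =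
  - ((c ^+ 2)%:C%C *: ((dotp v.1.2 v.1.2)%:C%C *: W v)).
Proof.
apply/eqP; rewrite -addr_eq0 -/(Z v); apply/eqP; case: v => [[x y] t].
have it0 n : iter n (@Gamma R m) (fun y => Z (x, y, 0)) = fun=> 0.
  elim: n => [|n IH]; first by apply/funext => z; exact: Z0.
  rewrite iterS IH; apply/funext => z; rewrite /Gamma.
  rewrite big1 ?oppr0// => j _; rewrite big1// => l _.
  have cp0 i : cl_partial i (fun=> 0 : Cl) z = 0 by exact: clD_cst.
  by rewrite !cp0 !scaler0 subrr mulr0.
have s0 n : exp_Gamma_series t (fun y => Z (x, y, 0)) y n = 0.
  by rewrite /exp_Gamma_series /series /= big1// => i _; rewrite it0 scaler0.
apply/ffunP => A; have [z1 z2] := exp_Gamma_cvg x y t tZ ZE A.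
rewrite [RHS]ffunE; apply/eqP; rewrite eq_complex; apply/andP; split; apply/eqP.
  rewrite -(cvg_lim _ z1)//; apply/cvg_lim => //.
  rewrite (_ : (fun n => _) = fun=> 0); first exact: cvg_cst.
  by apply/funext => n; rewrite s0 ffunE.
rewrite -(cvg_lim _ z2)//; apply/cvg_lim => //.
rewrite (_ : (fun n => _) = fun=> 0); first exact: cvg_cst.
by apply/funext => n; rewrite s0 ffunE.
Qed.

Let opp_scale2 (a b : C) (u : Cl) A : (- (a *: (b *: u))) A = - (a * b) * u A.
Proof. by rewrite !ffunE; ring. Qed.

Lemma wave_helmholtz_re A v :
  \sum_j 'D_(ex R j) ('D_(ex R j) (fun u => complex.Re (W u A))) v =
  - (c ^+ 2 * dotp v.1.2 v.1.2 * complex.Re (W v A)).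
Proof.
have := congr1 (fun z : Cl => complex.Re (z A)) (wave_helmholtz v).
rewrite sum_ffunE raddf_sum /= => H.
transitivity (\sum_j complex.Re (clD (ex R j) (clD (ex R j) W) v A)).
  by apply: eq_bigr => j _; rewrite (congr1 (@^~ v) (iter_clD_re (ex R j) 2 W A)).
rewrite H opp_scale2; case: (W v A) => a b /=; ring.
Qed.

Lemma wave_helmholtz_im A v :
  \sum_j 'D_(ex R j) ('D_(ex R j) (fun u => complex.Im (W u A))) v =
  - (c ^+ 2 * dotp v.1.2 v.1.2 * complex.Im (W v A)).
Proof.
have := congr1 (fun z : Cl => complex.Im (z A)) (wave_helmholtz v).
rewrite sum_ffunE raddf_sum /= => H.
transitivity (\sum_j complex.Im (clD (ex R j) (clD (ex R j) W) v A)).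
  by apply: eq_bigr => j _; rewrite (congr1 (@^~ v) (iter_clD_im (ex R j) 2 W A)).
rewrite H opp_scale2; case: (W v A) => a b /=; ring.
Qed.

End Helmholtz.

(** * Integration over the space of tuples *)

Section LineIntegral.
Variable R : realType.
Local Notation leb := (@lebesgue_measure R).

Lemma integrable_oneDsqr : leb.-integrable setT (fun x => (oneDsqr x)^-1%:E).
Proof.
have m1 : measurable_fun setT (fun x : R => (oneDsqr x)^-1).
  by apply: continuous_measurable_fun; exact: continuous_oneDsqrV.
apply/integrableP; split; first exact/measurable_EFinP.
rewrite (_ : (\int[leb]_x _)%E = (\int[leb]_x ((oneDsqr x)^-1)%:E)%E); last first.
  apply: eq_integral => x _.
  by rewrite gee0_abs// lee_fin invr_ge0 (le_trans ler01)// oneDsqr_ge1.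
rewrite (@ge0_symfun_integralT R (fun x => (oneDsqr x)^-1)).
- by rewrite -set_itvcy integral0y_oneDsqr -EFinM ltry.
- by move=> x; rewrite invr_ge0 (le_trans ler01)// oneDsqr_ge1.
- exact: continuous_oneDsqrV.
- by move=> x /=; rewrite /oneDsqr sqrrN.
Qed.

(** The integral over a symmetric interval is a difference of boundary values, which tends to 0;
    dominated convergence then identifies the integral over the line. *)
Lemma integral_derivative0 (phi dphi : R -> R) (K : R) :
  (forall x, is_derive x (1 : R) phi (dphi x)) -> continuous dphi ->
  (forall x, `|phi x| <= K / oneDsqr x) -> (forall x, `|dphi x| <= K / oneDsqr x) ->
  (\int[leb]_x (dphi x)%:E = 0)%E.
Proof.
move=> dp cd bp bd.
have mdphi : measurable_fun setT dphi by exact: continuous_measurable_fun.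
pose I (n : nat) : set R := `[- n.+1%:R, n.+1%:R].
pose f_ (n : nat) := ((EFin \o dphi) \_ (I n)).
have If : (\int[leb]_x f_ n x)%E @[n --> \oo] --> (\int[leb]_x (dphi x)%:E)%E.
  apply: (@dominated_cvg _ _ _ leb setT measurableT f_ (fun x => (dphi x)%:E)
    (fun x => (K / oneDsqr x)%:E)) => //.
  - move=> n; rewrite /f_; have mI : measurable (I n : set (measurableTypeR R)) by exact: measurable_itv.
    apply: (iffLR (measurable_restrictT (EFin \o dphi) mI)).
    by apply: measurable_funTS; exact/measurable_EFinP.
  - move=> x _; have [N xN] := nat_bound `|x|.
    apply: cvg_near_cst; near=> n; rewrite /f_ patchE mem_set//.
    rewrite /I /= in_itv/= -ler_norml (le_trans xN)// ler_nat leqW//.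
    by near: n; exact: nbhs_infty_ge.
  - have := integrableZl measurableT K integrable_oneDsqr.
    exact: eq_integrable.
  - move=> n x _; rewrite /f_ patchE; case: ifPn => _ /=.
      by rewrite lee_fin.
    by rewrite normr0 lee_fin (le_trans (normr_ge0 (phi x))).
have In n : (\int[leb]_x f_ n x = (phi n.+1%:R - phi (- n.+1%:R))%:E)%E.
  rewrite /f_ -integral_mkcond EFinB.
  have dphiE x : derivable phi x 1 by exact: (@ex_derive _ _ _ _ _ _ _ (dp x)).
  have cphi : continuous phi.
    by move=> x; apply/differentiable_continuous/derivable1_diffP.
  apply: continuous_FTC2.
  - by rewrite -subr_gt0 opprK addr_gt0.
  - exact: continuous_subspaceT.
  - split; first by move=> x _; exact: dphiE.
      by apply: cvg_at_right_filter; exact: cphi.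
    by apply: cvg_at_left_filter; exact: cphi.
  - by move=> x _; rewrite derive1E (@derive_val _ _ _ _ _ _ _ (dp x)).
have K0 : 0 <= K.
  have := le_trans (normr_ge0 _) (bp 0).
  by rewrite pmulr_lge0// invr_gt0 (lt_le_trans ltr01)// oneDsqr_ge1.
have lim0 : (phi n.+1%:R - phi (- n.+1%:R)) @[n --> \oo] --> (0 : R).
  apply/cvgr0Pnorm_le => e e0; have [N NP] := nat_bound (2 * K / e).
  near=> n; apply: le_trans (ler_normB _ _) _.
  have oE : oneDsqr (- n.+1%:R) = oneDsqr n.+1%:R :> R by rewrite /oneDsqr sqrrN.
  apply: (@le_trans _ _ (2 * K / n.+1%:R)).
    have -> : 2 * K / n.+1%:R = K / n.+1%:R + K / n.+1%:R :> R by rewrite mulr_natl mulr2n mulrDl.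
    have L : K / oneDsqr n.+1%:R <= K / n.+1%:R.
      rewrite ler_wpM2l// lef_pV2 ?posrE ?ltr0n ?(lt_le_trans ltr01 (oneDsqr_ge1 _))//.
      by rewrite /oneDsqr expr2 ler_wpDl// ler_peMr// ler1n.
    apply: lerD; first exact: le_trans (bp _) L.
    by apply: le_trans (bp _) _; rewrite oE.
  rewrite ler_pdivrMr// [X in _ <= X]mulrC -ler_pdivrMr//; apply: le_trans NP _.
  by rewrite ler_nat leqW//; near: n; exact: nbhs_infty_ge.
have := cvg_lim (@ereal_hausdorff R) If.
have /(cvg_lim (@ereal_hausdorff R)) : (\int[leb]_x f_ n x)%E @[n --> \oo] --> (0%:E : \bar R).
  by rewrite (funext In); apply: cvg_EFin => //; near=> n.
by move=> -> <-.
Unshelve. all: by end_near. Qed.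

End LineIntegral.

Section TupleIntegral.
Variable R : realType.
Local Notation RR := (measurableTypeR R).
Local Notation leb := (@lebesgue_measure R).

Lemma row_norm_le n (x : 'rV[R]_n) (a : R) : 0 <= a -> (forall i, `|x 0 i| <= a) ->
  `|x| <= a.
Proof.
move=> a0 xa; rewrite [leLHS]mx_normrE; apply: bigmax_le => // -[i j] _ /=.
by rewrite ord1.
Qed.

Lemma coord_le_norm n (x : 'rV[R]_n) i : `|x 0 i| <= `|x|.
Proof.
by rewrite [leRHS]mx_normrE; exact: (le_bigmax _ (fun ij => `|x ij.1 ij.2|) (0, i)).
Qed.

(** An open set of row vectors is a countable union of rational boxes, whose preimages
    lie in the product sigma-algebra. *)
Lemma measurable_row_open n (O : set 'rV[R]_n) : open O ->
  measurable ((@row_of_tuple R n) @^-1` O).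
Proof.
move=> oO.
pose box (p : {ffun 'I_n -> rat} * nat) : set 'rV[R]_n :=
  [set x | forall i, `|x 0 i - ratr (p.1 i)| < p.2.+1%:R^-1].
pose F p : set (n.-tuple RR) :=
  if `[< box p `<=` O >] then (@row_of_tuple R n) @^-1` box p else set0.
rewrite (_ : _ @^-1` O = \bigcup_p F p); last first.
  apply/seteqP; split=> [t /= Ot|t [p _]]; last first.
    by rewrite /F; case: asboolP => // pO /= /pO.
  have /nbhs_ballP[e /= e0 eO] : nbhs (row_of_tuple t) O by apply: open_nbhs_nbhs.
  have [k ke] := nat_bound (2 / e).
  have k0 : 0 < k.+1%:R^-1 :> R by rewrite invr_gt0.
  have ke' : 2 * k.+1%:R^-1 < e.
    rewrite ltr_pdivrMr// [X in _ < X]mulrC -ltr_pdivrMr//; apply: le_lt_trans ke _.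
    by rewrite ltr_nat.
  have q_ i : {q : rat | `|row_of_tuple t 0 i - ratr q| < k.+1%:R^-1}.
    apply/cid.
    have lt : row_of_tuple t 0 i - k.+1%:R^-1 < row_of_tuple t 0 i + k.+1%:R^-1.
      by rewrite ltrBlDr -addrA ltrDl addr_gt0.
    (* a box centered at rational coordinates close to those of t *)
    have [q] := rat_in_itvoo lt.
    by rewrite in_itv/= => /andP[q1 q2]; exists q; rewrite ltr_distlC q1 q2.
  exists ([ffun i => sval (q_ i)], k) => //; rewrite /F.
  have bt : box ([ffun i => sval (q_ i)], k) (row_of_tuple t).
    by move=> i /=; rewrite ffunE; exact: (svalP (q_ i)).
  case: asboolP => // -[] x xb; apply: eO; rewrite -ball_normE /=.
  apply: le_lt_trans ke'; apply: row_norm_le => [|i]; first by rewrite mulr_ge0// ltW.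
  have := bt i; have := xb i; rewrite /= !ffunE.
  move: (ratr _) => q h1 h2; rewrite !mxE -(subrKA q).
  apply: le_trans (ler_normD _ _) _; rewrite mulr_natl mulr2n; apply: lerD.
    by move: h2; rewrite !mxE => /ltW.
  by rewrite distrC ltW.
apply: countable_bigcupT_measurable; first exact: countableP.
move=> p; rewrite /F; case: asboolP => // _.
rewrite (_ : _ @^-1` _ = \bigcap_(i in [set: 'I_n])
  ((fun t : n.-tuple RR => tnth t i) @^-1` [set z | `|z - ratr (p.1 i)| < p.2.+1%:R^-1])).
  apply: fin_bigcap_measurable; first exact: finite_finset.
  move=> i _; rewrite -[X in measurable X]setTI; apply: measurable_tnth => //.
  rewrite (_ : [set z | _] = `]ratr (p.1 i) - p.2.+1%:R^-1, ratr (p.1 i) + p.2.+1%:R^-1[).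
    exact: measurable_itv.
  by apply/seteqP; split => z /=; rewrite in_itv/= ltr_distl.
by apply/seteqP; split => t /= H i; [move=> _|]; have := H i; rewrite mxE; apply.
Qed.

Lemma measurable_row n (g : 'rV[R]_n -> R) : continuous g ->
  measurable_fun setT (g \o @row_of_tuple R n).
Proof.
move=> cg; apply: (measurability _ (RGenOInfty.measurableE R)) => //.
move=> _ [_ [a ->] <-]; rewrite setTI.
apply: (@measurable_row_open n (g @^-1` `]a, +oo[)).
by apply: open_comp => [x _|]; [exact: cg|exact: interval_open].
Qed.

(** An integrable weight that factors over the coordinates, so that Tonelli reduces its
    integral to dimension one. *)
Definition tuple_weight n (t : n.-tuple RR) : R := \prod_i (oneDsqr (tnth t i))^-1.

Lemma tuple_weight_gt0 n (t : n.-tuple RR) : 0 < tuple_weight t.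
Proof.
by apply: prodr_gt0 => i _; rewrite invr_gt0 (lt_le_trans ltr01)// oneDsqr_ge1.
Qed.

Lemma tuple_weight_cons n x (t : n.-tuple RR) :
  tuple_weight (tcons (x, t)) = (oneDsqr x)^-1 * tuple_weight t.
Proof.
have e0 : tnth (tcons (x, t)) ord0 = x by exact: tnth0.
have eS i : tnth (tcons (x, t)) (lift ord0 i) = tnth t i by exact: tnthS.
by rewrite /tuple_weight big_ord_recl e0; congr (_ * _); apply: eq_bigr => i _; rewrite eS.
Qed.

Lemma measurable_tuple_weight n : measurable_fun setT (@tuple_weight n).
Proof.
apply: measurable_prod => i _; apply: (@measurableT_comp _ _ _ _ _ _ (fun x : RR => (oneDsqr x)^-1)).
  by apply: continuous_measurable_fun; exact: continuous_oneDsqrV.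
exact: measurable_tnth.
Qed.

Lemma integral_tuple_cons_ge0 n (f : n.+1.-tuple RR -> \bar R) :
  measurable_fun setT f -> (forall t, 0 <= f t)%E ->
  (\int[@lebesgue_tuple R n.+1]_t f t =
   \int[leb]_x \int[@lebesgue_tuple R n]_t f (tcons (x, t)))%E.
Proof.
move=> mf f0; have mt : measurable_fun setT (@tcons R n) by exact: measurable_tcons.
rewrite [LHS](ge0_integral_pushforward mt (leb \x @lebesgue_tuple R n)%E measurableT mf); last first.
  by move=> t _; exact: f0.
rewrite preimage_setT fubini_tonelli1// => [|z]; last exact: f0.
exact: measurableT_comp.
Qed.

Lemma integrable_tuple_cons n (f : n.+1.-tuple RR -> \bar R) :
  (@lebesgue_tuple R n.+1).-integrable setT f ->
  (leb \x @lebesgue_tuple R n)%E.-integrable setT (f \o @tcons R n).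
Proof.
have mt : measurable_fun setT (@tcons R n) by exact: measurable_tcons.
move=> /integrableP[mf foo]; apply/integrableP; split; first exact: measurableT_comp.
have := foo; rewrite [X in (X < _)%E](ge0_integral_pushforward mt (leb \x @lebesgue_tuple R n)%E measurableT).
- by rewrite preimage_setT.
- exact: measurableT_comp.
- by move=> t _.
Qed.

Lemma integral_tuple_cons n (f : n.+1.-tuple RR -> \bar R) :
  (@lebesgue_tuple R n.+1).-integrable setT f ->
  (\int[@lebesgue_tuple R n.+1]_t f t =
   \int[(leb \x @lebesgue_tuple R n)%E]_z f (tcons z))%E.
Proof.
move=> fi; have mt : measurable_fun setT (@tcons R n) by exact: measurable_tcons.
move/integrableP: (fi) => [mf _].
rewrite [LHS](integral_pushforward (mu := (leb \x @lebesgue_tuple R n)%E) mt mf _ measurableT) preimage_setT//.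
exact: integrable_tuple_cons.
Qed.

Lemma integrable_tuple_weight n :
  (@lebesgue_tuple R n).-integrable setT (EFin \o @tuple_weight n).
Proof.
apply/integrableP; split; first by apply/measurable_EFinP; exact: measurable_tuple_weight.
rewrite (_ : (\int[_]_t _)%E = (\int[@lebesgue_tuple R n]_t (tuple_weight t)%:E)%E); last first.
  by apply: eq_integral => t _; rewrite gee0_abs// lee_fin ltW// tuple_weight_gt0.
elim: n => [|n IH].
  rewrite /= integral_dirac//; first by rewrite diracT mul1e ltry.
  by apply/measurable_EFinP; exact: measurable_tuple_weight.
rewrite integral_tuple_cons_ge0; first last.
- by move=> t; rewrite lee_fin ltW// tuple_weight_gt0.
- by apply/measurable_EFinP; exact: measurable_tuple_weight.
have W0 : (0 <= \int[@lebesgue_tuple R n]_t (tuple_weight t)%:E)%E.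
  by apply: integral_ge0 => t _; rewrite lee_fin ltW// tuple_weight_gt0.
rewrite (_ : (\int[leb]_x _)%E = (\int[leb]_x
    ((fine (\int[@lebesgue_tuple R n]_t (tuple_weight t)%:E))%:E * (oneDsqr x)^-1%:E))%E); last first.
  apply: eq_integral => x _; rewrite fineK ?ge0_fin_numE// muleC.
  under eq_integral do rewrite tuple_weight_cons EFinM.
  rewrite ge0_integralZl//.
  - by apply/measurable_EFinP; exact: measurable_tuple_weight.
  - by move=> t _; rewrite lee_fin ltW// tuple_weight_gt0.
have := integrableZl measurableT (fine (\int[@lebesgue_tuple R n]_t (tuple_weight t)%:E)) (integrable_oneDsqr R).
move=> /integrableP[mI]; apply: le_lt_trans; apply: ge0_le_integral => //.
- by move=> x _; rewrite mule_ge0// ?lee_fin ?fine_ge0// invr_ge0 (le_trans ler01)// oneDsqr_ge1.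
- exact: measurableT_comp.
- by move=> x _; rewrite lee_abs.
Qed.

Lemma integrable_weighted n (h : n.-tuple RR -> R) (K : R) :
  measurable_fun setT h -> (forall t, `|h t| <= K * tuple_weight t) ->
  (@lebesgue_tuple R n).-integrable setT (EFin \o h).
Proof.
move=> mh hK; apply: (le_integrable measurableT _ _ (integrableZl measurableT K (integrable_tuple_weight n))).
  by apply/measurable_EFinP.
by move=> t _ /=; rewrite lee_fin (le_trans (hK t))// ler_norm.
Qed.

Definition tuple_upd n (t : n.-tuple RR) (j : 'I_n) (z : R) : n.-tuple RR :=
  [tuple if i == j then z else tnth t i | i < n].

(** Fubini isolates the j-th coordinate, over which [integral_derivative0] applies; the
    induction moves the position j to the head of the tuple. *)
Lemma integral_partial_eq0 n (j : 'I_n) (h dh : n.-tuple RR -> R) (K : R) :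
  measurable_fun setT dh ->
  (forall t z, is_derive z (1 : R) (fun z => h (tuple_upd t j z)) (dh (tuple_upd t j z))) ->
  (forall t, continuous (fun z => dh (tuple_upd t j z))) ->
  (forall t, `|h t| <= K * tuple_weight t) ->
  (forall t, `|dh t| <= K * tuple_weight t) ->
  (\int[@lebesgue_tuple R n]_t (dh t)%:E = 0)%E.
Proof.
elim: n j h dh K => [[]//|n IH] j h dh K mdh d c bh bdh.
have idh := integrable_weighted mdh bdh.
have cidh := integrable_tuple_cons idh.
rewrite integral_tuple_cons//.
case: (unliftP ord0 j) => [i|] jE; rewrite {}jE in d c.
  rewrite -(integral12_prod_meas1 cidh) integral0_eq// => x _.
  have updE (t : n.-tuple RR) z : tuple_upd (tcons (x, t)) (lift ord0 i) z = tcons (x, tuple_upd t i z).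
    apply: eq_from_tnth => l; rewrite tnth_mktuple.
    case: (unliftP ord0 l) => [l'|] ->.
      by rewrite (inj_eq lift_inj) [RHS]tnthS tnth_mktuple [X in if _ then _ else X]tnthS.
    by rewrite (negPf (neq_lift _ _)) [RHS]tnth0 [LHS]tnth0.
  apply: (IH i (fun t => h (tcons (x, t))) (fun t => dh (tcons (x, t))) (K / oneDsqr x)).
  - apply: (measurableT_comp mdh); apply: (measurableT_comp (@measurable_tcons R n)).
    exact: pair1_measurable.
  - move=> t z; have := d (tcons (x, t)) z; rewrite updE.
    by under eq_fun do rewrite updE.
  - move=> t; have := c (tcons (x, t)); by under eq_fun do rewrite updE.
  - by move=> t; rewrite -mulrA -tuple_weight_cons.
  - by move=> t; rewrite -mulrA -tuple_weight_cons.
rewrite -(integral21_prod_meas1 cidh) integral0_eq// => t _.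
have updE z x : tuple_upd (tcons (z, t)) ord0 x = tcons (x, t).
  apply: eq_from_tnth => l; rewrite tnth_mktuple.
  case: (unliftP ord0 l) => [l'|] ->.
    by rewrite eq_sym (negPf (neq_lift _ _)) [RHS]tnthS [LHS]tnthS.
  by rewrite eqxx [RHS]tnth0.
apply: (@integral_derivative0 R (fun x => h (tcons (x, t))) (fun x => dh (tcons (x, t)))
   (K * tuple_weight t)).
- move=> x; have := d (tcons (0, t)) x; rewrite updE.
  by under eq_fun do rewrite updE.
- by have := c (tcons (0, t)); under eq_fun do rewrite updE.
- by move=> x; rewrite -mulrA [_ * _^-1]mulrC -tuple_weight_cons.
- by move=> x; rewrite -mulrA [_ * _^-1]mulrC -tuple_weight_cons.
Qed.

End TupleIntegral.

(** * Integration over the space of row vectors *)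

Section RowIntegral.
Variables (R : realType) (n : nat).
Local Notation mu := (@lebesgue_tuple R n).
Implicit Types (g h : 'rV[R]_n -> R).

Definition rn_int g : R := \int[mu]_t (g (row_of_tuple t)).

(** The exponent 2 n, two powers for each coordinate, is what [tuple_weight] requires. *)
Definition decays g (K : R) := forall x, (1 + `|x|) ^+ (2 * n) * `|g x| <= K.

Lemma tuple_weight_row (t : n.-tuple (measurableTypeR R)) :
  ((1 + `|row_of_tuple t|) ^+ (2 * n))^-1 <= tuple_weight t.
Proof.
rewrite exprM -exprVn -[X in _ ^+ X]card_ord -prodr_const.
apply: ler_prod => i _; rewrite invr_ge0 exprn_ge0 ?addr_ge0//=.
rewrite lef_pV2 ?posrE ?exprn_gt0 ?ltr_wpDr// ?(lt_le_trans ltr01 (oneDsqr_ge1 _))//.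
have := coord_le_norm (row_of_tuple t) i; rewrite mxE => ti.
rewrite sqrrD expr1n mul1r /oneDsqr -addrA lerD2l -[leLHS]add0r lerD//.
by rewrite -[leLHS]real_normK ?num_real// lerXn2r ?nnegrE.
exact: sqr_ge0.
Qed.

Lemma decays_weight g K : decays g K -> forall t, `|g (row_of_tuple t)| <= K * tuple_weight t.
Proof.
move=> gK t; have K0 : 0 <= K.
  by apply: le_trans (gK 0); rewrite mulr_ge0// exprn_ge0// addr_ge0.
apply: le_trans (ler_wpM2l K0 (tuple_weight_row t)).
by rewrite ler_pdivlMr ?exprn_gt0 ?ltr_wpDr// mulrC.
Qed.

Lemma rn_integrable g K : continuous g -> decays g K ->
  mu.-integrable setT (EFin \o (g \o @row_of_tuple R n)).
Proof.
by move=> cg gK; exact: integrable_weighted (measurable_row cg) (decays_weight gK).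
Qed.

(** The constant of the integral bound [rn_int_le]. *)
Definition mass : R := \int[mu]_t (@tuple_weight R n t).

Lemma mass_ge0 : 0 <= mass.
Proof. by apply: Rintegral_ge0 => t _; rewrite ltW// tuple_weight_gt0. Qed.

Lemma rn_int_le g K : continuous g -> decays g K -> `|rn_int g| <= K * mass.
Proof.
move=> cg gK; have ig := rn_integrable cg gK.
apply: le_trans (le_normr_Rintegral measurableT ig) _.
rewrite -RintegralZl//; last exact: integrable_tuple_weight.
apply: le_Rintegral => //.
- exact: integrable_norm ig.
- exact: (integrableZl measurableT K (integrable_tuple_weight R n)).
- by move=> t _; exact: decays_weight.
Qed.

Lemma rn_intD g h K L : continuous g -> continuous h -> decays g K -> decays h L ->
  rn_int (fun x => g x + h x) = rn_int g + rn_int h.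
Proof.
move=> cg ch gK hL; exact: (RintegralD measurableT (rn_integrable cg gK) (rn_integrable ch hL)).
Qed.

Lemma rn_intZ (a : R) g K : continuous g -> decays g K ->
  rn_int (fun x => a * g x) = a * rn_int g.
Proof.
move=> cg gK; exact: (RintegralZl a measurableT (rn_integrable cg gK)).
Qed.

Lemma row_of_tuple_upd (t : n.-tuple (measurableTypeR R)) (j : 'I_n) (z : R) : row_of_tuple (tuple_upd t j z) =
  row_of_tuple (tuple_upd t j 0) + z *: delta_mx 0 j.
Proof.
apply/rowP => i; rewrite !mxE !tnth_mktuple eqxx/=.
by case: eqP => _; rewrite ?mulr1 ?mulr0 ?addr0 ?add0r.
Qed.

Lemma rn_int_derive j g K : (forall x, differentiable g x) ->
  continuous ('D_(delta_mx 0 j) g) -> decays g K -> decays ('D_(delta_mx 0 j) g) K ->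
  rn_int ('D_(delta_mx 0 j) g) = 0.
Proof.
move=> dg cg gK dgK.
rewrite /rn_int /Rintegral.
suff -> : (\int[mu]_t ('D_(delta_mx 0 j) g (row_of_tuple t))%:E = 0)%E by [].
apply: (@integral_partial_eq0 R n j (g \o @row_of_tuple R n)
  ('D_(delta_mx 0 j) g \o @row_of_tuple R n) K).
- exact: measurable_row.
- move=> t z; rewrite /comp row_of_tuple_upd.
  under eq_fun do rewrite row_of_tuple_upd.
  by apply: is_derive_line; exact: diff_derivable.
- move=> t z; rewrite /comp; under eq_fun do rewrite row_of_tuple_upd.
  have cz : (fun z : R => row_of_tuple (tuple_upd t j 0) + z *: delta_mx 0 j) x @[x --> z] -->
      (row_of_tuple (tuple_upd t j 0) + z *: delta_mx 0 j : 'rV[R]_n).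
    by apply: cvgD; [exact: cvg_cst|apply: cvgZr_tmp; exact: cvg_id].
  exact: (cvg_comp _ _ cz (cg _)).
- by move=> t; exact: (decays_weight gK t).
- by move=> t; exact: (decays_weight dgK t).
Qed.

End RowIntegral.

(** * Real Schwartz functions and operators on them *)

Section RapidDecay.
Variables (R : realType) (n : nat).
Local Notation X := 'rV[R]_n.
Implicit Types (u : X -> R) (K : R).

Definition partial (j : 'I_n) u : X -> R := 'D_(delta_mx 0 j) u.
Definition partials (s : seq 'I_n) u : X -> R := foldr partial u s.
Definition smooth u := forall s x, differentiable (partials s u) x.
(** A single scale of norms replaces the two-index family of seminorms: the same k
    bounds the number of derivatives and the weight. *)
Definition schwartz_bound k u K := forall s, (size s <= k)%N -> forall x : X,
  (1 + `|x|) ^+ k * `|partials s u x| <= K.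
Definition schwartzr u := smooth u /\ forall k, exists K, schwartz_bound k u K.

Lemma partials_rcons s j u : partials (rcons s j) u = partials s (partial j u).
Proof. exact: foldr_rcons. Qed.

Lemma weight_ge1 (x : X) : 1 <= 1 + `|x|.
Proof. by rewrite lerDl. Qed.

Lemma weight_gt0 (x : X) k : 0 < (1 + `|x|) ^+ k.
Proof. by rewrite exprn_gt0// (lt_le_trans ltr01)// weight_ge1. Qed.

Lemma schwartz_bound_ge0 k u K : schwartz_bound k u K -> 0 <= K.
Proof. by move=> /(_ [::] (leq0n k) 0); apply: le_trans; rewrite mulr_ge0// ltW// weight_gt0. Qed.

Lemma schwartz_bound_mono k l u K : (k <= l)%N -> schwartz_bound l u K -> schwartz_bound k u K.
Proof.
move=> kl uK s sk x; apply: le_trans (uK s (leq_trans sk kl) x).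
by rewrite ler_wpM2r// ler_weXn2l// weight_ge1.
Qed.

Lemma schwartz_bound_partials k s u K : schwartz_bound (k + size s) u K -> schwartz_bound k (partials s u) K.
Proof.
move=> uK t tk x; rewrite /partials -foldr_cat.
have ts : (size (t ++ s) <= k + size s)%N by rewrite size_cat leq_add2r.
by apply: le_trans (uK _ ts x); rewrite ler_wpM2r// ler_weXn2l ?weight_ge1// leq_addr.
Qed.

Lemma schwartzr_partials s u : schwartzr u -> schwartzr (partials s u).
Proof.
move=> [du bu]; split=> [t x|k]; first by rewrite /partials -foldr_cat; exact: du.
by have [K uK] := bu (k + size s)%N; exists K; exact: schwartz_bound_partials.
Qed.

Lemma schwartzr_differentiable u x : schwartzr u -> differentiable u x.
Proof. by move=> [du _]; exact: (du [::]). Qed.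

Lemma schwartzr_continuous u : schwartzr u -> continuous u.
Proof. by move=> su x; apply: differentiable_continuous; exact: schwartzr_differentiable. Qed.

Local Notation op := ((X -> R) -> (X -> R)).

(** Continuity in terms of the scale of norms, which composes: each norm of the image
    is controlled by one norm of the argument. *)
Definition schwartz_op (J : op) := (forall u, schwartzr u -> smooth (J u)) /\
  forall k, exists l (c : R), forall u K, schwartzr u -> schwartz_bound l u K -> schwartz_bound k (J u) (c * K).

Lemma schwartz_op_schwartzr J u : schwartz_op J -> schwartzr u -> schwartzr (J u).
Proof.
move=> [dJ bJ] su; split=> [|k]; first exact: dJ.
by have [l [c cP]] := bJ k; have [K uK] := su.2 l; exists (c * K); exact: cP.
Qed.

(** A family of operators that is stable under following a partial derivative, and
    whose members satisfy weighted sup bounds. Derivatives of arbitrary order then need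
    no separate estimate ([op_family_schwartz_op]). *)
Record op_family (P : op -> Prop) : Prop := OpFamily {
  op_family_bound : forall J, P J -> forall N, exists l (c : R), forall u K,
    schwartzr u -> schwartz_bound l u K -> forall x, (1 + `|x|) ^+ N * `|J u x| <= c * K;
  op_family_diff : forall J, P J -> forall u x, schwartzr u -> differentiable (J u) x;
  op_family_partial : forall J j, P J -> exists2 J' : op, P J' &
    forall u, schwartzr u -> partial j (J u) = J' u }.

(** The bounds for derivatives of order k follow by induction on k: the derivative
    that is performed first is exchanged for another member of the family, one for each direction. *)
Lemma op_family_schwartz_op P J : op_family P -> P J -> schwartz_op J.
Proof.
move=> [bP dP pP] PJ; split.
  move=> u su s; elim/last_ind: s J PJ => [|s j IH] J PJ x; first exact: (dP J PJ u x su).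
  by rewrite partials_rcons; have [J' PJ' ->//] := pP J j PJ; exact: IH.
move=> k; suff [l [c cP]] : exists l (c : R), forall u K, schwartzr u -> schwartz_bound l u K ->
    forall s, (size s <= k)%N -> forall x, (1 + `|x|) ^+ k * `|partials s (J u) x| <= c * K.
  by exists l, c => u K su uK s sk x; exact: cP.
move: {2}k => N; elim: k J PJ => [|k IH] J PJ.
  have [l [c cP]] := bP J PJ N; exists l, c => u K su uK s.
  by rewrite leqn0 size_eq0 => /eqP ->; exact: cP.
have [l0 [c0 c0P]] := bP J PJ N.
have /choice[f fP] : forall j, exists lc : nat * R, forall u K, schwartzr u -> schwartz_bound lc.1 u K ->
    forall s, (size s <= k)%N -> forall x,
    (1 + `|x|) ^+ N * `|partials s (partial j (J u)) x| <= lc.2 * K.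
  move=> j; have [J' PJ' JE] := pP J j PJ; have [l [c cP]] := IH J' PJ'.
  by exists (l, c) => u K su uK s sk x; rewrite JE//; exact: cP.
exists (maxn l0 (\max_j (f j).1)), (`|c0| + \sum_j `|(f j).2|) => u K su uK s.
have K0 := schwartz_bound_ge0 uK.
case/lastP: s => [_ x|s j].
  apply: le_trans (c0P u K su _ x) _; first by apply: schwartz_bound_mono uK; exact: leq_maxl.
  rewrite ler_wpM2r//; apply: le_trans (ler_norm _) _.
  by rewrite lerDl sumr_ge0.
rewrite size_rcons ltnS partials_rcons => sk x.
apply: le_trans (fP j u K su _ s sk x) _.
  by apply: schwartz_bound_mono uK; apply: leq_trans (leq_maxr _ _); exact: (@leq_bigmax 'I_n (fun j => (f j).1) j).
rewrite ler_wpM2r//; apply: le_trans (ler_norm _) _.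
by rewrite (bigD1 j)//= addrCA lerDl addr_ge0// sumr_ge0.
Qed.

(** By the Leibniz rule the derivatives of a product with a tame factor stay in this
    family. *)
Inductive mul_partials : op -> Prop :=
| mul_partials_mul g s : tame setT g -> mul_partials (fun u x => g x * partials s u x)
| mul_partials_add J1 J2 : mul_partials J1 -> mul_partials J2 -> mul_partials (fun u x => J1 u x + J2 u x).

Lemma op_family_mul_partials : op_family mul_partials.
Proof.
have dm J : mul_partials J -> forall u x, schwartzr u -> differentiable (J u) x.
  elim=> [g s tg|J1 J2 _ d1 _ d2] u x su.
    exact: (differentiableM (tame_differentiable x tg) (su.1 s x)).
  exact: (differentiableD (d1 u x su) (d2 u x su)).
split=> //.
- move=> J; elim=> [g s tg|J1 J2 m1 b1 m2 b2] N.
    have [k gk] := tame_growth tg.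
    exists (N + k + size s)%N, k%:R => u K su uK x.
    have K0 := schwartz_bound_ge0 uK.
    have gx := gk x I.
    rewrite normrM mulrCA.
    apply: (@le_trans _ _ (poly_bound k `|x| * ((1 + `|x|) ^+ N * `|partials s u x|))).
      by rewrite ler_wpM2r// mulr_ge0// ltW// weight_gt0.
    rewrite /poly_bound -mulrA ler_wpM2l// mulrA -exprD addnC.
    exact: (schwartz_bound_partials uK (leq0n _ : (size [::] <= _)%N) x).
  have [l1 [c1 c1P]] := b1 N; have [l2 [c2 c2P]] := b2 N.
  exists (maxn l1 l2), (c1 + c2) => u K su uK x.
  (* the larger of the two indices serves both summands *)
  apply: (@le_trans _ _ ((1 + `|x|) ^+ N * (`|J1 u x| + `|J2 u x|))).
    by rewrite ler_wpM2l ?ler_normD// ltW// weight_gt0.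
  rewrite mulrDr mulrDl lerD//; [apply: c1P|apply: c2P] => //.
    by apply: schwartz_bound_mono uK; exact: leq_maxl.
  by apply: schwartz_bound_mono uK; exact: leq_maxr.
- move=> J j; elim=> [g s tg|J1 J2 m1 [J1' m1' E1] m2 [J2' m2' E2]].
    exists (fun u x => 'D_(delta_mx 0 j) g x * partials s u x + g x * partials (j :: s) u x).
      by apply: mul_partials_add; apply: mul_partials_mul => //; exact: tame_derive.
    move=> u su; apply/funext => x; rewrite /partial.
    have d1 : derivable g x (delta_mx 0 j) by exact: tame_derivable tg.
    have d2 : derivable (partials s u) x (delta_mx 0 j) by apply: diff_derivable; exact: su.1.
    rewrite [LHS](deriveM d1 d2).
    by rewrite addrC /GRing.scale/= (mulrC (partials s u x)).
  exists (fun u x => J1' u x + J2' u x); first exact: mul_partials_add.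
  move=> u su; apply/funext => x; rewrite -E1// -E2//.
  have d1 : derivable (J1 u) x (delta_mx 0 j) by apply: diff_derivable; exact: dm.
  have d2 : derivable (J2 u) x (delta_mx 0 j) by apply: diff_derivable; exact: dm.
  exact: (deriveD d1 d2).
Qed.

Lemma schwartz_op_mul g : tame setT g -> schwartz_op (fun u x => g x * u x).
Proof. by move=> tg; apply: op_family_schwartz_op op_family_mul_partials (mul_partials_mul [::] tg). Qed.

Lemma partials_add s u v : smooth u -> smooth v ->
  partials s (fun x => u x + v x) = (fun x => partials s u x + partials s v x).
Proof.
move=> du dv; elim: s => //= j s ->; apply/funext => x.
have d1 : derivable (partials s u) x (delta_mx 0 j) by apply: diff_derivable; exact: du.
have d2 : derivable (partials s v) x (delta_mx 0 j) by apply: diff_derivable; exact: dv.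
exact: (deriveD d1 d2).
Qed.

Lemma smooth_add u v : smooth u -> smooth v -> smooth (fun x => u x + v x).
Proof.
by move=> du dv s x; rewrite partials_add//; exact: (differentiableD (du s x) (dv s x)).
Qed.

Lemma schwartz_bound_add k u v K L : smooth u -> smooth v -> schwartz_bound k u K -> schwartz_bound k v L ->
  schwartz_bound k (fun x => u x + v x) (K + L).
Proof.
move=> du dv uK vL s sk x; rewrite partials_add//.
apply: (@le_trans _ _ ((1 + `|x|) ^+ k * (`|partials s u x| + `|partials s v x|))).
  by rewrite ler_wpM2l ?ler_normD// ltW// weight_gt0.
by rewrite mulrDr lerD// ?uK ?vL.
Qed.

End RapidDecay.

(** * Integral operators with tame kernels *)

(** A quadratic remainder is stronger than the little-o of differentiability, and it
    survives integration in a parameter. *)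
Lemma quadratic_differentiable (R : realType) (V : normedModType R) (f : V -> R) (y : V)
    (L : V -> R) (C : R) :
  (forall a u v, L (a *: u + v) = a * L u + L v) -> continuous L ->
  (forall h : V, `|h| <= 1 -> `|f (h + y) - f y - L h| <= C * `|h| ^+ 2) ->
  differentiable f y /\ forall v, 'D_v f y = L v.
Proof.
move=> linL cL fC.
have lo : f \o shift y = cst (f y) + linear_pack linL +o_ (0 : V) id.
  apply/eqaddoP => e e0; rewrite near_simpl.
  have C0 : 0 < `|C| + 1 by rewrite ltr_wpDl.
  apply/nbhs_ballP; exists (Num.min 1 (e / (`|C| + 1))) => /=.
    by rewrite lt_min ltr01 divr_gt0.
  move=> h; rewrite -ball_normE /= sub0r normrN lt_min => /andP[h1 he].
  have -> : ((f \o shift y) - (cst (f y) + (linear_pack linL : V -> R))) h = f (h + y) - f y - L h.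
    by rewrite !fctE opprD addrA.
  apply: le_trans (fC h (ltW h1)) _; rewrite expr2 mulrA ler_wpM2r//.
  apply: (@le_trans _ _ ((`|C| + 1) * `|h|)).
    by rewrite ler_wpM2r// (le_trans (ler_norm C))// lerDl.
  by rewrite mulrC -ler_pdivlMr// ltW.
have dE : 'd f y = (linear_pack linL) :> (V -> R).
  exact: (@diff_unique _ _ _ f (linear_pack linL) y cL lo).
have df : differentiable f y.
  by apply/diff_locallyP; rewrite dE.
by split=> // v; rewrite deriveE// dE.
Qed.

Lemma taylor2 (R : realType) (f f1 f2 : R -> R) (B : R) :
  (forall t, is_derive t (1 : R) f (f1 t)) -> (forall t, is_derive t (1 : R) f1 (f2 t)) ->
  (forall t, 0 <= t <= 1 -> `|f2 t| <= B) -> `|f 1 - f 0 - f1 0| <= B.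
Proof.
move=> df df1 fB.
have cont (g g' : R -> R) a b : (forall t, is_derive t (1 : R) g (g' t)) -> {within `[a, b], continuous g}.
  move=> dg; apply: derivable_within_continuous => t _.
  exact: (@ex_derive _ _ _ _ _ _ _ (dg t)).
have [s s01 ->] := MVT ltr01 (fun t _ => df t) (cont _ _ _ _ df).
rewrite subr0 mulr1.
have /andP[s0 s1] : 0 < s < 1 by move: s01; rewrite in_itv.
have [t t0s ->] := MVT s0 (fun t _ => df1 t) (cont _ _ _ _ df1).
have /andP[t0 ts] : 0 < t < s by move: t0s; rewrite in_itv.
have fB' : `|f2 t| <= B by apply: fB; rewrite (ltW t0)/= ltW// (lt_trans ts).
rewrite subr0 normrM; apply: le_trans fB'.
by rewrite ler_piMr// ger0_norm ?ltW.
Qed.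

Lemma pair_ext (A B : Type) (p q : A * B) : p.1 = q.1 -> p.2 = q.2 -> p = q.
Proof. by case: p q => [a b] [a' b'] /= -> ->. Qed.

Section Kernels.
Variables (R : realType) (n : nat).
Local Notation X := 'rV[R]_n.
Local Notation X2 := (X * X)%type.
Implicit Types (w : X2 -> R) (u : X -> R) (K c : R).

(** Slices are affine substitutions. *)
Lemma tame_left w y : tame setT w -> tame setT (fun x : X => w (x, y)).
Proof.
apply: (tame_subst (psi := fun x => (x, y))) => // l linl cl.
have E x : l (x, y) = l (x, 0) + l (0, y).
  rewrite -[X in X + _]mul1r -linl; congr l; apply: pair_ext => /=.
    by rewrite scale1r addr0.
  by rewrite scaler0 add0r.
rewrite (funext E); apply: tame_add; last exact: tame_cst.
apply: tame_lin => [a u v|x].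
  rewrite -linl; congr l; apply: pair_ext => //=.
  by rewrite scaler0 addr0.
have cp : {for x, continuous (fun x : X => (x, 0 : X))}.
  exact: (cvg_pair (@cvg_id _ (nbhs x)) (cvg_cst (0 : X))).
exact: (continuous_comp cp (cl (x, 0))).
Qed.

Lemma derive_left w v x y : 'D_v (fun x : X => w (x, y)) x = 'D_(v, 0) w (x, y).
Proof.
apply: (@derive_slice _ _ _ (fun x : X => (x, y)) v (v, 0) w x) => h z.
by apply: pair_ext => //=; rewrite scaler0 add0r.
Qed.

Lemma kernel_growth w : tame setT w -> exists k c, 0 <= c /\
  forall x y : X, `|w (x, y)| <= c * ((1 + `|x|) ^+ k * (1 + `|y|) ^+ k).
Proof.
move=> /tame_growth[k wk]; exists k, k%:R; split=> // x y.
apply: le_trans (wk (x, y) I) _; rewrite /poly_bound ler_wpM2l// -exprMn.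
rewrite lerXn2r ?nnegrE ?mulr_ge0 ?addr_ge0//.
rewrite mulrDl mul1r mulrDr mulr1 -addrA lerD2l prod_normE/= ge_max; apply/andP; split.
  by rewrite addrCA lerDl addr_ge0// mulr_ge0.
by rewrite lerDl addr_ge0// mulr_ge0.
Qed.

Definition integral_op w u (y : X) : R := rn_int (fun x => w (x, y) * u x).

(** The integrands for which the integral is additive and homogeneous. *)
Definition nice (g : X -> R) := continuous g /\ exists K, decays g K.

Lemma integral_op_decays (g : X -> R) (k : nat) c u K : 0 <= c ->
  (forall x, `|g x| <= c * (1 + `|x|) ^+ k) -> schwartz_bound (k + 2 * n) u K ->
  decays (fun x => g x * u x) (c * K).
Proof.
move=> c0 gk uK x; rewrite normrM.
apply: (@le_trans _ _ ((1 + `|x|) ^+ (2 * n) * (c * (1 + `|x|) ^+ k * `|u x|))).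
  by rewrite ler_wpM2l ?ler_wpM2r// ltW// weight_gt0.
rewrite -mulrA mulrCA ler_wpM2l// mulrA -exprD addnC.
exact: (uK [::] (leq0n _) x).
Qed.

Lemma mul_continuous (g u : X -> R) : continuous g -> continuous u -> continuous (fun x => g x * u x).
Proof. by move=> cg cu x; apply: continuousM; [exact: cg|exact: cu]. Qed.

Lemma tame_left_continuous w y : tame setT w -> continuous (fun x : X => w (x, y)).
Proof. by move=> tw; apply: tame_continuous (tame_left y tw). Qed.

Lemma integral_op_nice w u y : tame setT w -> schwartzr u -> nice (fun x => w (x, y) * u x).
Proof.
move=> tw su; split.
  by apply: mul_continuous; [exact: tame_left_continuous|exact: schwartzr_continuous].
have [k [c [c0 wk]]] := kernel_growth tw.
have [K uK] := su.2 (k + 2 * n)%N.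
exists (c * (1 + `|y|) ^+ k * K); apply: integral_op_decays uK.
  by rewrite mulr_ge0// ltW// weight_gt0.
by move=> x; rewrite -mulrA [X in _ * X]mulrC; exact: wk.
Qed.

Lemma nice_add g h : nice g -> nice h -> nice (fun x => g x + h x).
Proof.
move=> [cg [K gK]] [ch [L hL]]; split.
  by move=> x; exact: (@continuousD _ _ _ g h x (cg x) (ch x)).
exists (K + L) => x.
apply: (@le_trans _ _ ((1 + `|x|) ^+ (2 * n) * (`|g x| + `|h x|))).
  by rewrite ler_wpM2l ?ler_normD// ltW// weight_gt0.
by rewrite mulrDr lerD// ?gK ?hL.
Qed.

Lemma nice_scale (a : R) g : nice g -> nice (fun x => a * g x).
Proof.
move=> [cg [K gK]]; split; first by apply: mul_continuous => //; exact: cst_continuous.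
by exists (`|a| * K) => x; rewrite normrM mulrCA ler_wpM2l// gK.
Qed.

Lemma nice0 : nice (fun=> 0).
Proof. by split; [exact: cst_continuous|exists 0 => x; rewrite normr0 mulr0]. Qed.

Lemma nice_sum (I : Type) (r : seq I) (g : I -> X -> R) : (forall i, nice (g i)) ->
  nice (fun x => \sum_(i <- r) g i x).
Proof.
move=> ng; elim: r => [|i r IH].
  by rewrite (_ : (fun _ => _) = fun=> 0) ?funeqE => [|x]; [exact: nice0|rewrite big_nil].
rewrite (_ : (fun _ => _) = fun x => g i x + \sum_(j <- r) g j x); first exact: nice_add.
by apply/funext => x; rewrite big_cons.
Qed.

Lemma rn_int_add g h : nice g -> nice h -> rn_int (fun x => g x + h x) = rn_int g + rn_int h.
Proof. by move=> [cg [K gK]] [ch [L hL]]; exact: rn_intD gK hL. Qed.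

Lemma rn_int_scale (a : R) g : nice g -> rn_int (fun x => a * g x) = a * rn_int g.
Proof. by move=> [cg [K gK]]; exact: rn_intZ gK. Qed.

Lemma rn_int_sum (I : Type) (r : seq I) (g : I -> X -> R) : (forall i, nice (g i)) ->
  rn_int (fun x => \sum_(i <- r) g i x) = \sum_(i <- r) rn_int (g i).
Proof.
move=> ng; elim: r => [|i r IH].
  rewrite big_nil (_ : (fun _ => _) = fun x : X => 0 * 0); last first.
    by apply/funext => x; rewrite big_nil mulr0.
  by rewrite (rn_int_scale _ nice0) mul0r.
rewrite big_cons -IH -rn_int_add//; last exact: nice_sum.
by congr rn_int; apply/funext => x; rewrite big_cons.
Qed.

(** Polynomial growth of the kernel costs a weight on u and passes to y; [oscillating]
    kernels do better. *)
Lemma integral_op_growth w : tame setT w -> exists M l c, 0 <= c /\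
  forall u K, schwartzr u -> schwartz_bound l u K -> forall y, `|integral_op w u y| <= c * K * (1 + `|y|) ^+ M.
Proof.
move=> tw; have [k [c [c0 wk]]] := kernel_growth tw.
exists k, (k + 2 * n)%N, (c * mass R n); split; first by rewrite mulr_ge0// mass_ge0.
move=> u K su uK y.
have d : decays (fun x => w (x, y) * u x) (c * (1 + `|y|) ^+ k * K).
  apply: integral_op_decays uK; first by rewrite mulr_ge0// ltW// weight_gt0.
  by move=> x; rewrite -mulrA [X in _ * X]mulrC; exact: wk.
apply: le_trans (rn_int_le (integral_op_nice y tw su).1 d) _.
by rewrite le_eqVlt; apply/orP; left; apply/eqP; ring.
Qed.

(** The total derivative of the integrand has integral zero. *)
Lemma integral_op_by_parts w u j y : tame setT w -> schwartzr u ->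
  integral_op ('D_(delta_mx 0 j, 0) w) u y = - integral_op w (partial j u) y.
Proof.
move=> tw su; have su' : schwartzr (partial j u) by exact: (schwartzr_partials [:: j]).
have n1 := integral_op_nice y tw su; have n2 := integral_op_nice y tw su'.
have n3 := integral_op_nice y (tame_derive (delta_mx 0 j, 0) tw) su.
apply/eqP; rewrite -addr_eq0 -[X in X == 0]rn_int_add//.
set g := fun x => w (x, y) * u x.
have E : (fun x => 'D_(delta_mx 0 j, 0) w (x, y) * u x + w (x, y) * partial j u x) = 'D_(delta_mx 0 j) g.
  apply/funext => x; have d1 : derivable (fun x => w (x, y)) x (delta_mx 0 j).
    exact: tame_derivable (tame_left y tw).
  have d2 : derivable u x (delta_mx 0 j) by apply: diff_derivable; exact: schwartzr_differentiable.
  by rewrite [RHS](deriveM d1 d2) derive_left addrC /GRing.scale/= (mulrC (u x)).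
have n4 := nice_add n3 n2; rewrite E in n4 *.
have [cg [K gK]] := n1; have [cdg [L gL]] := n4.
apply/eqP; apply: (@rn_int_derive _ _ j g (Num.max K L)) => //.
- move=> x; apply: differentiableM; last exact: schwartzr_differentiable.
  exact: tame_differentiable (tame_left y tw).
- by move=> x; apply: le_trans (gK x) _; rewrite le_max lexx.
- by move=> x; apply: le_trans (gL x) _; rewrite le_max lexx orbT.
Qed.

End Kernels.

(** * Differentiation under the integral sign *)

Section KernelDerivative.
Variables (R : realType) (n : nat).
Local Notation X := 'rV[R]_n.
Local Notation X2 := (X * X)%type.
Implicit Types (w : X2 -> R) (u : X -> R) (K c : R).

Definition dy (j : 'I_n) w : X2 -> R := 'D_(0 : X, delta_mx 0 j) w.
Definition dx (j : 'I_n) w : X2 -> R := 'D_(delta_mx 0 j, 0 : X) w.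

(** Linearity of the differential in the direction. *)
Lemma derive_right_sum w (h : X) : tame setT w ->
  'D_(0 : X, h) w = fun p => \sum_j h 0 j * dy j w p.
Proof.
move=> tw; apply/funext => p; have dw := tame_differentiable p tw.
rewrite deriveE// (_ : (0 : X, h) = \sum_j h 0 j *: (0 : X, delta_mx 0 j) :> X2).
  by rewrite linear_sum; apply: eq_bigr => j _; rewrite linearZ /dy deriveE.
apply: pair_ext => /=.
  rewrite (big_morph fst (id1 := 0) (op1 := +%R))//.
  by rewrite big1// => j _ /=; rewrite scaler0.
rewrite (big_morph snd (id1 := 0) (op1 := +%R))//=.
exact: row_sum_delta.
Qed.

Lemma kernel_growth_fam (I : finType) (F : I -> X2 -> R) : (forall i, tame setT (F i)) ->
  exists k c, 0 <= c /\
  forall i x y, `|F i (x, y)| <= c * ((1 + `|x|) ^+ k * (1 + `|y|) ^+ k).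
Proof.
move=> tF; have /choice[f fP] : forall i, exists kc : nat * R, 0 <= kc.2 /\
    forall x y, `|F i (x, y)| <= kc.2 * ((1 + `|x|) ^+ kc.1 * (1 + `|y|) ^+ kc.1).
  by move=> i; have [k [c H]] := kernel_growth (tF i); exists (k, c).
exists (\max_i (f i).1)%N, (\sum_i (f i).2); split.
  by apply: sumr_ge0 => i _; have [] := fP i.
move=> i x y; have [c0 H] := fP i; apply: le_trans (H x y) _.
have w0 (x' : X) l : 0 <= (1 + `|x'|) ^+ l by rewrite ltW// weight_gt0.
apply: ler_pM; [exact: c0|exact: mulr_ge0| |].
  by rewrite (bigD1 i)//= lerDl sumr_ge0// => j _; have [] := fP j.
have le_k : ((f i).1 <= \max_i (f i).1)%N by exact: (@leq_bigmax _ (fun i => (f i).1) i).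
by apply: ler_pM => //; rewrite ler_weXn2l ?weight_ge1.
Qed.

(** The bound is uniform in x up to a polynomial weight, which the decay of u absorbs. *)
Lemma kernel_taylor w y : tame setT w -> exists k C, 0 <= C /\
  forall (h x : X), `|h| <= 1 ->
    `|w (x, h + y) - w (x, y) - \sum_j h 0 j * dy j w (x, y)| <= C * `|h| ^+ 2 * (1 + `|x|) ^+ k.
Proof.
move=> tw.
have tww (ij : 'I_n * 'I_n) : tame setT (dy ij.1 (dy ij.2 w)) by do 2!apply: tame_derive.
have [k [c [c0 wk]]] := kernel_growth_fam tww.
exists k, (c * (2 + `|y|) ^+ k * n%:R * n%:R); split.
  by rewrite !mulr_ge0// exprn_ge0// addr_ge0.
move=> h x h1; set B := _ * (1 + `|x|) ^+ k.
(* restriction of the kernel to the segment from (x, y) to (x, y + h) *)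
pose f (t : R) := w ((x, y) + t *: (0 : X, h)).
pose f1 (t : R) := 'D_(0 : X, h) w ((x, y) + t *: (0 : X, h)).
pose f2 (t : R) := 'D_(0 : X, h) ('D_(0 : X, h) w) ((x, y) + t *: (0 : X, h)).
have df t : is_derive t (1 : R) f (f1 t).
  by apply: is_derive_line; exact: tame_derivable tw.
have df1 t : is_derive t (1 : R) f1 (f2 t).
  by apply: is_derive_line; exact: tame_derivable (tame_derive _ tw).
have hj j : `|h 0 j| <= `|h| by exact: coord_le_norm.
have f2B t : 0 <= t <= 1 -> `|f2 t| <= B.
  move=> /andP[t0 t1]; 
  have -> : f2 t = \sum_j h 0 j * dy j ('D_(0 : X, h) w) ((x, y) + t *: (0 : X, h)).
    exact: (congr1 (@^~ _) (derive_right_sum h (tame_derive (0 : X, h) tw))).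
  have pE : (x, y) + t *: (0 : X, h) = (x, y + t *: h) :> X2.
    by apply: pair_ext => //=; rewrite scaler0 addr0.
  rewrite pE.
  have yh : 1 + `|y + t *: h| <= 2 + `|y|.
    rewrite (_ : 2 + _ = 1 + (`|y| + 1)); last by ring.
    rewrite lerD2l (le_trans (ler_normD _ _))// lerD2l normrZ ger0_norm//.
    by rewrite mulr_ile1.
  have dB i j : `|dy i (dy j w) (x, y + t *: h)| <= c * ((1 + `|x|) ^+ k * (2 + `|y|) ^+ k).
    apply: le_trans (wk (i, j) _ _) _; rewrite ler_wpM2l// ler_wpM2l ?(ltW (weight_gt0 _ _))//.
    by rewrite lerXn2r ?nnegrE ?addr_ge0.
  rewrite (_ : B = \sum_(i < n) \sum_(j < n) `|h| * (`|h| * (c * ((1 + `|x|) ^+ k * (2 + `|y|) ^+ k)))); last first.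
    rewrite !sumr_const !card_ord /B -[RHS]mulr_natr.
    rewrite -[X in _ = X * _](mulr_natr (`|h| * _)).
    move: ((1 + `|x|) ^+ k) ((2 + `|y|) ^+ k) (n%:R : R) `|h| => a b d e.
    by rewrite expr2 !mulrA; clear; ring.
  apply: le_trans (ler_norm_sum _ _ _) _; apply: ler_sum => i _.
  have -> : dy i ('D_(0 : X, h) w) (x, y + t *: h) =
      \sum_j h 0 j * dy i (dy j w) (x, y + t *: h).
    have tF j : tame setT (fun p : X2 => h 0 j * dy j w p).
      by apply: tame_scale; exact: tame_derive.
    rewrite derive_right_sum//.
    apply: etrans (congr1 (@^~ (x, y + t *: h))
      (tame_sumE (index_enum 'I_n) (0 : X, delta_mx 0 i) tF)) _.
    by apply: eq_bigr => j _; exact: (congr1 (@^~ _) (tame_scaleE _ _ (tame_derive _ tw))).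
  rewrite normrM.
  apply: (@le_trans _ _ (`|h 0 i| * \sum_j `|h 0 j * dy i (dy j w) (x, y + t *: h)|)).
    by rewrite ler_wpM2l// ler_norm_sum.
  rewrite mulr_sumr; apply: ler_sum => j _.
  by apply: ler_pM => //; rewrite normrM; apply: ler_pM.
have := taylor2 df df1 f2B.
have -> : f1 0 = \sum_j h 0 j * dy j w ((x, y) + 0 *: (0 : X, h)).
  exact: (congr1 (@^~ _) (derive_right_sum h tw)).
rewrite /f !scale0r !addr0 scale1r (_ : (x, y) + (0 : X, h) = (x, h + y))//.
by apply: pair_ext => /=; rewrite ?addr0 1?addrC.
Qed.

Lemma integral_op_linear_nice w u y (h : X) : tame setT w -> schwartzr u ->
  nice (fun x => (\sum_j h 0 j * dy j w (x, y)) * u x) /\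
  rn_int (fun x => (\sum_j h 0 j * dy j w (x, y)) * u x) = \sum_j h 0 j * integral_op (dy j w) u y.
Proof.
move=> tw su.
have nj j : nice (fun x => dy j w (x, y) * u x) by apply: integral_op_nice su; exact: tame_derive.
rewrite (_ : (fun _ => _) = fun x => \sum_j h 0 j * (dy j w (x, y) * u x)); last first.
  by apply/funext => x; rewrite mulr_suml; apply: eq_bigr => j _; rewrite mulrA.
split; first by apply: nice_sum => j; exact: nice_scale.
rewrite rn_int_sum; last by move=> j; exact: nice_scale.
by apply: eq_bigr => j _; rewrite rn_int_scale.
Qed.

(** Integrating [kernel_taylor] against u gives a quadratic remainder. *)
Lemma integral_op_differentiable w u y : tame setT w -> schwartzr u ->
  differentiable (integral_op w u) y /\
  forall v, 'D_v (integral_op w u) y = \sum_j v 0 j * integral_op (dy j w) u y.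
Proof.
move=> tw su; have [k [C [C0 wC]]] := kernel_taylor y tw.
have [K uK] := su.2 (k + 2 * n)%N.
pose L (h : X) := \sum_j h 0 j * integral_op (dy j w) u y.
apply: (@quadratic_differentiable _ _ _ _ L (C * K * mass R n)).
- move=> a h h'; rewrite /L mulr_sumr -big_split/=; apply: eq_bigr => j _.
  by rewrite !mxE mulrDl mulrA.
- apply: (@tame_continuous _ _ setT); apply: tame_sum => j.
  by apply: tame_mul; [exact: tame_coord|exact: tame_cst].
move=> h h1.
have [nl El] := integral_op_linear_nice y h tw su.
have n1 := integral_op_nice (h + y) tw su; have n2 := integral_op_nice y tw su.
pose g x := w (x, h + y) - w (x, y) - \sum_j h 0 j * dy j w (x, y).
have gE : (fun x => w (x, h + y) * u x + (-1) * (w (x, y) * u x) +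
    (-1) * ((\sum_j h 0 j * dy j w (x, y)) * u x)) = fun x => g x * u x.
  by apply/funext => x; rewrite /g !mulN1r !mulrBl.
have ng : nice (fun x => g x * u x).
  by rewrite -gE; apply: nice_add; [apply: nice_add => //|]; exact: nice_scale.
have -> : integral_op w u (h + y) - integral_op w u y - L h = rn_int (fun x => g x * u x).
  rewrite -gE rn_int_add ?rn_int_add ?rn_int_scale ?El ?mulN1r//; try exact: nice_scale.
  by apply: nice_add => //; exact: nice_scale.
have dg : decays (fun x => g x * u x) (C * `|h| ^+ 2 * K).
  apply: integral_op_decays uK; first by rewrite mulr_ge0// exprn_ge0.
  by move=> x; exact: wC.
apply: le_trans (rn_int_le ng.1 dg) _.
by rewrite le_eqVlt; apply/orP; left; apply/eqP; ring.
Qed.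

Lemma partial_integral_op w u j : tame setT w -> schwartzr u -> partial j (integral_op w u) = integral_op (dy j w) u.
Proof.
move=> tw su; apply/funext => y; rewrite /partial (integral_op_differentiable y tw su).2.
rewrite (bigD1 j)//= big1 ?addr0 => [|i ij]; rewrite mxE eqxx/= ?eqxx ?mul1r//.
by rewrite (negPf ij) mul0r.
Qed.

End KernelDerivative.

(** * Oscillating kernels *)

Section Oscillating.
Variables (R : realType) (n : nat) (c : R).
Hypothesis c0 : c != 0.
Local Notation X := 'rV[R]_n.
Local Notation X2 := (X * X)%type.
Implicit Types (w r g : X2 -> R) (u : X -> R) (K : R).

(** Kernels that satisfy the Helmholtz equation Delta_x w = - c^2 |y|^2 w up to a
    remainder of the same kind. The nesting is finite, which allows induction, and the
    remainder is what makes the class stable under derivatives in y. *)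
Inductive oscillating : (X2 -> R) -> Prop :=
| osc0 : oscillating (fun=> 0)
| oscillating_step w r : tame setT w -> oscillating r ->
    (forall p, \sum_j dx j (dx j w) p = - (c ^+ 2 * dotp p.2 p.2 * w p) + r p) -> oscillating w.

Lemma oscillating_tame w : oscillating w -> tame setT w.
Proof. by case=> // *; exact: tame_cst. Qed.

Lemma tame_right j : tame setT (fun p : X2 => p.2 0 j).
Proof.
apply: tame_lin => [a u v|v]; first by rewrite !mxE.
apply: (@cvg_comp _ _ _ (fun p : X2 => p.2) (fun x : X => x 0 j)).
  exact: cvg_snd.
exact: coord_continuous.
Qed.

Lemma derive_right_coord (v p : X2) j : 'D_v (fun p : X2 => p.2 0 j) p = v.2 0 j.
Proof.
apply: derive_linear_fun => [a u v'|v']; first by rewrite !mxE.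
by apply: (@tame_continuous _ _ setT); exact: tame_right.
Qed.

Lemma tame_right_sqr : tame setT (fun p : X2 => dotp p.2 p.2).
Proof. by apply: tame_sum => j; apply: tame_mul; exact: tame_right. Qed.

Lemma derive_right_sqr j p : dy j (fun p : X2 => dotp p.2 p.2) p = 2 * p.2 0 j.
Proof.
have tF i : tame setT (fun p : X2 => p.2 0 i * p.2 0 i).
  by apply: tame_mul; exact: tame_right.
apply: etrans (congr1 (@^~ p) (tame_sumE (index_enum 'I_n) (0 : X, delta_mx 0 j) tF)) _.
rewrite (bigD1 j)//= big1 ?addr0 => [|i ij].
  rewrite (tD_mul _ _ (tame_right j) (tame_right j)) derive_right_coord mxE !eqxx/=.
  by rewrite mul1r mulr1 [RHS]mulr_natl mulr2n.
rewrite (tD_mul _ _ (tame_right i) (tame_right i)) derive_right_coord mxE (negPf ij) andbF.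
by rewrite mul0r mulr0 addr0.
Qed.

Lemma oscillating_add w1 w2 : oscillating w1 -> oscillating w2 -> oscillating (fun p => w1 p + w2 p).
Proof.
move=> o1; elim: o1 w2 => [w2|w1' r1 t1 o1 IH E1 w2 o2].
  by rewrite (_ : (fun _ => _) = w2)//; apply/funext => p; rewrite add0r.
case: o2 => [|w2' r2 t2 o2 E2].
  rewrite (_ : (fun _ => _) = w1'); first exact: oscillating_step E1.
  by apply/funext => p; rewrite addr0.
apply: (@oscillating_step _ (fun p => r1 p + r2 p)); [exact: tame_add|exact: IH|] => p.
have D j w w' q : tame setT w -> tame setT w' ->
    dx j (fun p => w p + w' p) q = dx j w q + dx j w' q 
    by move=> tw tw'; exact: (tD_add _ _ tw tw').
have D2 j : dx j (dx j (fun p => w1' p + w2' p)) p = dx j (dx j w1') p + dx j (dx j w2') p.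
  rewrite -D; try exact: tame_derive.
  by congr (dx j _ p); apply/funext => q; exact: D.
rewrite (eq_bigr _ (fun j _ => D2 j)) big_split/= E1 E2.
by move: (w1' p) (w2' p) (r1 p) (r2 p) (dotp _ _) => a b d e f; clear; ring.
Qed.

(** A factor that depends on y only commutes with the Laplacian in x. *)
Lemma oscillating_mul g w : tame setT g -> (forall j p, dx j g p = 0) -> oscillating w ->
  oscillating (fun p => g p * w p).
Proof.
move=> tg g0; elim=> [|w' r t o IH E].
  by rewrite (_ : (fun _ => _) = fun=> 0); [exact: osc0|apply/funext => p; rewrite mulr0].
apply: (@oscillating_step _ (fun p => g p * r p)); [exact: tame_mul|exact: IH|] => p.
have D j v q : tame setT v -> dx j (fun p => g p * v p) q = g q * dx j v q.
  move=> tv; apply: etrans (tD_mul _ _ tg tv) _.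
  by have := g0 j q; rewrite /dx => ->; rewrite mul0r add0r.
have D2 j : dx j (dx j (fun p => g p * w' p)) p = g p * dx j (dx j w') p.
  rewrite -D; last exact: tame_derive.
  by congr (dx j _ p); apply/funext => q; exact: D.
rewrite (eq_bigr _ (fun j _ => D2 j)) -mulr_sumr E.
by move: (w' p) (g p) (r p) (dotp _ _) => a b d e; clear; ring.
Qed.

(** Differentiating the equation of w in y_j gives the remainder
    d r / dy_j - 2 c^2 y_j w, again oscillating. *)
Lemma oscillating_dy j w : oscillating w -> oscillating (dy j w).
Proof.
elim=> [|w' r t o IH E].
  by rewrite (_ : dy j _ = fun=> 0); [exact: osc0|apply/funext => p; exact: derive_cst].
have o' : oscillating w' by exact: oscillating_step E.
have or' : oscillating (fun p => dy j r p + (- (2 * c ^+ 2) * p.2 0 j) * w' p).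
  apply: oscillating_add => //; apply: oscillating_mul o'.
    by apply: tame_scale; exact: tame_right.
  move=> i p; apply: etrans (congr1 (@^~ p) (tame_scaleE _ _ (tame_right j))) _.
  by rewrite derive_right_coord mxE mulr0.
apply: oscillating_step or' _; first exact: tame_derive.
move=> p.
have tt i : tame setT (dx i (dx i w')) by do 2!apply: tame_derive.
have D i : dx i (dx i (dy j w')) p = dy j (dx i (dx i w')) p.
  have S1 : dx i (dy j w') = dy j (dx i w') by exact: tame_symmetric t.
  by rewrite S1; exact: (congr1 (@^~ p) (tame_symmetric _ _ (tame_derive _ t))).
rewrite (eq_bigr _ (fun i _ => D i)).
rewrite -[LHS](congr1 (@^~ p) (tame_sumE (index_enum 'I_n) (0 : X, delta_mx 0 j) tt)).
rewrite (funext E).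
have tq : tame setT (fun p : X2 => c ^+ 2 * dotp p.2 p.2) by apply: tame_scale; exact: tame_right_sqr.
have tqw := tame_mul tq t.
have tN : tame setT (fun p : X2 => - (c ^+ 2 * dotp p.2 p.2 * w' p)).
  rewrite (_ : (fun _ => _) = fun p : X2 => (-1) * (c ^+ 2 * dotp p.2 p.2 * w' p)).
    exact: tame_scale.
  by apply/funext => q; rewrite mulN1r.
rewrite (tD_add _ _ tN (oscillating_tame o)).
rewrite (_ : (fun p : X2 => - _) = fun p : X2 => (-1) * (c ^+ 2 * dotp p.2 p.2 * w' p)); last first.
  by apply/funext => q; rewrite mulN1r.
rewrite (congr1 (@^~ p) (tame_scaleE (-1) _ tqw)) (tD_mul _ _ tq t).
rewrite (congr1 (@^~ p) (tame_scaleE (c ^+ 2) _ tame_right_sqr)).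
have := derive_right_sqr j p; rewrite /dy => ->.
by move: (w' p) ('D__ w' p) ('D__ r p) (dotp _ _) (p.2 0 j) => a b d e f; clear; ring.
Qed.

(** The operator with kernel w sends Schwartz functions to rapidly decreasing ones,
    with control of the constants. *)
Definition decaying w := forall N, exists l d, 0 <= d /\ forall u K, schwartzr u -> schwartz_bound l u K ->
  forall y, (1 + `|y|) ^+ N * `|integral_op w u y| <= d * K.

Lemma weight_dotp (y : X) : 1 + `|y| <= 2 * (1 + dotp y y).
Proof.
have y2 : `|y| <= 1 + dotp y y.
  have d0 : 0 <= dotp y y by apply: sumr_ge0 => i _; rewrite -expr2 sqr_ge0.
  apply: row_norm_le => [|i]; first by rewrite addr_ge0.
  have yi : y 0 i * y 0 i <= dotp y y.
    by rewrite /dotp (bigD1 i)//= lerDl sumr_ge0// => j _; rewrite -expr2 sqr_ge0.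
  move: (y 0 i) (dotp y y) yi {d0} => a b ab.
  by rewrite ler_norml; apply/andP; split; nra.
have d0 : 0 <= dotp y y by apply: sumr_ge0 => i _; rewrite -expr2 sqr_ge0.
by move: (`|y|) (dotp y y) y2 d0 => a b; lra.
Qed.

(** Two integrations by parts move the Laplacian from the kernel to u, so that a factor
    |y|^2 is paid by two derivatives of u. *)
Lemma integral_op_helmholtz w r u y : tame setT w -> tame setT r ->
  (forall p, \sum_j dx j (dx j w) p = - (c ^+ 2 * dotp p.2 p.2 * w p) + r p) -> schwartzr u ->
  c ^+ 2 * dotp y y * integral_op w u y = integral_op r u y - \sum_j integral_op w (partials [:: j; j] u) y.
Proof.
move=> tw tr E su.
have nw := integral_op_nice y tw su; have nr := integral_op_nice y tr su.
have tt j : tame setT (dx j (dx j w)) by do 2!apply: tame_derive.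
have -> : \sum_j integral_op w (partials [:: j; j] u) y = \sum_j integral_op (dx j (dx j w)) u y.
  apply: eq_bigr => j _; rewrite integral_op_by_parts//; last exact: tame_derive.
  rewrite integral_op_by_parts ?opprK//; exact: (schwartzr_partials [:: j]).
rewrite -rn_int_sum; last by move=> j; exact: integral_op_nice.
have -> : (fun x => \sum_j dx j (dx j w) (x, y) * u x) =
    fun x => (- (c ^+ 2 * dotp y y)) * (w (x, y) * u x) + r (x, y) * u x.
  by apply/funext => x; rewrite -mulr_suml E/= mulrDl mulNr mulNr mulrA.
rewrite rn_int_add//; last exact: nice_scale.
by rewrite rn_int_scale// /integral_op mulNr opprD opprK addrC subrK.
Qed.

(** Starting from polynomial growth of some degree M, each use of
    [integral_op_helmholtz] gains a factor of the weight, at the price of two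
    derivatives of u and of an integral against the remainder, which decays by
    induction. After N + M steps the growth is compensated. *)
Lemma oscillating_decaying w : oscillating w -> decaying w.
Proof.
elim=> [N|w' r tw or' dr E].
  exists 0%N, 0; split=> // u K su uK y.
  rewrite mul0r /integral_op (_ : (fun _ => _) = fun x : X => 0 * 0).
    by rewrite (rn_int_scale _ (nice0 R n)) mul0r normr0 mulr0.
  by apply/funext => x; rewrite !mul0r.
have [M [l0 [d0 [d00 growth]]]] := integral_op_growth tw.
have step N : exists l d, 0 <= d /\ forall u K, schwartzr u -> schwartz_bound l u K ->
    forall y, (1 + `|y|) ^+ N * `|integral_op w' u y| <= d * K * (1 + `|y|) ^+ M.
  elim: N => [|N [l [d [dge0 IH]]]].
    exists l0, d0; split=> // u K su uK y; rewrite expr0 mul1r; exact: growth.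
  have [lr [d1 [d10 rP]]] := dr N.
  exists (maxn (l + 2) lr), (2 * (d + (c ^- 2) * (d1 + n%:R * d))).
  have ci : 0 <= (c ^- 2 : R) by rewrite invr_ge0 sqr_ge0.
  split; first by rewrite mulr_ge0// addr_ge0// mulr_ge0// addr_ge0// mulr_ge0.
  move=> u K su uK y.
  have K0 := schwartz_bound_ge0 uK.
  have w1 : 1 <= (1 + `|y|) ^+ M by rewrite exprn_ege1// weight_ge1.
  have wN : 0 <= (1 + `|y|) ^+ N by rewrite ltW// weight_gt0.
  have b1 : (1 + `|y|) ^+ N * `|integral_op w' u y| <= d * K * (1 + `|y|) ^+ M.
    by apply: IH => //; apply: schwartz_bound_mono uK; rewrite leq_max leq_addr.
  have b2 : (1 + `|y|) ^+ N * `|integral_op r u y| <= d1 * K * (1 + `|y|) ^+ M.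
    apply: le_trans (_ : d1 * K <= _); last by rewrite ler_peMr// mulr_ge0.
    by apply: rP => //; apply: schwartz_bound_mono uK; rewrite leq_maxr.
  have b3 j : (1 + `|y|) ^+ N * `|integral_op w' (partials [:: j; j] u) y| <= d * K * (1 + `|y|) ^+ M.
    apply: IH; first exact: schwartzr_partials.
    by apply: schwartz_bound_partials; apply: schwartz_bound_mono uK; rewrite leq_maxl.
  (* the equation solved for the factor |y|^2 *)
  have H : dotp y y * integral_op w' u y =
      (c ^- 2) * (integral_op r u y - \sum_j integral_op w' (partials [:: j; j] u) y).
    rewrite -(integral_op_helmholtz y tw (oscillating_tame or') E su) -(mulrA (c ^+ 2)) mulKf//.
    by rewrite expf_neq0.
  have H2 : (1 + dotp y y) * `|integral_op w' u y| <= `|integral_op w' u y| +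
      (c ^- 2) * (`|integral_op r u y| + \sum_j `|integral_op w' (partials [:: j; j] u) y|).
    rewrite mulrDl mul1r lerD2l.
    have dp : 0 <= dotp y y by apply: sumr_ge0 => i _; rewrite -expr2 sqr_ge0.
    rewrite -[X in X * _ <= _](ger0_norm dp) -normrM H normrM (ger0_norm ci) ler_wpM2l//.
    by apply: le_trans (ler_normB _ _) _; rewrite lerD2l ler_norm_sum.
  rewrite exprS.
  apply: (@le_trans _ _ (2 * ((1 + `|y|) ^+ N * ((1 + dotp y y) * `|integral_op w' u y|)))).
    rewrite -mulrA (mulrCA _ (1 + dotp y y)) (mulrA 2).
    by rewrite ler_wpM2r ?weight_dotp// mulr_ge0.
  rewrite -!mulrA ler_wpM2l//.
  apply: le_trans (ler_wpM2l wN H2) _.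
  rewrite mulrDr mulrDl lerD//; first by rewrite mulrA.
  rewrite mulrCA -mulrA ler_wpM2l// mulrDr mulrDl lerD//; first by rewrite mulrA.
  rewrite mulr_sumr; apply: (@le_trans _ _ (\sum_(j < n) d * K * (1 + `|y|) ^+ M)).
    by apply: ler_sum => j _; exact: b3.
  by rewrite sumr_const card_ord -[leLHS]mulr_natl !mulrA.
move=> N; have [l [d [d0' H]]] := step (N + M)%N.
exists l, d; split=> // u K su uK y.
have := H u K su uK y.
by rewrite exprD -mulrA mulrCA mulrC ler_pM2r// weight_gt0.
Qed.

(** Oscillating kernels are stable under derivatives in y and these pass under the
    integral, so they form a family in the sense of [op_family]. *)
Lemma oscillating_schwartz_op w : oscillating w -> schwartz_op (integral_op w).
Proof.
move=> ow; apply: (@op_family_schwartz_op _ _ (fun J => exists2 w, oscillating w & J = integral_op w)); last by exists w.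
split.
- move=> _ [v ov ->] N; have [l [d [_ H]]] := oscillating_decaying ov N.
  by exists l, d => u K su uK; exact: H.
- move=> _ [v ov ->] u x su; exact: (integral_op_differentiable x (oscillating_tame ov) su).1.
- move=> _ j [v ov ->]; exists (integral_op (dy j v)); first by exists (dy j v) => //; exact: oscillating_dy.
  by move=> u su; apply: partial_integral_op => //; exact: oscillating_tame.
Qed.

End Oscillating.

(** * Complex Schwartz functions through real coordinates *)

Section ComplexSchwartz.
Variables (R : realType) (m : nat).
Local Notation X := 'rV[R]_m.
Local Notation C := R[i].
Implicit Types (u : X -> R) (f : X -> C).

Lemma foldr_cpartial s f : foldr (@cpartial R m) f s =
  fun x => Complex (partials s (fun t => complex.Re (f t)) x) (partials s (fun t => complex.Im (f t)) x).
Proof.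
elim: s => [|j s IH] /=; first by apply/funext => x; case: (f x).
by rewrite IH.
Qed.

Lemma csmoothE f : csmooth f <->
  smooth (fun t => complex.Re (f t)) /\ smooth (fun t => complex.Im (f t)).
Proof.
split=> [sf|[s1 s2] s x].
  by split=> s x; have := sf s x; rewrite foldr_cpartial => -[].
by rewrite foldr_cpartial; split; [exact: s1|exact: s2].
Qed.

Lemma partial_comm i j u : (forall x, differentiable u x) ->
  (forall x, differentiable (partial i u) x) -> (forall x, differentiable (partial j u) x) ->
  partial i (partial j u) = partial j (partial i u).
Proof.
move=> du di dj; apply/funext => x; apply: derive_symmetric => //.
- by move=> v; exact: diff_derivable.
- by move=> v; exact: diff_derivable.
Qed.

(** A derivative that occurs in the list can be performed last. *)
Lemma partials_rem i s u : smooth u -> i \in s -> partials s u = partial i (partials (rem i s) u).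
Proof.
move=> du; elim: s => //= j s IH; case: (altP (j =P i)) => [->//|ji].
rewrite inE eq_sym (negPf ji)/= => /IH ->.
by exact: esym (partial_comm (du (rem i s)) (du (i :: rem i s)) (du (j :: rem i s))).
Qed.

Lemma partials_perm s t u : smooth u -> perm_eq s t -> partials s u = partials t u.
Proof.
move=> du; elim: s t => [|i s IH] t st.
  by have := perm_size st => /esym/size0nil ->.
have it : i \in t by rewrite -(perm_mem st) mem_head.
rewrite (partials_rem du it) /= (IH (rem i t))//.
by rewrite -(perm_cons i); apply: perm_trans st (perm_to_rem it).
Qed.

(** The list in which direction j occurs del j times, in increasing order. *)
Definition multi (del : 'I_m -> nat) : seq 'I_m := flatten [seq nseq (del j) j | j <- enum 'I_m].

Lemma mpartial_partials del f : mpartial del f = foldr (@cpartial R m) f (multi del).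
Proof.
rewrite /mpartial /multi; elim: (enum 'I_m) => //= j s ->.
by rewrite foldr_cat; elim: (del j) => //= k ->.
Qed.

Lemma count_multi del i : count_mem i (multi del) = del i.
Proof.
rewrite count_flatten -map_comp sumnE big_map big_enum/= (bigD1 i)//= big1 => [|j ji].
  by rewrite count_nseq/= eqxx mul1n addn0.
by rewrite count_nseq/= (negPf ji).
Qed.

Lemma perm_multi s : perm_eq s (multi (fun j => count_mem j s)).
Proof. by rewrite /perm_eq; apply/allP => i _ /=; rewrite count_multi. Qed.

Lemma normc_re (z : C) : `|complex.Re z| <= Normc.normc z.
Proof.
case: z => a b /=; rewrite -sqrtr_sqr ler_wsqrtr//.
by rewrite lerDl sqr_ge0.
Qed.

Lemma normc_im (z : C) : `|complex.Im z| <= Normc.normc z.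
Proof.
case: z => a b /=; rewrite -sqrtr_sqr ler_wsqrtr//.
by rewrite lerDr sqr_ge0.
Qed.

Lemma normc_le (z : C) : Normc.normc z <= `|complex.Re z| + `|complex.Im z|.
Proof.
case: z => a b /=; have h : 0 <= `|a| + `|b| by rewrite addr_ge0.
rewrite -[leRHS](ger0_norm h) -sqrtr_sqr ler_wsqrtr// sqrrD !real_normK ?num_real//.
by rewrite addrAC lerDl mulrn_wge0// mulr_ge0.
Qed.

Lemma reMreal (a : R) (z : C) : complex.Re (a%:C%C * z) = a * complex.Re z.
Proof. by case: z => p q /=; rewrite mul0r subr0. Qed.

Lemma imMreal (a : R) (z : C) : complex.Im (a%:C%C * z) = a * complex.Im z.
Proof. by case: z => p q /=; rewrite mul0r addr0. Qed.

(** A monomial of degree at most N is dominated by the weight (1 + |x|)^N. *)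
Lemma seminorm_le gam del f N K L : (size (multi del) <= N)%N -> (\sum_j gam j <= N)%N ->
  schwartz_bound N (fun x => complex.Re (f x)) K -> schwartz_bound N (fun x => complex.Im (f x)) L ->
  (seminorm gam del f <= (K + L)%:E)%E.
Proof.
move=> sN gN fK fL; apply: ge_ereal_sup => _ [x _ <-].
rewrite lee_fin mpartial_partials foldr_cpartial.
apply: le_trans (normc_le _) _; rewrite reMreal imMreal !normrM.
have w : `|\prod_j x 0 j ^+ gam j| <= (1 + `|x|) ^+ N.
  apply: (@le_trans _ _ ((1 + `|x|) ^+ (\sum_j gam j))); last first.
    by rewrite ler_weXn2l ?weight_ge1.
  rewrite normr_prod expr_sum; apply: ler_prod => j _; rewrite normr_ge0/= normrX.
  rewrite lerXn2r ?nnegrE ?addr_ge0//; apply: le_trans (coord_le_norm x j) _.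
  by rewrite lerDr.
apply: lerD; [apply: le_trans (fK _ sN x)|apply: le_trans (fL _ sN x)];
  by rewrite ler_wpM2r.
Qed.

(** The exponents of the monomials 1 and x_j^N, which suffice to recover the weight. *)
Definition power_at (N : nat) (o : option 'I_m) (i : 'I_m) : nat :=
  if o is Some j then (if i == j then N else 0%N) else 0%N.

(** The norm is the maximum of the coordinates, so the weight is dominated by 2^N when
    |x| <= 1 and by 2^N |x_j|^N for a maximal coordinate otherwise. *)
Lemma power_weight (N : nat) (x : X) (p d : R) : 0 <= p ->
  (forall o, `|\prod_j x 0 j ^+ power_at N o j| * p <= d) ->
  (1 + `|x|) ^+ N * p <= 2 ^+ N * d.
Proof.
move=> p0 H.
have H0 : p <= d.
  by have := H None; rewrite big1 => [|i _]; rewrite ?expr0 ?normr1 ?mul1r.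
have [x1|x1] := leP `|x| 1.
  have w0 : 0 <= (1 + `|x|) ^+ N by rewrite ltW// weight_gt0.
  apply: (ler_pM w0 p0 _ H0).
  by rewrite lerXn2r ?nnegrE ?addr_ge0//; move: x1; move: `|x| => a; lra.
have [[i j] xj] : exists ij, `|x| = `|x ij.1 ij.2|.
  by apply: mx_norm_neq0; apply/eqP => x0; move: x1; rewrite (x0 : `|x| = 0) ltr10.
have {}xj : `|x| = `|x 0 j| by rewrite xj /= (ord1 i).
have Hj := H (Some j).
have E : \prod_i x 0 i ^+ power_at N (Some j) i = x 0 j ^+ N.
  rewrite (bigD1 j)//= eqxx big1 ?mulr1// => i0 ij.
  by rewrite (negPf ij) expr0.
rewrite E normrX -xj in Hj.
apply: (@le_trans _ _ ((2 * `|x|) ^+ N * p)).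
  rewrite ler_wpM2r// lerXn2r ?nnegrE ?addr_ge0 ?mulr_ge0//.
  by move: x1; move: `|x| => a; lra.
by rewrite exprMn -mulrA ler_wpM2l// exprn_ge0.
Qed.

(** Derivatives of order at most N depend only on the multiplicities of the directions,
    so finitely many seminorms control the norm of index N. *)
Lemma schwartz_bound_seminorm f N (d : R) : csmooth f ->
  (forall (o : option 'I_m) (e : {ffun 'I_m -> 'I_N.+1}),
    (seminorm (power_at N o) (fun j => e j) f <= d%:E)%E) ->
  schwartz_bound N (fun x => complex.Re (f x)) (2 ^+ N * d) /\
  schwartz_bound N (fun x => complex.Im (f x)) (2 ^+ N * d).
Proof.
move=> /csmoothE[s1 s2] H.
have key s (x : X) o : (size s <= N)%N ->
    `|\prod_j x 0 j ^+ power_at N o j| * `|partials s (fun t => complex.Re (f t)) x| <= d /\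
    `|\prod_j x 0 j ^+ power_at N o j| * `|partials s (fun t => complex.Im (f t)) x| <= d.
  move=> sN; pose e : {ffun 'I_m -> 'I_N.+1} := [ffun j => inord (count_mem j s)].
  have eE : (fun j => e j : nat) = fun j => count_mem j s.
    apply/funext => j; rewrite ffunE inordK// ltnS; apply: leq_trans sN.
    exact: count_size.
  have := le_trans (seminorm_ge (power_at N o) (fun j => e j) f x) (H o e).
  rewrite lee_fin eE mpartial_partials foldr_cpartial => H'.
  rewrite -!normrM (partials_perm s1 (perm_multi s)) (partials_perm s2 (perm_multi s)).
  split; [apply: le_trans H'; apply: le_trans (normc_re _)|
    apply: le_trans H'; apply: le_trans (normc_im _)].
    by rewrite reMreal.
  by rewrite imMreal.
by split=> s sN x; apply: power_weight => // o; have [] := key s x o sN.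
Qed.

Lemma is_schwartzE f : is_schwartz f <->
  schwartzr (fun t => complex.Re (f t)) /\ schwartzr (fun t => complex.Im (f t)).
Proof.
split=> [[sf bf]|[[s1 b1] [s2 b2]]].
  have [s1 s2] := (csmoothE f).1 sf.
  suff H k : exists K, schwartz_bound k (fun t => complex.Re (f t)) K /\ schwartz_bound k (fun t => complex.Im (f t)) K.
    by split; split=> // k; have [K []] := H k; exists K.
  pose a (oe : option 'I_m * {ffun 'I_m -> 'I_k.+1}) :=
    fine (seminorm (power_at k oe.1) (fun j => oe.2 j) f).
  have se (oe : option 'I_m * {ffun 'I_m -> 'I_k.+1}) :
      seminorm (power_at k oe.1) (fun j => oe.2 j) f = (a oe)%:E.
    rewrite /a fineK// ge0_fin_numE//; apply: le_trans (seminorm_ge _ _ _ 0).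
    by rewrite lee_fin; case: (_ * _) => ? ?; rewrite sqrtr_ge0.
  exists (2 ^+ k * \sum_oe `|a oe|); apply: schwartz_bound_seminorm => // o e.
  rewrite (se (o, e)) lee_fin (bigD1 (o, e))//=; apply: le_trans (ler_norm _) _.
  by rewrite lerDl sumr_ge0.
split; first exact/csmoothE.
move=> gam del; set N := maxn (size (multi del)) (\sum_j gam j).
have [K fK] := b1 N; have [L fL] := b2 N.
by apply: le_lt_trans (seminorm_le _ _ fK fL) (ltry _); rewrite ?leq_maxl ?leq_maxr.
Qed.

End ComplexSchwartz.

(** * Complex-valued Schwartz maps *)

Section ComplexOperators.
Variables (R : realType) (m : nat).
Local Notation X := 'rV[R]_m.
Local Notation X2 := (X * X)%type.
Local Notation C := R[i].
Local Notation S := (schwartz R m).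
Local Notation re := (@complex.Re R).
Local Notation im := (@complex.Im R).
Implicit Types (f : S) (g : X -> C) (W : X2 -> C) (K : R).

Definition schwartz_bounds N f K := forall A, schwartz_bound N (fun x => re (f x A)) K /\ schwartz_bound N (fun x => im (f x A)) K.

Lemma schwartz_bounds_mono k l f K : (k <= l)%N -> schwartz_bounds l f K -> schwartz_bounds k f K.
Proof. by move=> kl fK A; have [] := fK A; split; apply: schwartz_bound_mono kl _. Qed.

(** A map into real Schwartz functions whose norms are controlled by those of its
    argument; maps are assembled from real coordinates with sums and operators. *)
Definition schwartz_map (Phi : S -> X -> R) := (forall f, schwartzr (Phi f)) /\
  forall k, exists l (c : R), forall f K, schwartz_bounds l f K -> schwartz_bound k (Phi f) (c * K).

Lemma schwartz_map_ext Phi Psi : (forall f x, Phi f x = Psi f x) -> schwartz_map Phi -> schwartz_map Psi.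
Proof.
by move=> E; have -> : Phi = Psi by apply/funext => f; apply/funext => x; exact: E.
Qed.

Lemma schwartz_map_schwartz_op J Phi : schwartz_op J -> schwartz_map Phi -> schwartz_map (fun f => J (Phi f)).
Proof.
move=> sJ [sP bP]; split=> [f|k]; first exact: schwartz_op_schwartzr.
have [l1 [c1 H1]] := sJ.2 k; have [l2 [c2 H2]] := bP l1.
exists l2, (c1 * c2) => f K fK; rewrite -mulrA.
by apply: H1 => //; exact: H2.
Qed.

Lemma schwartzr_add (u v : X -> R) : schwartzr u -> schwartzr v -> schwartzr (fun x => u x + v x).
Proof.
move=> [su bu] [sv bv]; split; first exact: smooth_add.
by move=> k; have [K uK] := bu k; have [L vL] := bv k; exists (K + L); exact: schwartz_bound_add.
Qed.

Lemma schwartz_map_add Phi Psi : schwartz_map Phi -> schwartz_map Psi -> schwartz_map (fun f x => Phi f x + Psi f x).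
Proof.
move=> [s1 b1] [s2 b2]; split=> [f|k]; first exact: schwartzr_add.
have [l1 [c1 H1]] := b1 k; have [l2 [c2 H2]] := b2 k.
exists (maxn l1 l2), (c1 + c2) => f K fK; rewrite mulrDl.
apply: schwartz_bound_add; [exact: (s1 f).1|exact: (s2 f).1|apply: H1|apply: H2].
  by apply: schwartz_bounds_mono fK; exact: leq_maxl.
by apply: schwartz_bounds_mono fK; exact: leq_maxr.
Qed.

Lemma schwartz_map_mul (g : X -> R) Phi : tame setT g -> schwartz_map Phi -> schwartz_map (fun f x => g x * Phi f x).
Proof. by move=> tg tP; exact: (schwartz_map_schwartz_op (schwartz_op_mul tg) tP). Qed.

Definition cschwartz_map (Phi : S -> X -> C) :=
  schwartz_map (fun f x => re (Phi f x)) /\ schwartz_map (fun f x => im (Phi f x)).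

Lemma cschwartz_map_coord A : cschwartz_map (fun f x => f x A).
Proof.
have sf f : schwartzr (fun x => re (f x A)) /\ schwartzr (fun x => im (f x A)).
  by apply/is_schwartzE; have /asboolP := schwartzP f; exact.
split; split=> [f|k]; try by have [] := sf f.
  by exists k, 1 => f K fK; rewrite mul1r; have [] := fK A.
by exists k, 1 => f K fK; rewrite mul1r; have [] := fK A.
Qed.

Lemma cschwartz_map_add Phi Psi : cschwartz_map Phi -> cschwartz_map Psi -> cschwartz_map (fun f x => Phi f x + Psi f x).
Proof.
move=> [p1 p2] [q1 q2]; split.
  by apply: schwartz_map_ext (schwartz_map_add p1 q1) => f x; rewrite ReD.
by apply: schwartz_map_ext (schwartz_map_add p2 q2) => f x; rewrite ImD.
Qed.

Lemma cschwartz_map_mul g Phi : ctame setT g -> cschwartz_map Phi -> cschwartz_map (fun f x => g x * Phi f x).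
Proof.
move=> [tr ti] [pr pi]; split.
  have tN := tame_scale (-1) ti.
  apply: schwartz_map_ext (schwartz_map_add (schwartz_map_mul tr pr) (schwartz_map_mul tN pi)) => f x.
  by rewrite ReM mulN1r mulNr.
apply: schwartz_map_ext (schwartz_map_add (schwartz_map_mul tr pi) (schwartz_map_mul ti pr)) => f x.
by rewrite ImM.
Qed.

Lemma cschwartz_map_sum (I : Type) (r : seq I) (Phi : I -> S -> X -> C) :
  (forall i, cschwartz_map (Phi i)) -> cschwartz_map (fun f x => \sum_(i <- r) Phi i f x).
Proof.
move=> tP; elim: r => [|i r IH].
  have := cschwartz_map_mul (ctame_cst setT 0) (cschwartz_map_coord finset.set0).
  by congr cschwartz_map; apply/funext => f; apply/funext => x; rewrite big_nil mul0r.
have := cschwartz_map_add (tP i) IH.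
by congr cschwartz_map; apply/funext => f; apply/funext => x; rewrite big_cons.
Qed.

Definition crn_int g : C := Complex (rn_int (fun x => re (g x))) (rn_int (fun x => im (g x))).
Definition cnice g := nice (fun x => re (g x)) /\ nice (fun x => im (g x)).

Lemma nice_ext (g h : X -> R) : (forall x, g x = h x) -> nice g -> nice h.
Proof. by move=> E; rewrite (funext E). Qed.

Lemma cnice_add g h : cnice g -> cnice h -> cnice (fun x => g x + h x).
Proof.
move=> [g1 g2] [h1 h2]; split.
  by apply: nice_ext (nice_add g1 h1) => x; rewrite ReD.
by apply: nice_ext (nice_add g2 h2) => x; rewrite ImD.
Qed.

Lemma cnice_scale a g : cnice g -> cnice (fun x => a * g x).
Proof.
move=> [g1 g2]; split.
  by apply: nice_ext (nice_add (nice_scale (re a) g1) (nice_scale (- im a) g2)) => x; rewrite ReM mulNr.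
by apply: nice_ext (nice_add (nice_scale (re a) g2) (nice_scale (im a) g1)) => x; rewrite ImM.
Qed.

Lemma crn_int_add g h : cnice g -> cnice h -> crn_int (fun x => g x + h x) = crn_int g + crn_int h.
Proof.
move=> [g1 g2] [h1 h2]; apply/eqP; rewrite eq_complex; apply/andP; split; apply/eqP => /=.
  by rewrite -rn_int_add//; congr rn_int; apply/funext => x; rewrite ReD.
by rewrite -rn_int_add//; congr rn_int; apply/funext => x; rewrite ImD.
Qed.

Lemma crn_int_scale a g : cnice g -> crn_int (fun x => a * g x) = a * crn_int g.
Proof.
move=> [g1 g2]; apply/eqP; rewrite eq_complex ReM ImM; apply/andP; split; apply/eqP => /=.
  rewrite -mulNr -!rn_int_scale// -rn_int_add; try exact: nice_scale.
  by congr rn_int; apply/funext => x; rewrite ReM mulNr.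
rewrite -!rn_int_scale// -rn_int_add; try exact: nice_scale.
by congr rn_int; apply/funext => x; rewrite ImM.
Qed.

Lemma cnice0 : cnice (fun=> 0).
Proof. by split; exact: nice0. Qed.

Lemma cnice_sum (I : Type) (r : seq I) (g : I -> X -> C) : (forall i, cnice (g i)) ->
  cnice (fun x => \sum_(i <- r) g i x).
Proof.
move=> ng; elim: r => [|i r IH].
  have := cnice0; by congr cnice; apply/funext => x; rewrite big_nil.
have := cnice_add (ng i) IH.
by congr cnice; apply/funext => x; rewrite big_cons.
Qed.

Lemma crn_int_sum (I : Type) (r : seq I) (g : I -> X -> C) : (forall i, cnice (g i)) ->
  crn_int (fun x => \sum_(i <- r) g i x) = \sum_(i <- r) crn_int (g i).
Proof.
move=> ng; elim: r => [|i r IH].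
  rewrite big_nil (_ : (fun _ => _) = fun x : X => 0 * 0); last first.
    by apply/funext => x; rewrite big_nil mulr0.
  by rewrite (crn_int_scale _ cnice0) mul0r.
rewrite big_cons -IH -crn_int_add//; last exact: cnice_sum.
by congr crn_int; apply/funext => x; rewrite big_cons.
Qed.

Definition cintegral_op W g (y : X) : C := crn_int (fun x => W (x, y) * g x).

Lemma cintegral_op_nice W g y : ctame setT W -> schwartzr (fun x => re (g x)) -> schwartzr (fun x => im (g x)) ->
  cnice (fun x => W (x, y) * g x).
Proof.
move=> [w1 w2] g1 g2; split.
  apply: nice_ext (nice_add (integral_op_nice y w1 g1) (nice_scale (-1) (integral_op_nice y w2 g2))) => x.
  by rewrite ReM mulN1r.
apply: nice_ext (nice_add (integral_op_nice y w1 g2) (integral_op_nice y w2 g1)) => x.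
by rewrite ImM.
Qed.

Lemma cschwartz_map_integral_op (c : R) W Phi : c != 0 -> oscillating c (fun p => re (W p)) -> oscillating c (fun p => im (W p)) ->
  cschwartz_map Phi -> cschwartz_map (fun f => cintegral_op W (Phi f)).
Proof.
move=> c0 w1 w2 [p1 p2]; have s1 := oscillating_schwartz_op c0 w1; have s2 := oscillating_schwartz_op c0 w2.
have t1 := oscillating_tame w1; have t2 := oscillating_tame w2.
split.
  apply: schwartz_map_ext (schwartz_map_add (schwartz_map_schwartz_op s1 p1) (schwartz_map_mul (tame_cst setT (-1)) (schwartz_map_schwartz_op s2 p2))) => f y.
  have n1 := integral_op_nice y t1 (p1.1 f); have n2 := integral_op_nice y t2 (p2.1 f).
  rewrite /integral_op /cintegral_op /= -rn_int_scale// -rn_int_add//; last exact: nice_scale.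
  by congr rn_int; apply/funext => x; rewrite ReM mulN1r.
apply: schwartz_map_ext (schwartz_map_add (schwartz_map_schwartz_op s1 p2) (schwartz_map_schwartz_op s2 p1)) => f y.
have n1 := integral_op_nice y t1 (p2.1 f); have n2 := integral_op_nice y t2 (p1.1 f).
rewrite /integral_op /cintegral_op /= -rn_int_add//.
by congr rn_int; apply/funext => x; rewrite ImM.
Qed.

End ComplexOperators.

(** * Continuity criterion on Clifford-valued Schwartz functions *)

Section Continuity.
Variables (R : realType) (m : nat).
Local Notation X := 'rV[R]_m.
Local Notation C := R[i].
Local Notation Cl := (clifford R[i] m).
Local Notation S := (schwartz R m).
Local Notation re := (@complex.Re R).
Local Notation im := (@complex.Im R).
Implicit Types (f g : S).

Lemma schwartz_open (B : set S) : @schwartz_subbase R m B -> open B.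
Proof.
move=> sB; exists [set B]; last by rewrite bigcup_set1.
move=> _ ->; exists (fset1 B); first by move=> D /fset1P ->; apply: mem_set.
by rewrite set_fset1 bigcap_set1.
Qed.

(** A basic neighbourhood is a finite intersection of sets of the subbase. *)
Lemma schwartz_continuous_at (h : S -> S) f :
  (forall B, @schwartz_subbase R m B -> B (h f) -> nbhs f (h @^-1` B)) ->
  {for f, continuous h}.
Proof.
move=> H U; rewrite {1}nbhsE => -[V [[I' sI <-] [W IW Wf]] VU].
have [D sD DW] := sI _ IW; rewrite -DW in Wf.
have nD : nbhs f (\bigcap_(B in [set` D]) (h @^-1` B)).
  by apply: filter_bigI => B BD; apply: H; [exact: set_mem (sD B BD)|exact: Wf].
apply: filterS nD => g gD; apply: VU; exists W => //.
by rewrite -DW; exact: gD.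
Qed.

Lemma schwartz_subE f g x : (g - f) x = g x - f x.
Proof. by []. Qed.

Lemma schwartz_csmooth f A : csmooth (fun x => f x A).
Proof. by have /asboolP/(_ A)[] := schwartzP f. Qed.

Lemma seminorm_triangle gam del (h1 h2 : X -> C) : csmooth h1 -> csmooth h2 ->
  (seminorm gam del (fun x => (h1 x + h2 x)%R) <= seminorm gam del h1 + seminorm gam del h2)%E.
Proof.
move=> s1 s2; apply: ge_ereal_sup => _ [x _ <-].
have -> : (fun x => h1 x + h2 x) = fun x => 1 * h1 x + h2 x.
  by apply/funext => z; rewrite mul1r.
rewrite mpartial_partials foldr_cpartialP// -!mpartial_partials mul1r mulrDr.
apply: le_trans (leeD (seminorm_ge gam del h1 x) (seminorm_ge gam del h2 x)).
by rewrite -EFinD lee_fin le_normcD.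
Qed.

(** The ball centered at f itself belongs to the subbase. *)
Lemma ball_nbhs f gam del A (d : R) : 0 < d ->
  nbhs f [set g : S | (seminorm gam del (fun x => ((g x - f x) A)%R) < d%:E)%E].
Proof.
move=> d0; apply: open_nbhs_nbhs; split.
  by apply: schwartz_open; exists gam, del, A, f, d.
rewrite /= (_ : (fun x => _) = fun=> 0); last first.
  by apply/funext => x; rewrite subrr ffunE.
apply: le_lt_trans (_ : (_ <= 0)%E) _; last by rewrite lte_fin.
apply: ge_ereal_sup => _ [x _ <-]; rewrite lee_fin.
have E s : foldr (@cpartial R m) (fun=> 0) s = fun=> 0.
  elim: s => //= j s ->; apply/funext => z.
  by rewrite /cpartial /reim/= !derive_cst.
by rewrite mpartial_partials E mulr0 /= expr0n /= addr0 sqrtr0.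
Qed.

(** A norm of the scale is controlled by finitely many seminorms, so its balls are
    neighbourhoods. *)
Lemma schwartz_bounds_nbhs f N (d : R) : 0 < d -> nbhs f [set g : S | schwartz_bounds N (g - f) (2 ^+ N * d)].
Proof.
move=> d0.
pose I := (option 'I_m * {ffun 'I_m -> 'I_N.+1} * {set 'I_m})%type.
pose B (i : I) := [set g : S | (seminorm (power_at N i.1.1) (fun j => i.1.2 j)
  (fun x => ((g x - f x) i.2)%R) < d%:E)%E].
have H : nbhs f [set g : S | forall i, B i g].
  have Bf i : nbhs f (B i) by exact: ball_nbhs.
  exact: (@filter_forall _ I B (nbhs f) _ Bf).
apply: filterS H => g Bg A; apply: schwartz_bound_seminorm; first exact: (schwartz_csmooth (g - f)).
by move=> o e; exact: ltW (Bg (o, e, A)).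
Qed.

(** By linearity the image of g differs from that of f by the image of g - f, whose
    seminorms are small when g lies in a ball of the scale of norms around f. *)
Lemma coord_bound_continuous (F : {linear S -> S}) :
  (forall A, cschwartz_map (fun f x => F f x A)) -> continuous F.
Proof.
move=> tF f; apply: schwartz_continuous_at => B [gam [del [A [G [e ->]]]]] /= fB.
set N := maxn (size (multi del)) (\sum_j gam j).
have [[s1 b1] [s2 b2]] := tF A.
have [l1 [c1 H1]] := b1 N; have [l2 [c2 H2]] := b2 N.
pose a := fine (seminorm gam del (fun x => ((F f x - G x) A)%R)).
have aE : seminorm gam del (fun x => (F f x - G x) A) = a%:E.
  rewrite /a fineK// ge0_fin_numE; first exact: lt_trans fB (ltry _).
  apply: le_trans (seminorm_ge _ _ _ 0).
  by rewrite lee_fin; case: (_ * _) => ? ?; rewrite sqrtr_ge0.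
have ae : 0 < e - a by move: fB; rewrite aE lte_fin subr_gt0.
pose l := maxn l1 l2.
pose c := (`|c1| + `|c2| + 1) * 2 ^+ l.
have c0 : 0 < c by rewrite mulr_gt0 ?exprn_gt0// ltr_wpDl// addr_ge0.
(* the ball of radius e - a around the image of f stays in the given ball *)
pose d := (e - a) / c / 2.
have d0 : 0 < d by rewrite !divr_gt0.
apply: filterS (schwartz_bounds_nbhs f l d0) => g gf /=.
have K0 : 0 <= 2 ^+ l * d by rewrite mulr_ge0// ?exprn_ge0// ltW.
have n1 : schwartz_bound N (fun x => re (F (g - f) x A)) (c1 * (2 ^+ l * d)).
  by apply: H1; apply: schwartz_bounds_mono gf; exact: leq_maxl.
have n2 : schwartz_bound N (fun x => im (F (g - f) x A)) (c2 * (2 ^+ l * d)).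
  by apply: H2; apply: schwartz_bounds_mono gf; exact: leq_maxr.
have sm := seminorm_le (leq_maxl _ _) (leq_maxr _ _) n1 n2.
have cd : c1 * (2 ^+ l * d) + c2 * (2 ^+ l * d) < e - a.
  apply: (@le_lt_trans _ _ (c * d)).
    rewrite -mulrDl /c -mulrA ler_wpM2r// -[leLHS]addr0 lerD// lerD//; exact: ler_norm.
  rewrite /d mulrC mulrAC divfK ?gt_eqF//.
  by rewrite ltr_pdivrMr// ltr_pMr// ltr1n.
have -> : (fun x => (F g x - G x) A) = fun x => F (g - f) x A + (F f x - G x) A.
  apply/funext => x; rewrite linearB schwartz_subE.
  by move: (F g x) (F f x) (G x) => p q r; rewrite !ffunE; ring.
apply: le_lt_trans (seminorm_triangle _ _ (schwartz_csmooth _ A) (schwartz_csmooth (F f - G) A)) _.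
rewrite aE; apply: (@le_lt_trans _ _ ((c1 * (2 ^+ l * d) + c2 * (2 ^+ l * d))%:E + a%:E)%E).
  by rewrite leeD2r.
by rewrite -EFinD lte_fin -ltrBrDr.
Qed.

Lemma continuous_operator (T : S -> X -> Cl) :
  (forall A, cschwartz_map (fun f x => T f x A)) ->
  (forall a f g x, T (a *: f + g) x = a *: T f x + T g x) ->
  exists2 F : {linear S -> S}, continuous F & forall f, F f = T f :> (X -> Cl).
Proof.
move=> tT linT.
have TP f : T f \in @schwartz_pred R m.
  apply/asboolP => A; apply/is_schwartzE.
  by have [[s1 _] [s2 _]] := tT A.
pose F0 f : S := Schwartz (TP f).
have linF : linear F0.
  by move=> a f g; apply: val_inj; apply/funext => x; exact: linT.
pose F : {linear S -> S} := HB.pack F0 (GRing.isLinear.Build _ _ _ _ F0 linF).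
exists F => //; exact: (@coord_bound_continuous F).
Qed.

End Continuity.

(** * The fractional Clifford-Fourier transform *)

Section Kernel.
Variables (R : realType) (m k : nat) (alpha beta : R).
Hypothesis mE : m = (2 * k + 2)%N.
Hypothesis sin0 : sin alpha != 0.
Local Notation X := 'rV[R]_m.
Local Notation X2 := (X * X)%type.
Local Notation C := R[i].
Local Notation Cl := (clifford R[i] m).
Local Notation S := (schwartz R m).
Local Notation E := (X * X * R)%type.

Let c : R := - (sin alpha)^-1.
Let kappa : R := 2^-1 * (cos alpha / sin alpha).

Lemma freq_neq0 : c != 0.
Proof. by rewrite /c oppr_eq0 invr_eq0. Qed.

(** The frequency c = - 1 / sin alpha matches the exponent of the kernel. *)
Lemma plane_wave_wave (x : X) : plane_wave alpha x = fun y : X => wave c k (x, y, 0).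
Proof.
apply/funext => y; rewrite (wave_init k freq_neq0) /plane_wave /c.
by congr (expi _ *: _); rewrite mulNr mulrC.
Qed.

Lemma exp_Gamma_limits (x y : X) A :
  (fun n => complex.Re (exp_Gamma_series beta (plane_wave alpha x) y n A)) @ \oo -->
    complex.Re (wave c k (x, y, beta) A) /\
  (fun n => complex.Im (exp_Gamma_series beta (plane_wave alpha x) y n A)) @ \oo -->
    complex.Im (wave c k (x, y, beta) A).
Proof.
rewrite plane_wave_wave.
apply: exp_Gamma_cvg; first exact: cltame_wave.
by move=> v; have H := wave_pde c mE v; exact: H.
Qed.

Lemma exp_Gamma_wave (x y : X) : exp_Gamma beta (plane_wave alpha x) y = wave c k (x, y, beta).
Proof.
apply/ffunP => A; have [l1 l2] := exp_Gamma_limits x y A.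
rewrite ffunE /reim; apply/eqP; rewrite eq_complex; apply/andP; split; apply/eqP => /=.
  exact: cvg_lim l1.
exact: cvg_lim l2.
Qed.

(** The coordinates of the wave at time beta, as kernels in (x, y). *)
Definition frozen_wave (A : {set 'I_m}) (p : X2) : C := wave c k (p.1, p.2, beta) A.

Let at_beta (p : X2) : E := (p.1, p.2, beta).

Lemma frozen_wave_tame A : ctame setT (frozen_wave A).
Proof.
apply: (@ctame_subst _ _ _ setT setT at_beta (fun v => wave c k v A)) => //.
  move=> l linl cl.
  have El (p : X2) : l (at_beta p) = l (p, 0) + l (0, beta).
    rewrite -[X in X + _]mul1r -linl; congr l; apply: pair_ext => /=.
      by rewrite scale1r addr0; case: p.
    by rewrite scaler0 add0r.
  rewrite (funext El); apply: tame_add; last exact: tame_cst.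
  apply: tame_lin => [a u v|p].
    by rewrite -linl; congr l; apply: pair_ext => //=; rewrite scaler0 addr0.
  have cp : {for p, continuous (fun p : X2 => (p, 0 : R))}.
    exact: (cvg_pair (@cvg_id _ (nbhs p)) (cvg_cst (0 : R))).
  exact: (continuous_comp cp (cl (p, 0))).
exact: cltame_wave.
Qed.

Lemma dx_at_beta (f : E -> R) j p : dx j (fun p => f (at_beta p)) p = 'D_(ex R j) f (at_beta p).
Proof.
apply: (@derive_slice _ _ _ at_beta (delta_mx 0 j, 0 : X) (ex R j) f p) => h z.
by apply: pair_ext => /=; [apply: pair_ext|rewrite scaler0 add0r].
Qed.

(** Freezing the time keeps the Helmholtz equation, with no remainder. *)
Lemma oscillating_at_beta (f : E -> R) : tame setT (fun p => f (at_beta p)) ->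
  (forall v, \sum_j 'D_(ex R j) ('D_(ex R j) f) v = - (c ^+ 2 * dotp v.1.2 v.1.2 * f v)) ->
  oscillating c (fun p => f (at_beta p)).
Proof.
move=> tf H; apply: oscillating_step tf (osc0 _ _) _ => p.
rewrite addr0 -(H (at_beta p)); apply: eq_bigr => j _.
by rewrite -dx_at_beta; congr (dx j _ p); apply/funext => q; exact: dx_at_beta.
Qed.

Lemma frozen_wave_oscillating A : oscillating c (fun p => complex.Re (frozen_wave A p)) /\
  oscillating c (fun p => complex.Im (frozen_wave A p)).
Proof.
have [t1 t2] := frozen_wave_tame A.
split.
  apply: (@oscillating_at_beta (fun v => complex.Re (wave c k v A)) t1) => v.
  exact: wave_helmholtz_re freq_neq0 mE A v.
apply: (@oscillating_at_beta (fun v => complex.Im (wave c k v A)) t2) => v.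
exact: wave_helmholtz_im freq_neq0 mE A v.
Qed.

Lemma expiD (a b : R) : expi (a + b) = expi a * expi b.
Proof. by rewrite /expi cosD sinD; congr Complex; rewrite addrC. Qed.

Lemma clME (a b : Cl) D : (a * b) D =
  \sum_(A : {set 'I_m}) (-1) ^+ swaps A (symdiff A D) * (a A * b (symdiff A D)).
Proof. by rewrite [LHS]ffunE. Qed.

(** The quadratic exponential of the kernel separates into one such factor in x and one
    in y. *)
Definition chirp (y : X) : C := expi (kappa * dotp y y).

Lemma chirp_tame : ctame setT chirp.
Proof.
apply: ctame_expi; apply: tame_scale; apply: tame_sum => j.
by apply: tame_mul; exact: tame_coord.
Qed.

Definition chirped A (f : S) (x : X) : C := chirp x * f x A.

Lemma chirped_cschwartz_map A : cschwartz_map (chirped A).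
Proof. by apply: cschwartz_map_mul; [exact: chirp_tame|exact: cschwartz_map_coord]. Qed.

(** The product rule of the Clifford algebra, with the quadratic exponential split. *)
Lemma kernel_coord (f : S) (x y : X) D : (cf_kernel alpha beta x y * f x) D =
  \sum_(A : {set 'I_m}) (chirp y * (-1) ^+ swaps A (symdiff A D)) *
    (frozen_wave A (x, y) * chirped (symdiff A D) f x).
Proof.
rewrite clME; apply: eq_bigr => A _.
rewrite /cf_kernel exp_Gamma_wave mulrDr expiD -/kappa -/(chirp x) -/(chirp y).
rewrite /chirped /frozen_wave /=.
have -> : ((chirp x * chirp y) *: wave c k (x, y, beta)) A =
    chirp x * chirp y * wave c k (x, y, beta) A.
  by move: (wave c k (x, y, beta)) (chirp x * chirp y) => u a; rewrite ffunE.
move: (wave c k (x, y, beta) A) (chirp x) (chirp y) (f x (symdiff A D)) (_ ^+ _) => a b d e s.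
by clear; ring.
Qed.

Lemma frozen_nice A (f : S) (y : X) B : cnice (fun x => frozen_wave A (x, y) * chirped B f x).
Proof.
have [p1 p2] := chirped_cschwartz_map B.
by apply: cintegral_op_nice; [exact: frozen_wave_tame|exact: p1.1|exact: p2.1].
Qed.

Lemma kernel_nice (f : S) (y : X) D : cnice (fun x => (cf_kernel alpha beta x y * f x) D).
Proof.
rewrite (_ : (fun _ => _) = fun x => \sum_(A : {set 'I_m})
    (chirp y * (-1) ^+ swaps A (symdiff A D)) *
    (frozen_wave A (x, y) * chirped (symdiff A D) f x)); last first.
  by apply/funext => x; exact: kernel_coord.
by apply: cnice_sum => A; apply: cnice_scale; exact: frozen_nice.
Qed.

Lemma kernel_integrable (f : S) (y : X) : cl_integrable (fun x => cf_kernel alpha beta x y * f x).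
Proof.
by move=> D; have [[c1 [K1 d1]] [c2 [K2 d2]]] := kernel_nice f y D;
  split; [exact: rn_integrable c1 d1|exact: rn_integrable c2 d2].
Qed.

Let cst_alpha : C := (pi%:C%C * (1 - expi (- (2 * alpha)))) ^- m./2.

Lemma cf_transform_crn_int (f : S) (y : X) D : cf_transform alpha beta f y D =
  cst_alpha * crn_int (fun x => (cf_kernel alpha beta x y * f x) D).
Proof. by rewrite /cf_transform [LHS]ffunE [X in _ * X]ffunE. Qed.

Lemma cf_transform_coord (f : S) (y : X) D : cf_transform alpha beta f y D =
  \sum_(A : {set 'I_m}) (cst_alpha * (-1) ^+ swaps A (symdiff A D)) *
    (chirp y * cintegral_op (frozen_wave A) (chirped (symdiff A D) f) y).
Proof.
rewrite cf_transform_crn_int (_ : (fun _ => _) = fun x => \sum_(A : {set 'I_m})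
    (chirp y * (-1) ^+ swaps A (symdiff A D)) *
    (frozen_wave A (x, y) * chirped (symdiff A D) f x)); last first.
  by apply/funext => x; exact: kernel_coord.
rewrite crn_int_sum; last by move=> A; apply: cnice_scale; exact: frozen_nice.
rewrite mulr_sumr; apply: eq_bigr => A _.
rewrite crn_int_scale; last exact: frozen_nice.
rewrite -/(cintegral_op (frozen_wave A) (chirped (symdiff A D) f) y).
move: cst_alpha (chirp y) (_ ^+ _) (cintegral_op _ _ _) => a b d e.
by clear; ring.
Qed.

Lemma cf_transform_cschwartz_map D : cschwartz_map (fun f : S => fun y => cf_transform alpha beta f y D).
Proof.
rewrite (_ : (fun _ => _) = fun (f : S) (y : X) =>
  \sum_(A : {set 'I_m}) (cst_alpha * (-1) ^+ swaps A (symdiff A D)) *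
    (chirp y * cintegral_op (frozen_wave A) (chirped (symdiff A D) f) y)); last first.
  by apply/funext => f; apply/funext => y; exact: cf_transform_coord.
have tA A : cschwartz_map (fun (f : S) (y : X) => (cst_alpha * (-1) ^+ swaps A (symdiff A D)) *
    (chirp y * cintegral_op (frozen_wave A) (chirped (symdiff A D) f) y)).
  apply: cschwartz_map_mul; first exact: ctame_cst.
  apply: cschwartz_map_mul; first exact: chirp_tame.
  have [q1 q2] := frozen_wave_oscillating A.
  exact: cschwartz_map_integral_op freq_neq0 q1 q2 (chirped_cschwartz_map _).
have H := cschwartz_map_sum (index_enum {set 'I_m}) tA.
exact: H.
Qed.

Lemma cf_transform_linear (a : C) (f g : S) (y : X) :
  cf_transform alpha beta (a *: f + g) y =
  a *: cf_transform alpha beta f y + cf_transform alpha beta g y.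
Proof.
apply/ffunP => D.
have -> : (a *: cf_transform alpha beta f y + cf_transform alpha beta g y) D =
    a * cf_transform alpha beta f y D + cf_transform alpha beta g y D.
  by move: (cf_transform _ _ f y) (cf_transform _ _ g y) => u v; rewrite !ffunE.
rewrite !cf_transform_crn_int.
have -> : (fun x => (cf_kernel alpha beta x y * (a *: f + g) x) D) = fun x =>
    a * (cf_kernel alpha beta x y * f x) D + (cf_kernel alpha beta x y * g x) D.
  apply/funext => x.
  have -> : (a *: f + g) x = a *: f x + g x by [].
  move: (cf_kernel _ _ _ _) (f x) (g x) => u v w.
  by rewrite mulrDr -scalerAr; move: (u * v) (u * w) => p q; rewrite !ffunE.
rewrite crn_int_add; [|apply: cnice_scale; exact: kernel_nice|exact: kernel_nice].
rewrite crn_int_scale; last exact: kernel_nice.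
move: cst_alpha (crn_int _) (crn_int _) => b d e.
by clear; ring.
Qed.

End Kernel.

(** This is where the excluded values of alpha enter. *)
Lemma sin_neq0 (R : realType) (alpha : R) : - pi <= alpha <= pi ->
  alpha != 0 -> alpha != pi -> alpha != - pi -> sin alpha != 0.
Proof.
move=> /andP[l u] a0 a1 a2.
have u' : alpha < pi by rewrite lt_neqAle a1.
have l' : - pi < alpha by rewrite lt_neqAle eq_sym a2.
case: (ltgtP alpha 0) a0 => // s _.
  rewrite -[alpha]opprK sinN oppr_eq0 gt_eqF// sin_gt0_pi// oppr_gt0 s/=.
  by rewrite ltrNl.
by rewrite gt_eqF// sin_gt0_pi// s.
Qed.

Theorem theorem6p5 (R : realType) (m : nat) (alpha beta : R)
    (m_ge2 : (2 <= m)%N) (m_even : ~~ odd m)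
    (alpha_itv : - pi <= alpha <= pi) (beta_itv : - pi <= beta <= pi)
    (alpha_neq0 : alpha != 0) (alpha_neqpi : alpha != pi)
    (alpha_neqNpi : alpha != - pi) :
  (forall x y : 'rV[R]_m,
     cl_reim_all (fun u : R^nat => cvgn u)
       (exp_Gamma_series beta (plane_wave alpha x) y)) /\
  (forall (f : schwartz R m) (y : 'rV[R]_m),
     cl_integrable (fun x => cf_kernel alpha beta x y * f x)) /\
  (exists2 F : {linear schwartz R m -> schwartz R m},
     continuous F &
     forall f : schwartz R m, F f = cf_transform alpha beta f :> (_ -> _)).
Proof.
have sin0 := sin_neq0 alpha_itv alpha_neq0 alpha_neqpi alpha_neqNpi.
(* the index k = m / 2 - 1 of the wave pair *)
have mE : m = (2 * (m./2).-1 + 2)%N.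
  have m2 : (0 < m./2)%N by rewrite half_gt0.
  rewrite -[LHS]odd_double_half (negPf m_even) add0n -{1}(prednK m2).
  by rewrite doubleS mul2n addn2.
split; first by move=> x y A; have [l1 l2] := exp_Gamma_limits beta mE sin0 x y A;
  split; [exact: cvgP l1|exact: cvgP l2].
split; first by move=> f y; exact: kernel_integrable mE sin0 f y.
apply: continuous_operator; first by move=> A; exact: cf_transform_cschwartz_map mE sin0 A.
by move=> a f g x; exact: cf_transform_linear mE sin0 a f g x.
Qed.
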